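(* Let $G\le\mathrm{GL}_4(\mathbb{Z})$ be the finite group with GAP ID $[4,33,2,1]$, generated by $$A=\begin{pmatrix}0&0&-1&0\\-1&0&0&0\\1&1&1&-2\\0&1&0&-1\end{pmatrix},\qquad B=\begin{pmatrix}0&1&0&-1\\0&0&-1&1\\-1&0&0&1\\0&1&0&0\end{pmatrix}.$$ Then the corresponding $G$-lattice $M_G$ is quasi-invertible but not quasi-permutation, and hence the associated algebraic torus is retract rational but not stably rational.
   Context: All fields $k$ have characteristic $0$. $M_G=\mathbb{Z}^4$ (row vectors, standard basis $\mathbf e_i$) with $g=(a_{ij})$ acting by $\mathbf e_i\mapsto\sum_ja_{ij}\mathbf e_j$. A permutation $G$-lattice is one with a $\mathbb{Z}$-basis permuted by $G$; an invertible lattice is a direct summand of a permutation lattice. A $G$-lattice $M$ is quasi-permutation (resp. quasi-invertible) if there is an exact sequence of $G$-lattices $0\to M\to P\to Q\to0$ with $P$ permutation and $Q$ permutation (resp. invertible). The associated torus is $\mathrm{Spec}(L[M_G]^G)$ for a Galois extension $L/k$ with group $G$; it is stably rational iff $M_G$ is quasi-permutation and retract rational iff $M_G$ is quasi-invertible (known theorems of Endo–Miyata, Voskresenskii and Saltman). The GAP ID refers to MatGroupZClass(4,33,2,1) in the GAP library of crystallographic groups. *)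

(* Defs.v *)
From HB Require Import structures.
From mathcomp Require Import all_boot all_order all_algebra all_fingroup.
From mathcomp Require Import all_field all_character fraction.
From mathcomp Require Import finmap mpoly monalg.
From mathcomp Require Import boolp.

Set Implicit Arguments.
Unset Strict Implicit.
Unset Printing Implicit Defensive.

Import GRing.Theory.
Local Open Scope ring_scope.

(* monalg and mpoly both define this notation; the type of mpoly is the one
   which carries the integral domain structure. *)
Notation "{ 'mpoly' T [ n ] }" := (mpoly.mpoly n T) : type_scope.

(* A G-lattice of rank n is [M : mx_representation int G n]: the lattice is
   Z^n (row vectors) and g acts on the right by v |-> v *m M g, so that the
   i-th basis vector is sent to the i-th row of M g. *)

Section Lattices.

Context {gT : finGroupType} {G : {group gT}}.

Definition permutation_lattice n (P : mx_representation int G n) : Prop :=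
  exists2 U : 'M[int]_n, U \in unitmx &
    forall g, g \in G -> forall i, exists j, row i U *m P g = row j U.

Definition equivariant m n (M : mx_representation int G m)
    (N : mx_representation int G n) (f : 'M[int]_(m, n)) : Prop :=
  forall g, g \in G -> M g *m f = f *m N g.

Definition lattice_iso m n (M : mx_representation int G m)
    (N : mx_representation int G n) : Prop :=
  exists (f : 'M[int]_(m, n)) (f' : 'M[int]_(n, m)),
    [/\ equivariant M N f, f *m f' = 1%:M & f' *m f = 1%:M].

Section DirectSum.
Variables (m n : nat).
Variables (M : mx_representation int G m) (N : mx_representation int G n).

Definition dsum_mx (g : gT) : 'M[int]_(m + n) := block_mx (M g) 0 0 (N g).

Lemma dsum_mx_repr : mx_repr G dsum_mx.
Proof.
split=> [|g h Gg Gh]; rewrite /dsum_mx; first by rewrite !repr_mx1 -scalar_mx_block.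
by rewrite mulmx_block !mul0mx !mulmx0 !addr0 !add0r !repr_mxM.
Qed.

Definition dsum_lattice := MxRepresentation dsum_mx_repr.
End DirectSum.

Definition invertible_lattice n (M : mx_representation int G n) : Prop :=
  exists m (N : mx_representation int G m) p (P : mx_representation int G p),
    permutation_lattice P /\ lattice_iso (dsum_lattice M N) P.

(* 0 -> M -> P -> Q -> 0 *)
Definition short_exact l m n (M : mx_representation int G l)
    (P : mx_representation int G m) (Q : mx_representation int G n)
    (i : 'M[int]_(l, m)) (q : 'M[int]_(m, n)) : Prop :=
  [/\ equivariant M P i, equivariant P Q q,
      injective (fun x : 'rV[int]_l => x *m i),
      (forall y : 'rV[int]_m, y *m q = 0 <-> exists x : 'rV[int]_l, y = x *m i)
    & forall z : 'rV[int]_n, exists y : 'rV[int]_m, z = y *m q].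

Definition quasi_permutation l (M : mx_representation int G l) : Prop :=
  exists m (P : mx_representation int G m) n (Q : mx_representation int G n) i q,
    [/\ permutation_lattice P, permutation_lattice Q & short_exact M P Q i q].

Definition quasi_invertible l (M : mx_representation int G l) : Prop :=
  exists m (P : mx_representation int G m) n (Q : mx_representation int G n) i q,
    [/\ permutation_lattice P, invertible_lattice Q & short_exact M P Q i q].

End Lattices.

(* Rationality of the integral affine k-scheme Spec R, where R is a k-algebra
   through iota; its function field is {fraction R}. *)

Section Rationality.

Variables (k : fieldType) (R : idomainType) (iota : {rmorphism k -> R}).

Local Notation ratfun n := {fraction {mpoly k[n]}}.
Local Notation K := {fraction R}.

Definition ratconst n (c : k) : ratfun n := tofrac (c%:MP_[n]).
Definition funconst (c : k) : K := tofrac (iota c).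

(* Spec R x A^m is k-birational to A^n for some m and n:
   K(y_1, .., y_m) is k-isomorphic to k(x_1, .., x_n). *)
Definition stably_rational : Prop :=
  exists m n (theta : {rmorphism ratfun n -> {fraction {mpoly K[m]}}}),
    bijective theta /\
    forall c : k, theta (ratconst n c) = tofrac ((funconst c)%:MP_[m]).

(* The localized polynomial ring k[x_1, .., x_n][1/f]. *)
Definition localized n (f : {mpoly k[n]}) (u : ratfun n) : Prop :=
  exists (p : {mpoly k[n]}) (e : nat), u = tofrac p / tofrac f ^+ e.

Definition subring_set (A : fieldType) (S : A -> Prop) : Prop :=
  [/\ S 1, forall x y, S x -> S y -> S (x - y)
    & forall x y, S x -> S y -> S (x * y)].

(* The restriction of h to the subring S is a ring homomorphism into T; values
   of h outside S are irrelevant. *)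
Definition hom_on (A B : fieldType) (S : A -> Prop) (T : B -> Prop)
    (h : A -> B) : Prop :=
  [/\ forall x, S x -> T (h x), h 1 = 1,
      forall x y, S x -> S y -> h (x - y) = h x - h y
    & forall x y, S x -> S y -> h (x * y) = h x * h y].

(* Saltman's definition: K is the fraction field of a k-subalgebra S whose
   identity factors as S -> k[x_1, .., x_n][1/f] -> S through k-algebra
   homomorphisms, for some nonzero polynomial f. *)
Definition retract_rational : Prop :=
  exists S : K -> Prop,
    [/\ subring_set S, forall c : k, S (funconst c),
        forall x : K, exists a b : K, [/\ S a, S b, b != 0 & x = a / b]
      & exists n (f : {mpoly k[n]}) (phi : K -> ratfun n) (psi : ratfun n -> K),
          [/\ f != 0,
              hom_on S (localized f) phi
                /\ (forall c, phi (funconst c) = ratconst n c),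
              hom_on (localized f) S psi
                /\ (forall c, psi (ratconst n c) = funconst c)
            & forall x, S x -> psi (phi x) = x]].

End Rationality.

(* The torus of a G-lattice M split by a Galois extension L/k whose group is
   identified with G by phi. The group algebra L[M] is the Laurent polynomial
   ring L[x_1, x_1^-1, .., x_n, x_n^-1], realized inside L(x_1, .., x_n), with v in Z^n
   written x^v. *)

Section Torus.

Variables (k : fieldType) (L : splittingFieldType k).
Variables (gT : finGroupType) (G : {group gT}).
Variable phi : {morphism G >-> gal_of {:L}}.
Variables (n : nat) (M : mx_representation int G n).

Local Notation LM := {malg L['rV[int]_n]}.
Local Notation F := {fraction {mpoly L[n]}}.
Local Notation "a @_ v" := (monalg.mcoeff v a) : ring_scope.

Definition char_mon (v : 'rV[int]_n) : F := \prod_(i < n) tofrac 'X_i ^ (v 0 i).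
Definition lconst (c : L) : F := tofrac (c%:MP_[n]).

(* The element \sum_v a_v x^v of L[M]. *)
Definition laurent (a : LM) : F := monalg.mmap lconst char_mon a.

(* g sends a_v x^v to (a_v)^g x^(v g), so \sum_v a_v x^v is fixed by g iff
   a_(v g) = (a_v)^g for every v. *)
Definition torus_inv (a : LM) : Prop :=
  forall g, g \in G -> forall v : 'rV[int]_n, a@_(v *m M g) = phi g a@_v.

Definition torus_pred : {pred F} :=
  fun x => `[< exists2 a : LM, torus_inv a & x = laurent a >].

Lemma torus_predP x :
  reflect (exists2 a : LM, torus_inv a & x = laurent a) (x \in torus_pred).
Proof. exact: asboolP. Qed.

Lemma char_mon0 : char_mon 0 = 1.
Proof. by rewrite /char_mon big1 // => i _; rewrite mxE expr0z. Qed.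

Lemma char_monD u v : char_mon (u + v) = char_mon u * char_mon v.
Proof.
rewrite /char_mon -big_split /=; apply: eq_bigr => i _.
by rewrite mxE expfzDr // tofrac_eq0 -msize_poly_eq0 msizeX.
Qed.

Lemma lconst_is_zmod_morphism : zmod_morphism lconst.
Proof. by move=> x y; rewrite /lconst mpoly.mpolyCB rmorphB. Qed.
HB.instance Definition _ := GRing.isZmodMorphism.Build L F lconst
  lconst_is_zmod_morphism.
Lemma lconst_is_monoid_morphism : monoid_morphism lconst.
Proof. by split=> [|x y]; rewrite /lconst ?mpoly.mpolyC1 ?rmorph1 // mpoly.mpolyCM rmorphM. Qed.
HB.instance Definition _ := GRing.isMonoidMorphism.Build L F lconst
  lconst_is_monoid_morphism.

Lemma laurentU c v : laurent << c *g v >> = lconst c * char_mon v.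
Proof. exact: mmapU. Qed.

Lemma laurent_is_zmod_morphism : zmod_morphism laurent.
Proof. exact: raddfB. Qed.
HB.instance Definition _ := GRing.isZmodMorphism.Build LM F laurent
  laurent_is_zmod_morphism.

Definition convol (a b : LM) : LM :=
  \sum_(u <- msupp a) \sum_(v <- msupp b) << a@_u * b@_v *g u + v >>.

Lemma laurentM a b : laurent (convol a b) = laurent a * laurent b.
Proof.
rewrite /convol raddf_sum /= [in RHS](monalgE a) [in RHS](monalgE b).
rewrite !raddf_sum mulr_suml; apply: eq_bigr => u _.
rewrite raddf_sum mulr_sumr; apply: eq_bigr => v _ /=.
by rewrite !laurentU rmorphM char_monD mulrACA.
Qed.

Lemma convolE a b w :
  (convol a b)@_w = \sum_(u <- msupp a) a@_u * b@_(w - u).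
Proof.
rewrite /convol raddf_sum; apply: eq_bigr => u _ /=.
rewrite raddf_sum /= (eq_bigr (fun v => a@_u * b@_v *+ (v == w - u))).
  have [vb|vNb] := boolP (w - u \in msupp b).
    rewrite (big_fsetD1 (w - u)) //= eqxx mulr1n big1_fset ?addr0 // => v.
    by rewrite in_fsetD1 => /andP[/negPf->].
  rewrite (mcoeff_outdom vNb) mulr0 big1_fset // => v vb _.
  by case: eqP vb vNb => [->|] // -> .
by move=> v _; rewrite mcoeffU [v == _]eq_sym subr_eq eq_sym addrC.
Qed.

Lemma torus_invB a b : torus_inv a -> torus_inv b -> torus_inv (a - b).
Proof. by move=> aG bG g Gg v; rewrite !mcoeffB aG // bG // rmorphB. Qed.

Lemma torus_invU c v0 :
  (forall g, g \in G -> phi g c = c /\ v0 *m M g = v0) ->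
  torus_inv << c *g v0 >>.
Proof.
move=> cG g Gg v; have [c_g v_g] := cG g Gg.
have Mu: M g \in unitmx by apply: repr_mx_unit.
rewrite !mcoeffU rmorphMn /= c_g; congr (_ *+ _).
by rewrite -{1}v_g (inj_eq (can_inj (mulmxK Mu))).
Qed.

Lemma torus_invM a b : torus_inv a -> torus_inv b -> torus_inv (convol a b).
Proof.
move=> aG bG g Gg w; have Mu: M g \in unitmx by apply: repr_mx_unit.
have Mi := can_inj (mulmxK (n := n) (m := 1) Mu).
rewrite !convolE rmorph_sum /=.
have eqs : perm_eq (msupp a) [seq v *m M g | v <- msupp a].
  apply: uniq_perm; rewrite ?map_inj_uniq ?fset_uniq // => v.
  rewrite -[v](mulmxKV Mu) (mem_map (f := mulmxr (M g)) Mi).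
  by rewrite -!mcoeff_neq0 aG // fmorph_eq0.
rewrite (perm_big _ eqs) big_map; apply: eq_bigr => u _.
by rewrite -mulmxBl aG // bG // rmorphM.
Qed.

Lemma torus_subring : GRing.subring_closed torus_pred.
Proof.
split=> [|x y|x y].
- apply/torus_predP; exists << 1 *g 0 >>.
    by apply: torus_invU => g Gg; rewrite rmorph1 mul0mx.
  by rewrite laurentU rmorph1 char_mon0 mulr1.
- move=> /torus_predP[a aG ->] /torus_predP[b bG ->].
  by apply/torus_predP; exists (a - b); [exact: torus_invB | rewrite raddfB].
move=> /torus_predP[a aG ->] /torus_predP[b bG ->].
by apply/torus_predP; exists (convol a b); [exact: torus_invM | rewrite laurentM].
Qed.
HB.instance Definition _ := GRing.isSubringClosed.Build F torus_pred
  torus_subring.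

(* The coordinate ring L[M]^G of the torus Spec (L[M]^G). *)
Record torus_ring := TorusRing { torus_val :> F; _ : torus_val \in torus_pred }.
HB.instance Definition _ := [isSub for torus_val].
HB.instance Definition _ := [Choice of torus_ring by <:].
HB.instance Definition _ := [SubChoice_isSubComNzRing of torus_ring by <:].

(* Units of an arbitrary subring of a field, needed for the structure of an
   integral domain in the library. *)
Definition torus_unit : {pred torus_ring} :=
  fun x => (val x != 0) && ((val x)^-1 \in torus_pred).
Definition torus_invr (x : torus_ring) : torus_ring :=
  if x \in torus_unit then insubd x (val x)^-1 else x.

Lemma torus_mulVx : {in torus_unit, left_inverse 1 torus_invr *%R}.
Proof.
move=> x ux; rewrite /torus_invr ux; have /andP[x0 xV] := ux.
by apply: val_inj; rewrite rmorphM rmorph1 /= insubdK // mulVf.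
Qed.
Lemma torus_unitPl (x y : torus_ring) : y * x = 1 -> torus_unit x.
Proof.
move=> /(congr1 val); rewrite rmorphM rmorph1 /= => yx1.
have x0 : val x != 0.
  by apply/eqP => x0; move/eqP: yx1; rewrite x0 mulr0 eq_sym oner_eq0.
suff xV : (val x)^-1 = val y by rewrite /torus_unit x0 xV; exact: valP.
by apply: (mulIf x0); rewrite mulVf.
Qed.
Lemma torus_invr_out : {in [predC torus_unit], torus_invr =1 id}.
Proof. by move=> x; rewrite inE /torus_invr => /negPf->. Qed.
HB.instance Definition _ := GRing.ComNzRing_hasMulInverse.Build torus_ring
  torus_mulVx torus_unitPl torus_invr_out.

Lemma torus_integral (x y : torus_ring) : x * y = 0 -> (x == 0) || (y == 0).
Proof.
move=> /(congr1 val); rewrite rmorphM rmorph0 /= => /eqP.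
by rewrite mulf_eq0 -!(inj_eq val_inj) rmorph0.
Qed.
HB.instance Definition _ := GRing.ComUnitRing_isIntegral.Build torus_ring
  torus_integral.

Lemma torus_const_subproof (c : k) : lconst c%:A \in torus_pred.
Proof.
apply/torus_predP; exists << c%:A *g 0 >>; last first.
  by rewrite laurentU char_mon0 mulr1.
by apply: torus_invU => g Gg; rewrite mul0mx linearZ /= rmorph1.
Qed.

Definition torus_const (c : k) : torus_ring := TorusRing (torus_const_subproof c).

Lemma torus_const_is_zmod_morphism : zmod_morphism torus_const.
Proof.
by move=> x y; apply: val_inj; rewrite raddfB /= scalerBl raddfB.
Qed.
HB.instance Definition _ := GRing.isZmodMorphism.Build k torus_ring torus_const
  torus_const_is_zmod_morphism.
Lemma torus_const_is_monoid_morphism : monoid_morphism torus_const.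
Proof.
split=> [|x y]; apply: val_inj; first by rewrite rmorph1 /= scale1r rmorph1.
by rewrite [RHS]rmorphM /= -rmorphM -scalerAl mul1r scalerA.
Qed.
HB.instance Definition _ := GRing.isMonoidMorphism.Build k torus_ring torus_const
  torus_const_is_monoid_morphism.

End Torus.

(* The subgroup of GL_n(Z) generated by a set S of matrices. *)
Inductive generated n (S : 'M[int]_n -> Prop) : 'M[int]_n -> Prop :=
| gen_in x : S x -> generated S x
| gen_one : generated S 1%:M
| gen_mul x y : generated S x -> generated S y -> generated S (x *m y)
| gen_inv x : generated S x -> generated S (invmx x).

Definition mx_rows (s : seq (seq int)) : 'M[int]_4 :=
  \matrix_(i < 4, j < 4) nth 0 (nth [::] s i) j.

Definition rowsA : seq (seq int) :=
  [:: [:: 0; 0; -1; 0]; [:: -1; 0; 0; 0]; [:: 1; 1; 1; -2]; [:: 0; 1; 0; -1]].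
Definition rowsB : seq (seq int) :=
  [:: [:: 0; 1; 0; -1]; [:: 0; 0; -1; 1]; [:: -1; 0; 0; 1]; [:: 0; 1; 0; 0]].

Definition mxA : 'M[int]_4 := mx_rows rowsA.
Definition mxB : 'M[int]_4 := mx_rows rowsB.

Definition G_pred : {pred 'M[int]_4} :=
  fun x => `[< generated (fun y => y = mxA \/ y = mxB) x >].

Lemma G_predP x :
  reflect (generated (fun y => y = mxA \/ y = mxB) x) (x \in G_pred).
Proof. exact: asboolP. Qed.

(* The group with GAP ID [4,33,2,1]. *)
Record G_4_33_2_1 := MkG { G_mx :> 'M[int]_4; _ : G_mx \in G_pred }.
HB.instance Definition _ := [isSub for G_mx].
HB.instance Definition _ := [Countable of G_4_33_2_1 by <:].

(* Its 24 elements, as products of powers of ABBAB (of order 3) and of A (of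
   order 8), to show that it is finite. *)
Definition rows_mul (s t : seq (seq int)) : seq (seq int) :=
  [seq [seq nth 0 (nth [::] s i) 0 * nth 0 (nth [::] t 0) j
          + nth 0 (nth [::] s i) 1 * nth 0 (nth [::] t 1) j
          + nth 0 (nth [::] s i) 2 * nth 0 (nth [::] t 2) j
          + nth 0 (nth [::] s i) 3 * nth 0 (nth [::] t 3) j
        | j <- iota 0 4] | i <- iota 0 4].
Definition rows1 : seq (seq int) :=
  [seq [seq (i == j)%:R | j <- iota 0 4] | i <- iota 0 4].
Definition rowsC : seq (seq int) :=
  rows_mul rowsA (rows_mul rowsB (rows_mul rowsB (rows_mul rowsA rowsB))).
Definition G_rows : seq (seq (seq int)) :=
  [seq rows_mul (iter i (rows_mul rowsC) rows1) (iter j (rows_mul rowsA) rows1)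
  | i <- iota 0 3, j <- iota 0 8].

Lemma mx_rowsM s t : mx_rows (rows_mul s t) = mx_rows s *m mx_rows t.
Proof.
apply/matrixP=> i j; rewrite !mxE !big_ord_recl big_ord0 /= !mxE addr0 !addrA.
rewrite (nth_map 0) ?size_iota // (nth_map 0) ?size_iota //.
by rewrite !nth_iota.
Qed.

Lemma mx_rows1 : mx_rows rows1 = 1%:M.
Proof.
apply/matrixP=> i j; rewrite !mxE (nth_map 0) ?size_iota //.
by rewrite (nth_map 0) ?size_iota // !nth_iota.
Qed.

Lemma G_rows_mul : all2rel (fun s t => rows_mul s t \in G_rows) G_rows.
Proof. by vm_compute. Qed.

Lemma G_rows_inv :
  all (fun s => has (fun t => rows_mul s t == rows1) G_rows) G_rows.
Proof. by vm_compute. Qed.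

Lemma G_finite x : x \in G_pred -> x \in [seq mx_rows s | s <- G_rows].
Proof.
move=> /G_predP; elim=> [y [] -> ||y z _ /mapP[s sG ->] _ /mapP[t tG ->]|
    y _ /mapP[s sG ->]].
- by apply: map_f; vm_compute.
- by apply: map_f; vm_compute.
- by rewrite -mx_rows1; apply: map_f; vm_compute.
- by rewrite -mx_rowsM; apply/map_f/(allrelP G_rows_mul).
have /hasP[t tG /eqP st1] := allP G_rows_inv s sG.
have st : mx_rows s *m mx_rows t = 1%:M by rewrite -mx_rowsM st1 mx_rows1.
have [su _] := mulmx1_unit st.
by rewrite -[invmx _]mulmx1 -st mulKmx // map_f.
Qed.

Lemma G_unitmx x : x \in G_pred -> x \in unitmx.
Proof.
move=> /G_finite/mapP[s sG ->].
have /hasP[t tG /eqP st1] := allP G_rows_inv s sG.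
by have [] := @mulmx1_unit _ _ (mx_rows s) (mx_rows t); rewrite -?mx_rowsM ?st1 ?mx_rows1.
Qed.

Definition G_enum : seq G_4_33_2_1 :=
  undup (pmap insub [seq mx_rows s | s <- G_rows]).

Lemma G_enumP : Finite.axiom G_enum.
Proof.
apply: Finite.uniq_enumP; first exact: undup_uniq.
by move=> x; rewrite mem_undup mem_pmap_sub G_finite // (valP x).
Qed.
HB.instance Definition _ := isFinite.Build G_4_33_2_1 G_enumP.

Lemma G_one_subproof : 1%:M \in G_pred.
Proof. by apply/G_predP; apply: gen_one. Qed.
Lemma G_mul_subproof (x y : G_4_33_2_1) : val x *m val y \in G_pred.
Proof. by apply/G_predP; apply: gen_mul; apply/G_predP; apply: valP. Qed.
Lemma G_inv_subproof (x : G_4_33_2_1) : invmx (val x) \in G_pred.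
Proof. by apply/G_predP; apply: gen_inv; apply/G_predP; apply: valP. Qed.

Definition G_one : G_4_33_2_1 := MkG G_one_subproof.
Definition G_mul (x y : G_4_33_2_1) : G_4_33_2_1 := MkG (G_mul_subproof x y).
Definition G_inv (x : G_4_33_2_1) : G_4_33_2_1 := MkG (G_inv_subproof x).

Lemma G_mulA : associative G_mul.
Proof. by move=> x y z; apply: val_inj; apply: mulmxA. Qed.
Lemma G_mul1 : left_id G_one G_mul.
Proof. by move=> x; apply: val_inj; apply: mul1mx. Qed.
Lemma G_mulV : left_inverse G_one G_inv G_mul.
Proof. by move=> x; apply: val_inj; apply: mulVmx; rewrite G_unitmx ?(valP x). Qed.
HB.instance Definition _ := Finite_isGroup.Build G_4_33_2_1 G_mulA G_mul1 G_mulV.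

Lemma M_G_repr : mx_repr [set: G_4_33_2_1] (fun g : G_4_33_2_1 => val g).
Proof. by []. Qed.

Definition M_G : mx_representation int [set: G_4_33_2_1] 4 :=
  MxRepresentation M_G_repr.

(* Main.v *)
Require Import Defs.
From HB Require Import structures.
From mathcomp Require Import all_boot all_order all_algebra all_fingroup all_solvable.
From mathcomp Require Import all_field all_character fraction.
From mathcomp Require Import finmap monalg mpoly boolp ring zify.

(** Let C = ABBAB, of order 3. The group G consists of the 24 elements C^i A^j, where
A has order 8, A^4 = -1 is central and A inverts C. In this comment c = A^4 and M is
the lattice of G, with character chi.

M is not quasi-permutation. For a permutation lattice on a set X, the number chi(1) -
chi(c) - chi(C) + chi(cC) counts the points of X fixed neither by c nor by C. The
cyclic group of order 8 generated by A acts freely on them, because each nontrivial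
subgroup contains c; so 8 divides this number, and it also does for a
quasi-permutation lattice, by additivity. For M the number is 12. Trivial summands do
not change it.

M is quasi-invertible. The first coordinate of Z^4 defines an embedding i of M in
Z[G]. Take a = e_0 - e_3 and b = e_1, so that a c = - a and b (1 + C + C^2) = 0. Then
i(a) = beta2 (1 - c) and i(b) = beta3 (1 - C) with beta2, beta3 in Z[G], and a
computation gives beta2 i(m) = 3 i(m) and beta3 i(m) = -2 i(m) for m in M. As 3 - 2 =
1, left multiplication by 1 - beta2 - beta3 kills i(M). Together with the projections
from G to the cosets of c and of C, it embeds Z[G] / M as a direct summand of a
permutation lattice of rank 24 + 12 + 8: the retraction is 1 on Z[G] and is given by
beta2 and beta3 on cosets, which is well defined modulo i(M).

The torus is retract rational. The same computation, done multiplicatively, gives an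
explicit section. Put u = (1 + z^a)(1 + z^b + z^-a) in L(M). The quotient of 1 + z^a
by its conjugate under c is z^a, and the quotient of 1 + z^b + z^-a by its conjugate
under C is z^b; hence the product over g of the g(u)^((m g^-1)_0) is z^(3 m - 2 m) =
z^m. So sending [g] to g(u) extends the characters from M to Z[G], and the torus is a
rational retract of the torus of Z[G], which is open in an affine space by Galois
descent (retract_rational_regular).

The torus is not stably rational. If the product T of the torus with an affine space
of dimension m is rational, then its function field over L is the fraction field of
two rings on which G acts: the Laurent polynomial ring A1 of M + Z^m, and the
polynomial ring A2 in coordinates defined over k. Both are factorial by the Gauss
lemma, and they become equal after inverting invariant elements. The units of the
common localization, modulo those of A1 or of A2, form permutation lattices on the
classes of primes that have become invertible (unit_lattice). Since A1^* / A2^* = M +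
Z^m, this lattice is quasi-permutation (quasi_permutation_two_models), which the trace
argument excludes. *)

Set Implicit Arguments.
Unset Strict Implicit.
Unset Printing Implicit Defensive.

Import Order.TTheory GRing.Theory Num.Theory.
Local Open Scope ring_scope.
Local Notation "{ 'mpoly' T [ n ] }" := (mpoly.mpoly n T) : type_scope.

(** * Unique factorization and the Gauss lemma *)

Section PrimeFactorization.
Variable R : idomainType.
Implicit Types (a b p u : R) (ps : seq R).

Definition divides a b := exists c, b = c * a.

(** Factorizations are into prime, not irreducible, elements: existence of such a
factorization then implies its uniqueness. *)
Definition prime_elt p :=
  [/\ p != 0, p \isn't a GRing.unit
    & forall a b, divides p (a * b) -> divides p a \/ divides p b].

Definition all_prime ps := forall p, p \in ps -> prime_elt p.

Definition factorable a := exists u ps,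
  [/\ u \is a GRing.unit, all_prime ps & a = u * \prod_(p <- ps) p].

Definition factorial_ring := forall a, a != 0 -> factorable a.

Lemma dividesMl a b c : divides a b -> divides a (c * b).
Proof. by move=> [d ->]; exists (c * d); rewrite mulrA. Qed.

Lemma divides_add a b c : divides a b -> divides a c -> divides a (b + c).
Proof. by move=> [d ->] [e ->]; exists (d + e); rewrite mulrDl. Qed.

Lemma dividesN a b : divides a b -> divides a (- b).
Proof. by move=> [d ->]; exists (- d); rewrite mulNr. Qed.

Lemma all_prime_cons p ps : all_prime (p :: ps) <-> prime_elt p /\ all_prime ps.
Proof.
split=> [h|[hp h] q]; last by rewrite inE => /orP[/eqP->|/h].
by split=> [|q q_ps]; apply: h; rewrite inE ?eqxx ?q_ps ?orbT.
Qed.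

(** A prime of the list divides x or y, so the primes can be dealt out one by one
between the two factors of a product. The count of primes is kept, since it is what
decreases when a common factor is removed from a polynomial. *)
Lemma factorable_split ps u x y :
  all_prime ps -> u \is a GRing.unit -> x * y = u * \prod_(p <- ps) p ->
  exists ux px uy py, [/\ ux \is a GRing.unit /\ uy \is a GRing.unit,
    all_prime px /\ all_prime py, x = ux * \prod_(p <- px) p,
    y = uy * \prod_(p <- py) p & (size px + size py = size ps)%N].
Proof.
elim: ps u x y => [|p ps IH] u x y pps uu.
  rewrite big_nil mulr1 => xyu; have : x * y \is a GRing.unit by rewrite xyu.
  rewrite unitrM => /andP[ux uy]; exists x, [::], y, [::].
  by rewrite big_nil !mulr1; split.
have [pp {}pps] := proj1 (all_prime_cons p ps) pps; have [p0 _ pP] := pp.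
rewrite big_cons mulrCA => e.
have [|[z xz]|[z yz]] := pP x y.
- by exists (u * \prod_(j <- ps) j); rewrite e mulrC.
- move: e; rewrite xz [z * p]mulrC -mulrA => /(mulfI p0) e.
  have [ux [px [uy [py [uuxy ppxy ex ey es]]]]] := IH _ _ _ pps uu e.
  exists ux, (p :: px), uy, py; split=> //.
  + by case: ppxy => ppx ppy; split=> //; apply/all_prime_cons; split.
  + by rewrite big_cons ex mulrCA.
  + by rewrite /= addSn es.
move: e; rewrite yz mulrA mulrC => /(mulfI p0) e.
have [ux [px [uy [py [uuxy ppxy ex ey es]]]]] := IH _ _ _ pps uu e.
exists ux, px, uy, (p :: py); split=> //.
+ by case: ppxy => ppx ppy; split=> //; apply/all_prime_cons; split.
+ by rewrite big_cons ey -mulrA [_ * p]mulrC.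
+ by rewrite /= addnS es.
Qed.

Lemma factorable_dvd x y : factorable (x * y) -> factorable x.
Proof.
move=> [u [ps [uu pps /(factorable_split pps uu)]]].
by move=> [ux [px [uy [py [[uux _] [ppx _] ex _ _]]]]]; exists ux, px.
Qed.

Lemma factorableM x y : factorable x -> factorable y -> factorable (x * y).
Proof.
move=> [u [ps [uu pps ->]]] [v [qs [uv pqs ->]]]; exists (u * v), (ps ++ qs).
split; first by rewrite unitrMl.
  by move=> p; rewrite mem_cat => /orP[/pps|/pqs].
by rewrite big_cat mulrACA.
Qed.

Lemma factorable_prime p : prime_elt p -> factorable p.
Proof.
move=> pp; exists 1, [:: p]; rewrite unitr1 big_seq1 mul1r.
by split=> // q; rewrite inE => /eqP->.
Qed.

Lemma factorable_unit u : u \is a GRing.unit -> factorable u.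
Proof. by move=> uu; exists u, [::]; rewrite big_nil mulr1. Qed.

End PrimeFactorization.

Lemma factorial_ring_iso (R S : idomainType) (f : {rmorphism R -> S}) :
  bijective f -> factorial_ring S -> factorial_ring R.
Proof.
move=> [g fK gK] fS a a0.
have f_inj := can_inj fK.
have gM x y : g (x * y) = g x * g y by apply: f_inj; rewrite rmorphM !gK.
have unit_g x : x \is a GRing.unit -> g x \is a GRing.unit.
  move=> ux; apply/unitrP; exists (g x^-1).
  by split; apply: f_inj; rewrite -gM gK ?mulVr ?mulrV ?rmorph1.
have [|u [ps [uu pps ea]]] := fS (f a); first by rewrite -(rmorph0 f) (inj_eq f_inj).
exists (g u), [seq g p | p <- ps]; split; first exact: unit_g.
  move=> _ /mapP[p /pps[p0 Up pP] ->]; split.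
  - by rewrite -(inj_eq f_inj) gK rmorph0.
  - by apply: contra Up => /(rmorph_unit f); rewrite gK.
  move=> x y [c e]; have [|[d ed]|[d ed]] := pP (f x) (f y).
  - by exists (f c); rewrite -rmorphM e rmorphM gK.
  - by left; exists (g d); apply: f_inj; rewrite ed -gM gK.
  by right; exists (g d); apply: f_inj; rewrite ed -gM gK.
apply: f_inj; rewrite ea rmorphM gK rmorph_prod big_map; congr (_ * _).
by apply: eq_bigr => p _; rewrite gK.
Qed.

Section Gauss.
Variable R : idomainType.
Hypothesis fR : factorial_ring R.
Implicit Types (f g h : {poly R}) (p : R).

Definition primitive f := forall p, prime_elt p -> ~ divides p%:P f.

(** The Gauss lemma: if p divides fg then it divides the product of the leading
coefficients, hence one of the leading terms; removing that term lowers the degree. *)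
Lemma prime_polyC p : prime_elt p -> prime_elt p%:P.
Proof.
move=> [p0 Up pP]; split; first by rewrite polyC_eq0.
  by rewrite poly_unitE coefC size_polyC p0.
suff H n f g : (size f + size g <= n)%N -> divides p%:P (f * g) ->
  divides p%:P f \/ divides p%:P g by move=> f g; apply: H (leqnn _).
have div0 : divides p%:P 0 by exists 0; rewrite mul0r.
have divC c m : divides p c -> divides p%:P (c *: 'X^m).
  by move=> [d ->]; exists (d *: 'X^m); rewrite [RHS]mulrC mul_polyC scalerA mulrC.
have sizeT (q : {poly R}) : q != 0 -> (size (q - lead_coef q *: 'X^((size q).-1))%R < size q)%N.
  move=> q0; have sq : (0 < size q)%N by rewrite size_poly_gt0.
  rewrite -[X in (_ < X)%N](prednK sq) ltnS; apply/leq_sizeP => j.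
  rewrite leq_eqVlt coefB coefZ coefXn => /orP[/eqP<-|lt_j].
    by rewrite eqxx mulr1 subrr.
  by rewrite gtn_eqF // mulr0 subr0 nth_default // -(prednK sq).
elim: n f g => [|n IH] f g le_n dfg.
  have f0 : f = 0.
    by apply/eqP; rewrite -size_poly_leq0; apply: leq_trans le_n; apply: leq_addr.
  by left; rewrite f0.
have [->|f0] := eqVneq f 0; first by left.
have [->|g0] := eqVneq g 0; first by right.
have /pP[df|dg] : divides p (lead_coef f * lead_coef g).
- rewrite -lead_coefM; have [c ->] := dfg.
  by rewrite lead_coefM lead_coefC; exists (lead_coef c).
- have dT : divides p%:P (lead_coef f *: 'X^((size f).-1)) by apply: divC.
  have [||d|] := IH (f - lead_coef f *: 'X^((size f).-1)) g.
  + by rewrite -ltnS; apply: leq_trans le_n; rewrite -addSn leq_add2r sizeT.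
  + rewrite mulrBl; apply: divides_add => //; apply: dividesN.
    by rewrite mulrC; apply: dividesMl.
  + by left; rewrite -[f](subrK (lead_coef f *: 'X^((size f).-1))); apply: divides_add.
  by right.
have dT : divides p%:P (lead_coef g *: 'X^((size g).-1)) by apply: divC.
have [|||d] := IH f (g - lead_coef g *: 'X^((size g).-1)).
- by rewrite -ltnS; apply: leq_trans le_n; rewrite -addnS leq_add2l sizeT.
- by rewrite mulrBr; apply: divides_add => //; apply/dividesN/dividesMl.
- by left.
by right; rewrite -[g](subrK (lead_coef g *: 'X^((size g).-1))); apply: divides_add.
Qed.

Lemma factorable_polyC (a : R) : a != 0 -> factorable a%:P.
Proof.
move=> /fR[u [ps [uu pps ->]]]; rewrite rmorphM rmorph_prod.
apply: factorableM; first by apply: factorable_unit; rewrite rmorph_unit.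
elim: ps pps => [|p ps IH] pps; rewrite ?big_nil ?big_cons.
  exact/factorable_unit/unitr1.
have [pp pps'] := proj1 (all_prime_cons p ps) pps.
by apply: factorableM (IH pps'); apply/factorable_prime/prime_polyC.
Qed.

(** Prime constants are divided out as long as there are any. The process stops
because each one uses up a prime factor of the leading coefficient. *)
Lemma primitive_part f : f != 0 ->
  exists (c : R) g, [/\ c != 0, primitive g & f = c%:P * g].
Proof.
move=> f0; have /fR[u [ps [uu pps]]] : lead_coef f != 0 by rewrite lead_coef_eq0.
have [n le_n] := ubnP (size ps); elim: n => // n IH in f f0 u ps uu pps le_n *.
move=> lf; have [[p [pp [h fh]]]|np] := pselect (exists p, prime_elt p /\ divides p%:P f).
  have h0 : h != 0 by apply: contraNneq f0 => h0; rewrite fh h0 mul0r.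
  have e : lead_coef h * p = u * \prod_(p <- ps) p by rewrite -lf fh lead_coefM lead_coefC.
  have [ux [px [uy [py [[uux uuy] [ppx ppy] ex ey es]]]]] := factorable_split pps uu e.
  have lt_px : (size px < n)%N.
    rewrite (leq_trans _ (le_n : (size ps <= n)%N)) // -es -addn1 leq_add2l lt0n size_eq0.
    by case: pp => _ /negP Up _; apply/eqP => py0; apply: Up; rewrite ey py0 big_nil mulr1.
  have [c [g [c0 pg hg]]] := IH h h0 ux px uux ppx lt_px ex.
  exists (c * p), g; split=> //; first by rewrite mulf_neq0 //; case: pp.
  by rewrite fh hg rmorphM mulrAC.
exists 1, f; split; rewrite ?oner_eq0 ?mul1r // => p pp pf.
by apply: np; exists p.
Qed.

(** Division over the fraction field costs a constant factor c. The primes of c divide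
q * f but, f being primitive, not f; so they can be cancelled from q. *)
Lemma primitive_dvdp f g : primitive f -> f %| g -> divides f g.
Proof.
move=> pf /Pdiv.Idomain.dvdpP[[c q] /= c0]; have [u [ps [uu pps ->]]] := fR c0.
elim: ps q pps => [|p ps IH] q pps.
  rewrite big_nil mulr1 => e; exists (u^-1 *: q).
  by rewrite -scalerAl -e scalerA mulVr // scale1r.
have [pp {}pps] := proj1 (all_prime_cons p ps) pps; rewrite big_cons => e.
have [_ _ ppP] := prime_polyC pp.
have [|[q' eq]|/(pf _ pp)//] := ppP q f.
  exists ((u * \prod_(j <- ps) j) *: g).
  by rewrite -e [RHS]mulrC mul_polyC scalerA [in LHS]mulrCA.
apply: (IH q' pps); have [p0 _ _] := pp.
have pP0 : p%:P != 0 by rewrite polyC_eq0.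
by apply: (mulfI pP0); rewrite [LHS]mul_polyC scalerA [in LHS]mulrCA e eq mulrAC mulrC.
Qed.

Lemma primitive_irreducible_prime f :
  primitive f -> irreducible_poly f -> prime_elt f.
Proof.
move=> pf fI; have [sf _] := fI; split.
- by rewrite -size_poly_gt0 (ltn_trans _ sf).
- by rewrite poly_unitE gtn_eqF.
move=> g h [c e].
have fgh : f %| g * h by rewrite e; apply: dvdp_mulIr.
have [fg|Nfg] := boolP (f %| g); first by left; apply: primitive_dvdp.
right; apply: primitive_dvdp => //.
by rewrite -(Gauss_dvdpr _ (q := g)) // irreducible_poly_coprime.
Qed.

(** Induction on the degree: a primitive polynomial is irreducible over the fraction
field, hence prime, or it is up to a constant a product of two polynomials of smaller
degree, and a divisor of a factorable element is factorable. *)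
Theorem factorial_ring_poly : factorial_ring {poly R}.
Proof.
move=> f; have [n] := ubnP (size f); elim: n f => // n IH f le_n f0.
have [c [g [c0 pg fg]]] := primitive_part f0.
rewrite fg; apply: factorableM; first exact: factorable_polyC.
have g0 : g != 0 by apply: contraNneq f0 => g0; rewrite fg g0 mulr0.
have sg : size f = size g by rewrite fg mul_polyC size_scale.
have [sg1|sg1] := leqP (size g) 1.
  rewrite (size1_polyC sg1); apply: factorable_polyC.
  by rewrite -polyC_eq0 -size1_polyC.
have [gI|gNI] := pselect (irreducible_poly g).
  exact/factorable_prime/primitive_irreducible_prime.
have [h [h1 hg hNg]] : exists h, [/\ size h != 1%N, h %| g & ~~ (h %= g)].
  apply/not_existsP => H; apply: gNI; split=> // h h1 hg.
  by apply/negPn/negP => hNg; apply: (H h).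
have h0 : h != 0 by apply: contraTneq hg => ->; rewrite dvd0p.
have lt_h : (size h < size g)%N.
  rewrite ltn_neqAle dvdp_leq // andbT; apply: contra hNg => /eqP e.
  by rewrite -(dvdp_size_eqp hg) e.
move: hg => /Pdiv.Idomain.dvdpP[[d q] /= d0 e].
have q0 : q != 0.
  apply: contraNneq g0 => q0; move/eqP: e.
  by rewrite q0 mul0r -mul_polyC mulf_eq0 polyC_eq0 (negPf d0).
have h2 : (1 < size h)%N by rewrite ltn_neqAle eq_sym h1 size_poly_gt0.
have lt_q : (size q < size g)%N.
  have <- : size (d *: g) = size g by rewrite size_scale.
  rewrite e size_mul // -(prednK (ltnW h2)) addnS /= -[X in (X < _)%N]addn0.
  by rewrite ltn_add2l -subn1 subn_gt0.
rewrite sg in le_n.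
have := factorableM (IH q (leq_trans lt_q le_n) q0) (IH h (leq_trans lt_h le_n) h0).
by rewrite -e -mul_polyC mulrC; apply: factorable_dvd.
Qed.
End Gauss.

Section MpolyFactorial.

Lemma mpoly_rmorph_ext n (R : comNzRingType) (S : comNzRingType)
    (f g : {rmorphism {mpoly R[n]} -> S}) :
  (forall c, f c%:MP_[n] = g c%:MP_[n]) -> (forall i, f 'X_i = g 'X_i) ->
  f =1 g.
Proof.
move=> fgC fgX p; rewrite [p]mpolyE !rmorph_sum; apply: eq_bigr => m _.
rewrite -mul_mpolyC !rmorphM fgC (mpolyXE_id R m) !rmorph_prod; congr (_ * _).
by apply: eq_bigr => i _; rewrite !rmorphXn fgX.
Qed.

Variable R : idomainType.

Let muniX n (i : 'I_n) : muni ('X_(widen_ord (leqnSn n) i) : {mpoly R[n.+1]}) = ('X_i)%:P.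
Proof.
rewrite /muni mmapX mmap1U; case: splitP => j /=; last first.
  by rewrite ord1 addn0 => e; have := ltn_ord i; rewrite e ltnn.
by move=> e; congr ('X__)%:P; apply/val_inj.
Qed.

Let muniXmax n : muni ('X_ord_max : {mpoly R[n.+1]}) = 'X.
Proof.
rewrite /muni mmapX mmap1U; case: splitP => j //= e.
by have := ltn_ord j; rewrite -e ltnn.
Qed.

(** Polynomials in n + 1 variables are polynomials in the last variable over the
polynomials in the others, so that factoriality passes from n to n + 1. *)
Lemma muni_bij n : bijective (@muni n R).
Proof.
have [h [hC hX]] : exists h : {rmorphism {poly {mpoly R[n]}} -> {mpoly R[n.+1]}},
    (forall c, h c%:P = mwiden c) /\ h 'X = 'X_ord_max.
  exists (horner_eval 'X_ord_max \o map_poly (@mwiden n R)).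
  by split=> [c|] /=; rewrite ?map_polyC ?map_polyX /horner_eval ?hornerC ?hornerX.
have wC c : muni (mwiden c) = c%:P :> {poly {mpoly R[n]}}.
  apply: (mpoly_rmorph_ext (f := @muni n R \o @mwiden n R) (g := polyC)) => [a|i] /=.
    by rewrite mwidenC muniC.
  rewrite mwidenX (_ : mnmwiden _ = U_(widen_ord (leqnSn n) i))%MM ?muniX //.
  exact: mnmwiden1.
exists h => [p|p].
  apply: (mpoly_rmorph_ext (f := h \o @muni n R) (g := idfun)) => [a|i] /=.
    by rewrite muniC hC mwidenC.
  case: (unliftP ord_max i) => [j ->|->]; last by rewrite muniXmax hX.
  have -> : lift ord_max j = widen_ord (leqnSn n) j by apply/val_inj/lift_max.
  by rewrite muniX hC mwidenX mnmwiden1.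
elim/poly_ind: p => [|p c IH]; first by rewrite !rmorph0.
by rewrite !(rmorphD, rmorphM) /= IH hX hC muniXmax wC.
Qed.

End MpolyFactorial.

Lemma mpoly_unitP (K : fieldType) n (p : {mpoly K[n]}) :
  reflect (exists2 c, c != 0 & p = c%:MP) (p \is a GRing.unit).
Proof.
apply: (iffP idP) => [/andP[/eqP e] |[c c0 ->]].
  by rewrite [_ \in _]unitfE => u; exists p@_0.
by apply/unitrP; exists c^-1%:MP; rewrite -!mpolyCM mulVf ?mulfV.
Qed.

Theorem factorial_ring_mpoly (K : fieldType) n : factorial_ring {mpoly K[n]}.
Proof.
elim: n => [|n IH]; last first.
  exact: factorial_ring_iso (muni_bij K n) (factorial_ring_poly IH).
move=> p p0; apply/factorable_unit/mpoly_unitP; exists (p@_0).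
  by apply: contraNneq p0 => e; rewrite [p]nvar0_mpolyC e mpolyC0.
exact: nvar0_mpolyC.
Qed.

(** * Factorial subrings of a field and their localizations *)

Section SubringFactorization.
Variable Om : fieldType.

Lemma subringD (A : Om -> Prop) x y : subring_set A -> A x -> A y -> A (x + y).
Proof.
move=> [A1 AB AM] Ax Ay; rewrite -[y]opprK; apply: (AB) => //.
by rewrite -sub0r; apply: (AB) => //; rewrite -(subrr 1); apply: (AB).
Qed.

Lemma subringM (A : Om -> Prop) x y : subring_set A -> A x -> A y -> A (x * y).
Proof. by move=> [_ _]; apply. Qed.

Lemma subringX (A : Om -> Prop) x n : subring_set A -> A x -> A (x ^+ n).
Proof.
move=> hA Ax; elim: n => [|n IH]; first by rewrite expr0; case: hA.
by rewrite exprS; apply: subringM.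
Qed.

(** Subrings of one fixed field are compared with one another below, so divisibility
of b by a in the subring A is expressed by A (b / a), and the localization A[1/h] is
again a subset of the field. *)
Definition localization (A : Om -> Prop) (h x : Om) := exists e, A (x * h ^+ e).

Lemma localization_common (A : Om -> Prop) h x y : subring_set A -> A h ->
  localization A h x -> localization A h y ->
  exists e, A (x * h ^+ e) /\ A (y * h ^+ e).
Proof.
move=> hA Ah [e Ax] [f Ay]; exists (e + f)%N; split.
  by rewrite exprD mulrA; apply: subringM => //; apply: subringX.
by rewrite addnC exprD mulrA; apply: subringM => //; apply: subringX.
Qed.

Lemma localization_subring (A : Om -> Prop) h :
  subring_set A -> A h -> subring_set (localization A h).
Proof.
move=> hA Ah; have [A1 AB _] := hA; split.
- by exists 0%N; rewrite expr0 mulr1.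
- move=> x y lx ly; have [e [Ax Ay]] := localization_common hA Ah lx ly.
  by exists e; rewrite mulrBl; apply: AB.
move=> x y [e Ax] [f Ay]; exists (e + f)%N.
by rewrite exprD mulrACA; apply: subringM.
Qed.

Lemma localization_sub (A : Om -> Prop) h x : A x -> localization A h x.
Proof. by exists 0%N; rewrite expr0 mulr1. Qed.

Lemma localization_inv (A : Om -> Prop) h : subring_set A -> h != 0 ->
  localization A h h^-1.
Proof. by move=> [A1 _ _] h0; exists 1%N; rewrite expr1 mulVf. Qed.

Section Fixed.
Variable A : Om -> Prop.
Hypothesis hA : subring_set A.
Implicit Types (x y u p : Om) (ps : seq Om).

Definition unit_in x := [/\ x != 0, A x & A x^-1].

(** Primality of p in the subring A, with a divisibility expressed by membership of
the quotient in A. *)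
Definition prime_in p := [/\ p != 0, A p, ~ A p^-1
  & forall a b, A a -> A b -> A (a * b / p) -> A (a / p) \/ A (b / p)].

Definition factorial_subring := forall x, A x -> x != 0 -> exists u ps,
  [/\ unit_in u, (forall p, p \in ps -> prime_in p) & x = u * \prod_(p <- ps) p].

Definition associate x y := unit_in (x / y).

Lemma unit_in1 : unit_in 1.
Proof. by case: hA => A1 _ _; split; rewrite ?oner_eq0 ?invr1. Qed.

Lemma unit_inM x y : unit_in x -> unit_in y -> unit_in (x * y).
Proof.
move=> [x0 Ax AVx] [y0 Ay AVy]; split; first by rewrite mulf_neq0.
  exact: subringM.
by rewrite invfM; apply: subringM.
Qed.

Lemma unit_inV x : unit_in x -> unit_in x^-1.
Proof. by move=> [x0 Ax AVx]; split; rewrite ?invr_eq0 ?invrK. Qed.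

Lemma unit_inX x (n : int) : unit_in x -> unit_in (x ^ n).
Proof.
move=> ux; have H m : unit_in (x ^+ m).
  elim: m => [|m IH]; first by rewrite expr0; apply: unit_in1.
  by rewrite exprS; apply: unit_inM.
by case: n => m; [apply: H | apply: (unit_inV (H m.+1))].
Qed.

Lemma associate_refl x : x != 0 -> associate x x.
Proof. by move=> x0; rewrite /associate divff //; apply: unit_in1. Qed.

Lemma associate_sym x y : associate x y -> associate y x.
Proof. by move/unit_inV; rewrite invfM invrK mulrC. Qed.

Lemma associate_trans x y z : associate x y -> associate y z -> associate x z.
Proof.
move=> xy yz; have [y0 _ _] := associate_sym xy.
have {y0} : y != 0 by apply: contraNneq y0 => ->; rewrite mul0r.
move=> y0; have := unit_inM xy yz; rewrite mulrA mulrVK //.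
by rewrite unitfE.
Qed.

Lemma associate_prime x p : prime_in p -> associate x p -> prime_in x.
Proof.
move=> [p0 Ap NAVp pP] [xp0 Axp Apx]; have x0 : x != 0.
  by apply: contraNneq xp0 => ->; rewrite mul0r.
have xE : x = x / p * p by rewrite mulfVK.
have Vx : p^-1 = x / p * x^-1 by field; rewrite x0 p0.
have Vp : x^-1 = (x / p)^-1 * p^-1 by field; rewrite x0 p0.
split=> //; first by rewrite xE; apply: subringM.
  by move=> AVx; apply: NAVp; rewrite Vx; apply: subringM.
move=> a b Aa Ab Aabx; have [|||aP|bP] := pP a b => //.
- by rewrite Vx mulrCA; apply: subringM.
- by left; rewrite Vp mulrCA; apply: subringM.
by right; rewrite Vp mulrCA; apply: subringM.
Qed.

Lemma prime_dvd_prod p ps : prime_in p -> (forall q, q \in ps -> A q) ->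
  A (\prod_(q <- ps) q / p) -> exists2 q, q \in ps & A (q / p).
Proof.
move=> [p0 Ap NAVp pP]; elim: ps => [|q ps IH] Aps.
  by rewrite big_nil mul1r.
have Aps' r : r \in ps -> A r by move=> r_ps; apply: Aps; rewrite inE r_ps orbT.
rewrite big_cons => d; have [|||Aqp|/(IH Aps')[r r_ps Arp]] := pP q (\prod_(r <- ps) r).
- by apply: Aps; rewrite inE eqxx.
- elim: (ps) Aps' => [|r s IHs] As; first by rewrite big_nil; case: hA.
  rewrite big_cons; apply: subringM => //; first by apply: As; rewrite inE eqxx.
  by apply: IHs => t t_s; apply: As; rewrite inE t_s orbT.
- by [].
- by exists q; rewrite ?inE ?eqxx.
by exists r; rewrite ?inE ?r_ps ?orbT.
Qed.

Lemma prime_dvd_associate p q : prime_in p -> prime_in q -> A (q / p) -> associate q p.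
Proof.
move=> [p0 Ap NAVp _] [q0 Aq NAVq qP] Aqp; split=> //.
  by rewrite mulf_neq0 ?invr_eq0.
have [||||//] := qP p (q / p); rewrite ?invfM ?invrK //.
- by rewrite mulrCA mulfV // mulr1 mulfV //; case: hA.
- by rewrite mulrC.
by rewrite mulrAC mulfV // mul1r.
Qed.

(** A prime of the list divides x or y, and dividing it out of that factor shortens
the list. Membership in ps is kept, as only the classes of these primes matter. *)
Lemma primes_split ps x y :
  (forall p, p \in ps -> prime_in p) -> A x -> A y ->
  associate (x * y) (\prod_(p <- ps) p) ->
  exists u px, [/\ unit_in u, {subset px <= ps} & x = u * \prod_(p <- px) p].
Proof.
elim: ps x y => [|p ps IH] x y pps Ax Ay.
  rewrite big_nil => -[xy0 _ AV]; exists x, [::]; rewrite big_nil mulr1; split=> //.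
  rewrite divr1 in AV xy0; move: xy0; rewrite mulf_eq0 => /norP[x0 y0].
  split=> //; have -> : x^-1 = y * (x * y)^-1 by field; rewrite y0 x0.
  exact: subringM.
have pp : prime_in p by apply: pps; rewrite inE eqxx.
have pps' q : q \in ps -> prime_in q by move=> q_ps; apply: pps; rewrite inE q_ps orbT.
have [p0 Ap NAVp pP] := pp; rewrite big_cons => uxy.
have prodA : A (\prod_(q <- ps) q).
  elim: (ps) pps' => [|r s IHs] As; first by rewrite big_nil; case: hA.
  rewrite big_cons; apply: subringM => //; last first.
    by apply: IHs => t t_s; apply: As; rewrite inE t_s orbT.
  by have [] := As r; rewrite // inE eqxx.
have prod0 : \prod_(q <- ps) q != 0.
  rewrite prodf_seq_neq0; apply/allP => q /pps'[q0 _ _ _].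
  by rewrite q0 implybT.
have [|||Axp|Ayp] := pP x y => //.
- have [_ Ae _] := uxy.
  have -> : x * y / p = x * y / (p * \prod_(q <- ps) q) * \prod_(q <- ps) q.
    by field; rewrite p0 prod0.
  exact: subringM.
- have [|u [px [uu px_ps e]]] := IH (x / p) y pps' Axp Ay.
    rewrite /associate (_ : _ / _ = x * y / (p * \prod_(q <- ps) q)) //.
    by field; rewrite p0 prod0.
  exists u, (p :: px); split=> //.
    by move=> q; rewrite !inE => /orP[->//|/px_ps->]; rewrite orbT.
  by rewrite big_cons mulrCA -e mulrC mulfVK.
have [|u [px [uu px_ps e]]] := IH x (y / p) pps' Ax Ayp.
  rewrite /associate (_ : _ / _ = x * y / (p * \prod_(q <- ps) q)) //.
  by field; rewrite p0 prod0.
by exists u, px; split=> // q /px_ps q_ps; rewrite inE q_ps orbT.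
Qed.

End Fixed.

Lemma localization_prime A h p : subring_set A -> A h -> h != 0 ->
  prime_in A p -> unit_in (localization A h) p \/ prime_in (localization A h) p.
Proof.
move=> hA Ah h0 [p0 Ap NAVp pP].
have [lVp|NlVp] := pselect (localization A h p^-1).
  by left; split=> //; apply: localization_sub.
right; split=> //; first exact: localization_sub.
move=> a b [e Aa] [f Ab] [g Aabp].
have [|||l|l] := pP (a * h ^+ (e + g)) (b * h ^+ f).
- by rewrite exprD mulrA; apply: subringM => //; apply: subringX.
- by [].
- rewrite [_ / p](_ : _ = (a * b / p * h ^+ g) * h ^+ (e + f)); last by rewrite !exprD; ring.
  by apply: subringM => //; apply: subringX.
- by left; exists (e + g)%N; rewrite mulrAC.
by right; exists f; rewrite mulrAC.
Qed.

(** A prime of A becomes a unit or stays prime in A[1/h], so a factorization in A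
gives one in A[1/h] once the primes that became units are moved to the unit. *)
Lemma localization_factorial A h : subring_set A -> A h -> h != 0 ->
  factorial_subring A -> factorial_subring (localization A h).
Proof.
move=> hA Ah h0 fA x [e Axh] x0.
have hL := localization_subring hA Ah.
have uh : unit_in (localization A h) h.
  by split=> //; [exact: localization_sub | exact: localization_inv].
have [||u [ps [uu pps ex]]] := fA (x * h ^+ e) => //.
  by rewrite mulf_neq0 ?expf_neq0.
have {}uu : unit_in (localization A h) u.
  by case: uu => u0 Au AVu; split=> //; apply: localization_sub.
have [v [qs [uv pqs eps]]] : exists v qs, [/\ unit_in (localization A h) v,
    (forall q, q \in qs -> prime_in (localization A h) q)
    & \prod_(p <- ps) p = v * \prod_(q <- qs) q].
  elim: (ps) pps => [|p s IH] ppps.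
    by exists 1, [::]; rewrite !big_nil mulr1; split=> //; apply: unit_in1.
  have [|v [qs [uv pqs es]]] := IH; first by move=> q q_s; apply: ppps; rewrite inE q_s orbT.
  have /(localization_prime hA Ah h0)[up|pp] : prime_in A p by apply: ppps; rewrite inE eqxx.
    by exists (p * v), qs; rewrite big_cons es mulrA; split=> //; apply: unit_inM.
  exists v, (p :: qs); rewrite !big_cons es mulrCA; split=> // q.
  by rewrite inE => /orP[/eqP->|/pqs].
exists (u * v * h ^- e), qs; split=> //; last first.
  by rewrite mulrAC -[u * v * _]mulrA -eps -ex mulfK ?expf_neq0.
apply: unit_inM => //; first exact: unit_inM.
by have := unit_inX hL (- e%:Z) uh; rewrite exprnN.
Qed.

(** A unit x of A[1/h], where h is a product of primes, becomes a divisor of a power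
of h after multiplication by a power of h; so it is a unit of A times a Laurent
monomial in these primes. *)
Lemma unit_localization A (I : finType) (t : I -> Om) x : subring_set A ->
  (forall i, prime_in A (t i)) -> unit_in (localization A (\prod_i t i)) x ->
  exists u (w : I -> int), unit_in A u /\ x = u * \prod_i t i ^ w i.
Proof.
move=> hA pt [x0 [e ax] [f ay]].
have t0 i : t i != 0 by case: (pt i).
have P0 : \prod_i t i != 0 by apply/prodf_neq0.
pose s := flatten (nseq (e + f) [seq t i | i <- enum I]).
have sT y : y \in s -> exists i, y = t i.
  by move=> /flattenP[r /nseqP[-> _]] /mapP[i _ ->]; exists i.
have es : \prod_(y <- s) y = (\prod_i t i) ^+ (e + f).
  rewrite /s; elim: (e + f)%N => [|m IH]; first by rewrite big_nil.
  by rewrite /= big_cat /= IH exprS big_map big_enum.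
have [||u [px [uu sub ex]]] := primes_split hA _ ax ay (ps := s).
- by move=> _ /sT[i ->].
- rewrite es mulrACA mulfV // mul1r exprD; apply: associate_refl => //.
  by rewrite mulf_neq0 ?expf_neq0.
have [w ew] : exists w : I -> int, \prod_(y <- px) y = \prod_i t i ^ w i.
  elim: (px) sub => [|y r IH] sub.
    by exists (fun=> 0); rewrite big_nil big1.
  have [|w ew] := IH; first by move=> z zr; apply: sub; rewrite inE zr orbT.
  have [|i ei] := sT y; first by apply: sub; rewrite inE eqxx.
  exists (fun j => (j == i)%:Z + w j); rewrite big_cons ew ei.
  rewrite [RHS](eq_bigr (fun j => t j ^ (j == i)%:Z * t j ^ w j)) => [|j _]; last by rewrite expfzDr.
  rewrite big_split; congr (_ * _).
  rewrite (bigD1 i) //= eqxx expr1z big1 ?mulr1 // => j /negPf->.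
  by rewrite expr0z.
exists u, (fun i => w i - e%:Z); split=> //.
rewrite -[x](mulfK (expf_neq0 e P0)) ex ew -mulrA; congr (_ * _).
rewrite -prodrXl -prodfV -big_split; apply: eq_bigr => i _.
by rewrite expfzDr // exprnN.
Qed.

Section Range.
Variables (R : idomainType) (f : {rmorphism R -> Om}).
Hypothesis f_inj : injective f.
Let range x := exists r, x = f r.

Let f0 x : (f x == 0) = (x == 0). Proof. by rewrite -(inj_eq f_inj) rmorph0. Qed.

Lemma range_subring : subring_set range.
Proof.
split; first by exists 1; rewrite rmorph1.
  by move=> _ _ [a ->] [b ->]; exists (a - b); rewrite rmorphB.
by move=> _ _ [a ->] [b ->]; exists (a * b); rewrite rmorphM.
Qed.

Lemma prime_in_range p : prime_elt p -> prime_in range (f p).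
Proof.
move=> [p0 Up pP].
have fp0 : f p != 0 by rewrite f0.
have divP b : range (f b / f p) -> divides p b.
  move=> [c e]; exists c.
  by apply: f_inj; rewrite rmorphM -e mulfVK.
have Pdiv b : divides p b -> range (f b / f p).
  by move=> [c ->]; exists c; rewrite rmorphM mulfK.
split=> //; first by exists p.
  rewrite -[_^-1]mul1r -(rmorph1 f) => /divP[c e].
  by case/negP: Up; apply/unitrP; exists c; rewrite [p * c]mulrC.
move=> _ _ [a ->] [b ->]; rewrite -rmorphM => /divP/pP[]/Pdiv; by [left|right].
Qed.

Lemma unit_in_range u : unit_in range (f u) <-> u \is a GRing.unit.
Proof.
split=> [[fu0 _ [v e]]|uu]; last first.
  split; first by rewrite f0; apply: contraTneq uu => ->; rewrite unitr0.
    by exists u.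
  by exists u^-1; rewrite rmorphV.
apply/unitrP; exists v; suff uv : u * v = 1 by rewrite [v * u]mulrC.
by apply: f_inj; rewrite rmorphM rmorph1 -e mulfV.
Qed.

Lemma factorial_range : factorial_ring R -> factorial_subring range.
Proof.
move=> fR _ [r ->] fr0.
have [|u [ps [uu pps ->]]] := fR r; first by rewrite -f0.
exists (f u), (map f ps); split; first exact/unit_in_range.
  by move=> _ /mapP[p /pps pp ->]; apply: prime_in_range.
by rewrite rmorphM rmorph_prod big_map.
Qed.

End Range.

End SubringFactorization.

(** * The unit group of an invariant localization *)

Section UnitLattice.
Variables (gT : finGroupType) (G : {group gT}) (Om : fieldType).
Variable rho : gT -> {rmorphism Om -> Om}.
Hypothesis rho1 : forall x, rho 1%g x = x.
Hypothesis rhoM : {in G &, forall g h x, rho (g * h)%g x = rho h (rho g x)}.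
Variables (A : Om -> Prop) (h : Om).
Hypotheses (hA : subring_set A) (fA : factorial_subring A).
Hypothesis rhoA : {in G, forall g x, A x -> A (rho g x)}.
Hypotheses (Ah : A h) (h0 : h != 0) (rho_h : {in G, forall g, rho g h = h}).

Let rhoK g : g \in G -> cancel (rho g) (rho g^-1%g).
Proof. by move=> Gg x; rewrite -rhoM ?groupV // mulgV rho1. Qed.

Lemma unit_in_rho g x : g \in G -> unit_in A x -> unit_in A (rho g x).
Proof.
move=> Gg [x0 Ax AVx]; split; first by rewrite fmorph_eq0.
  exact: rhoA.
by rewrite -fmorphV; apply: rhoA.
Qed.

Lemma prime_in_rho g p : g \in G -> prime_in A p -> prime_in A (rho g p).
Proof.
move=> Gg [p0 Ap NAVp pP]; have GVg : g^-1%g \in G by rewrite groupV.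
have rhoVK : cancel (rho g^-1%g) (rho g) by move=> x; rewrite -rhoM // mulVg rho1.
split; first by rewrite fmorph_eq0.
- exact: rhoA.
- by rewrite -fmorphV => /(rhoA GVg); rewrite rhoK.
move=> a b Aa Ab /(rhoA GVg); rewrite !(rmorphM, fmorphV) /= rhoK // => d.
have [|||H|H] := pP (rho g^-1%g a) (rho g^-1%g b) => //; try exact: rhoA.
  by left; have := rhoA Gg H; rewrite rmorphM fmorphV /= rhoVK.
by right; have := rhoA Gg H; rewrite rmorphM fmorphV /= rhoVK.
Qed.

(** The prime p up to associates, chosen uniformly in each class. *)
Let rep (p : Om) := choose (fun q => `[< associate A q p >]) p.

Let repP p : p != 0 -> associate A (rep p) p.
Proof.
move=> p0; apply/asboolP; apply: (@chooseP _ (fun q => `[< associate A q p >])).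
exact/asboolP/associate_refl.
Qed.

Let rep_eq p q : p != 0 -> q != 0 -> associate A p q -> rep p = rep q.
Proof.
move=> p0 q0 pq; rewrite /rep.
have e : (fun r => `[< associate A r p >]) =1 (fun r => `[< associate A r q >]).
  move=> r; apply/asboolP/asboolP => H; first exact: associate_trans H pq.
  exact/(associate_trans hA H)/associate_sym.
rewrite (eq_choose e) (@choose_id _ _ p q) //; first exact/asboolP.
exact/asboolP/associate_refl.
Qed.

(** The classes of primes dividing h are those of the factors of one factorization of
h; one representative is chosen in each class. *)
Lemma unit_lattice_data : exists n (s : 'I_n -> Om),
  [/\ forall i, prime_in A (s i) /\ A (h / s i),
      forall i j, associate A (s i) (s j) -> i = j
    & exists2 ps : seq Om, (forall p, p \in ps -> exists i, associate A p (s i))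
        & associate A h (\prod_(p <- ps) p)].
Proof.
have [u [ps [uu pps eh]]] := fA Ah h0.
have pA p : p \in ps -> A p by move=> /pps[].
have ps0 p : p \in ps -> p != 0 by move=> /pps[].
pose t := undup (map rep ps).
have tP q : q \in t -> exists2 p, p \in ps & q = rep p.
  by rewrite mem_undup => /mapP.
have pr0 : \prod_(p <- ps) p != 0.
  by apply: contraNneq h0; rewrite eh => ->; rewrite mulr0.
exists (size t), (fun i : 'I_(size t) => tnth (in_tuple t) i); split=> [i|i j|].
- have [p p_ps ->] := tP _ (mem_tnth i (in_tuple t)).
  have rp := repP (ps0 _ p_ps); split; first exact: associate_prime (pps _ p_ps) rp.
  have [a0 Aa _] := associate_sym rp.
  have rp0 : rep p != 0 by case: (associate_prime hA (pps _ p_ps) rp).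
  rewrite eh (big_rem p) //= [_ / rep p](_ : _ =
    u * (p / rep p) * \prod_(q <- rem p ps) q); last by field.
  apply: subringM => //; first by apply: subringM => //; case: uu.
  have : forall q, q \in rem p ps -> A q by move=> q /mem_rem/pA.
  elim: (rem p ps) => [|r s IH] As; first by rewrite big_nil; case: hA.
  rewrite big_cons; apply: subringM => //; first by apply: As; rewrite inE eqxx.
  by apply: IH => q q_s; apply: As; rewrite inE q_s orbT.
- have [p p_ps e] := tP _ (mem_tnth i (in_tuple t)).
  have [q q_ps e'] := tP _ (mem_tnth j (in_tuple t)).
  rewrite e e' => H; have p0 := ps0 _ p_ps; have q0 := ps0 _ q_ps.
  have pq : rep p = rep q.
    apply: rep_eq => //; apply: (associate_trans hA (associate_sym (repP p0))).
    exact: associate_trans H (repP q0).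
  have /tuple_uniqP : uniq (in_tuple t) by apply: undup_uniq.
  by apply; rewrite e e' pq.
exists ps; last by rewrite /associate eh mulfK.
move=> p p_ps; have /tnthP[i e] : rep p \in in_tuple t by rewrite mem_undup map_f.
by exists i; rewrite -e; apply/associate_sym/repP/ps0.
Qed.

Definition unit_group x := [/\ x != 0, localization A h x & localization A h x^-1].

Lemma unit_groupM x y : unit_group x -> unit_group y -> unit_group (x * y).
Proof.
have hL := localization_subring hA Ah.
move=> [x0 lx lVx] [y0 ly lVy]; split; first by rewrite mulf_neq0.
  exact: subringM.
by rewrite invfM; apply: subringM.
Qed.

Lemma unit_groupV x : unit_group x -> unit_group x^-1.
Proof. by move=> [x0 lx lVx]; split; rewrite ?invr_eq0 ?invrK. Qed.

Lemma unit_group_rho g x : g \in G -> unit_group x -> unit_group (rho g x).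
Proof.
move=> Gg [x0 [e Ae] [f Af]]; split; first by rewrite fmorph_eq0.
  by exists e; rewrite -(rho_h Gg) -rmorphXn -rmorphM; apply: rhoA.
by exists f; rewrite -(rho_h Gg) -fmorphV -rmorphXn -rmorphM; apply: rhoA.
Qed.

Lemma unit_in_group x : unit_in A x -> unit_group x.
Proof. by move=> [x0 Ax AVx]; split=> //; apply: localization_sub. Qed.

(** The units of A[1/h] modulo those of A form the free abelian group on the primes
that divide h up to associates, and G permutes these classes because h is fixed. The
map v is the vector of valuations at these primes. *)
Theorem unit_lattice : exists n (Q : mx_representation int G n) (v : Om -> 'rV[int]_n),
  [/\ permutation_lattice Q,
      forall x y, unit_group x -> unit_group y -> v (x * y) = v x + v y,
      forall x g, g \in G -> unit_group x -> v (rho g x) = v x *m Q g,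
      forall x, unit_group x -> v x = 0 <-> unit_in A x
    & forall z, exists2 x, unit_group x & v x = z].
Proof.
have [n [s [sP s_inj [ps psP hps]]]] := unit_lattice_data.
have s0 i : s i != 0 by have [[]] := sP i.
pose expo (a : 'rV[int]_n) := \prod_i s i ^ a 0 i.
have expoD a b : expo (a + b) = expo a * expo b.
  by rewrite /expo -big_split; apply: eq_bigr => i _; rewrite mxE expfzDr.
have expo0 : expo 0 = 1 by rewrite /expo big1 // => i _; rewrite mxE expr0z.
have expoN a : expo (- a) = (expo a)^-1.
  have e : expo (- a) * expo a = 1 by rewrite -expoD addNr.
  have ea0 : expo a != 0 by apply: contraPneq e => ->; rewrite mulr0 => /eqP; rewrite eq_sym oner_eq0.
  by rewrite -[expo (- a)](mulfK ea0) e mul1r.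
have expo_neq0 a : expo a != 0.
  by have e := expoN (- a); rewrite opprK in e; have := expoD a (- a);
    rewrite subrr expo0 => /eqP; rewrite eq_sym; apply: contraTneq => ->; rewrite mul0r eq_sym oner_eq0.
have expo1 i : expo (delta_mx 0 i) = s i.
  rewrite /expo (bigD1 i) //= mxE !eqxx expr1z big1 ?mulr1 // => j ji.
  by rewrite mxE eqxx (negPf ji) expr0z.
have Us i : unit_group (s i).
  have [[_ As _ _] Ahs] := sP i; split=> //; first exact: localization_sub.
  by exists 1%N; rewrite expr1 mulrC.
have Uexpo a : unit_group (expo a).
  rewrite /expo; apply: (big_ind unit_group).
  - exact/unit_in_group/unit_in1.
  - exact: unit_groupM.
  move=> i _; have H m : unit_group (s i ^+ m).
    elim: m => [|m IH]; first by rewrite expr0; apply/unit_in_group/unit_in1.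
    by rewrite exprS; apply: unit_groupM.
  by case: (a 0 i) => m; [apply: H | apply: (unit_groupV (H m.+1))].
pose T x := exists a, unit_in A (x / expo a).
have TM x y : T x -> T y -> T (x * y).
  move=> [a ua] [b ub]; exists (a + b); have := unit_inM hA ua ub.
  by rewrite mulrACA -invfM -expoD.
have TV x : T x -> T x^-1.
  by move=> [a ua]; exists (- a); rewrite expoN invrK -[expo a]invrK -invfM; apply: unit_inV.
have Tunit x : unit_in A x -> T x by exists 0; rewrite expo0 divr1.
have Tassoc x i : associate A x (s i) -> T x by exists (delta_mx 0 i); rewrite expo1.
have Tprod qs : {subset qs <= ps} -> T (\prod_(q <- qs) q).
  elim: qs => [|q qs IH] sub; first by rewrite big_nil; apply/Tunit/unit_in1.
  rewrite big_cons; apply: TM; last by apply: IH => r r_qs; apply: sub; rewrite inE r_qs orbT.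
  by have [|i qi] := psP q; [apply: sub; rewrite inE eqxx | apply: Tassoc qi].
have pps p : p \in ps -> prime_in A p.
  by move=> /psP[i]; apply: associate_prime => //; have [] := sP i.
have prod0 : \prod_(p <- ps) p != 0.
  by have [] := associate_sym hps; rewrite mulf_eq0 negb_or => /andP[].
have Th : T h.
  have -> : h = h / (\prod_(p <- ps) p) * (\prod_(p <- ps) p) by rewrite mulfVK.
  by apply: TM; [apply: Tunit | apply: Tprod].
have TX x m : T x -> T (x ^+ m).
  by move=> Tx; elim: m => [|m IH]; rewrite ?expr0 ?exprS; [apply/Tunit/unit_in1 | apply: TM].
(* A unit x of A[1/h] is a divisor of a power of h times an inverse power of h, so it
   is a monomial in the primes of h up to a unit of A. *)
have UT x : unit_group x -> T x.
  move=> [x0 [e Ae] [f Af]].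
  have [||||u [qs [uu sub ex]]] := @primes_split _ A hA
    (flatten (nseq (e + f) ps)) (x * h ^+ e) (x^-1 * h ^+ f) => //.
  - by move=> p /flattenP[r /nseqP[-> _]]; apply: pps.
  - rewrite [_ * _](_ : _ = h ^+ (e + f)); last by rewrite exprD; field.
    elim: (e + f)%N => [|m IH]; first by rewrite big_nil; apply/associate_refl; rewrite ?oner_eq0.
    rewrite /= big_cat /= exprS /associate [_ / _](_ : _ =
       h / (\prod_(p <- ps) p) * (h ^+ m / \prod_(p <- flatten (nseq m ps)) p)).
      exact: unit_inM.
    by rewrite invfM mulrACA.
  have -> : x = x * h ^+ e * (h ^+ e)^-1 by rewrite mulfK ?expf_neq0.
  apply: (TM); last exact/TV/TX.
  rewrite ex; apply: TM; [exact: Tunit | apply: Tprod].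
  by move=> q /sub/flattenP[r /nseqP[-> _]].
(* Independence of the primes: if b has a positive exponent at i, then expo b = D * s
   i / N with D in A and N a product of powers of the other primes, and expo b being a
   unit would make s i divide N. *)
have uniq_expo a : unit_in A (expo a) -> a = 0.
  suff H b : unit_in A (expo b) -> forall i, b 0 i <= 0.
    move=> ua; apply/rowP => i; rewrite mxE; apply/eqP; rewrite eq_le (H a) //=.
    by have := H (- a); rewrite expoN => /(_ (unit_inV ua) i); rewrite mxE oppr_le0.
  move=> ub i; rewrite leNgt; apply/negP => bi.
  pose num m := if m is Posz k then k else 0%N.
  pose den m := if m is Negz k then k.+1 else 0%N.
  pose N := \prod_j s j ^+ den (b 0 j).
  pose D := s i ^+ (num (b 0 i)).-1 * \prod_(j | j != i) s j ^+ num (b 0 j).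
  have As j : A (s j) by have [[]] := sP j.
  have AD : A D.
    apply: subringM => //; first exact: subringX.
    apply: big_ind; [by case: hA | by move=> ? ?; apply: subringM|].
    by move=> j _; apply: subringX.
  have [[_ _ NAVi siP] _] := sP i.
  have [_ NN] : A N /\ ~ A (N / s i).
    apply: (big_ind (fun x => A x /\ ~ A (x / s i))).
    - by rewrite mul1r; split=> //; case: hA.
    - move=> x y [Ax Nx] [Ay Ny]; split; first exact: subringM.
      by move=> d; case: (siP x y Ax Ay d).
    move=> j _; split; first exact: subringX.
    case ej : (b 0 j) => [m|m] /=; first by rewrite expr0 mul1r.
    have ji : j != i by apply: contraTneq bi => <-; rewrite ej.
    elim: m.+1 => [|k IH]; first by rewrite expr0 mul1r.
    rewrite exprS => d; have [|Aji|//] := siP (s j) (s j ^+ k) (As j) _ d.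
      exact: subringX.
    case/eqP: ji; apply: s_inj.
    exact: (prime_dvd_associate hA (proj1 (sP i)) (proj1 (sP j)) Aji).
  apply: NN; have [_ _ AVb] := ub.
  suff -> : N / s i = (expo b)^-1 * D by apply: subringM.
  have powE j : s j ^ b 0 j = s j ^+ num (b 0 j) / s j ^+ den (b 0 j).
    by case: (b 0 j) => m /=; rewrite ?expr0 ?divr1 ?mul1r.
  have -> : expo b = \prod_j s j ^+ num (b 0 j) / N.
    by rewrite /N -prodfV -big_split; apply: eq_bigr => j _; apply: powE.
  have -> : \prod_j s j ^+ num (b 0 j) = D * s i.
    rewrite (bigD1 i) //= /D; case: (b 0 i) bi => // -[|m] //= _.
    by rewrite exprSr mulrAC.
  have D0 : D != 0.
    rewrite /D mulf_neq0 ?expf_neq0 //; apply/prodf_neq0 => j _.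
    exact: expf_neq0.
  have N0 : N != 0 by apply/prodf_neq0 => j _; apply: expf_neq0.
  by field; rewrite D0 N0 s0.
have expo_inj x a b : unit_in A (x / expo a) -> unit_in A (x / expo b) -> a = b.
  move=> ua ub; apply/eqP; rewrite -subr_eq0; apply/eqP/uniq_expo.
  have := unit_inM hA ub (unit_inV ua); rewrite expoD expoN.
  by have [+ _ _] := ua; rewrite mulf_eq0 negb_or => /andP[x0 _]; rewrite [X in unit_in A X](_ : _ = expo a / expo b) //; field; rewrite !expo_neq0.
pose v x := if pselect (T x) is left H then projT1 (cid H) else 0.
have vP x : T x -> unit_in A (x / expo (v x)).
  by move=> Tx; rewrite /v; case: pselect => // H; case: (cid H).
have v_eq x a : unit_in A (x / expo a) -> v x = a.
  by move=> ua; apply: (expo_inj x) => //; apply: vP; exists a.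
have v_expo a : v (expo a) = a.
  by apply: v_eq; rewrite divff //; apply: unit_in1.
have vM x y : unit_group x -> unit_group y -> v (x * y) = v x + v y.
  move=> /UT Tx /UT Ty; apply: v_eq; rewrite expoD invfM mulrACA.
  by apply: unit_inM => //; apply: (vP).
have v_unit x : unit_group x -> v x = 0 <-> unit_in A x.
  move=> Ux; split=> [v0|ux]; last by apply: v_eq; rewrite expo0 divr1.
  by have := vP _ (UT _ Ux); rewrite v0 expo0 divr1.
have rho_s g i : g \in G -> exists j, associate A (rho g (s i)) (s j).
  move=> Gg; have [pi Ahi] := sP i; have pgi := prime_in_rho Gg pi.
  have [|||p p_ps Ap] := @prime_dvd_prod _ A hA (rho g (s i)) ps.
  - by [].
  - by move=> q /pps[].
  - have -> : \prod_(q <- ps) q / rho g (s i) =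
       \prod_(q <- ps) q / h * (h / rho g (s i)).
      by have [pg0 _ _ _] := pgi; field; rewrite ?pg0 ?h0.
    apply: subringM => //; first by case: (associate_sym hps).
    by rewrite -{1}(rho_h Gg) -fmorph_div; apply: rhoA.
  have [j pj] := psP p p_ps; exists j.
  apply: (associate_trans hA _ pj); apply: associate_sym.
  exact: (prime_dvd_associate hA pgi (pps _ p_ps) Ap).
pose Qm g : 'M[int]_n := \matrix_i v (rho g (s i)).
have v_rho x g : g \in G -> unit_group x -> v (rho g x) = v x *m Qm g.
  move=> Gg Ux; set a := v x.
  have ua : unit_in A (x / expo a) by apply/vP/UT.
  have -> : v (rho g x) = v (rho g (expo a)).
    have Ur := unit_group_rho Gg (Uexpo a).
    have -> : rho g x = rho g (x / expo a) * rho g (expo a) by rewrite -rmorphM mulfVK.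
    have uu := unit_in_rho Gg ua.
    by rewrite vM ?(proj2 (v_unit _ (unit_in_group uu)) uu) ?add0r //; apply: unit_in_group.
  apply: v_eq; rewrite mulmx_sum_row.
  have -> : expo (\sum_i a 0 i *: row i (Qm g)) = \prod_i expo (row i (Qm g)) ^ a 0 i.
    have expoZ c m : expo (m *: c) = expo c ^ m.
      rewrite /expo (big_morph (fun x => x ^ m) (fun x y => expfzMl x y m) (exp1rz _ m)).
      by apply: eq_bigr => j _; rewrite mxE mulrC exprz_exp.
    elim/big_rec2: _ => [|i y z _ <-]; first exact: expo0.
    by rewrite expoD expoZ.
  rewrite rmorph_prod -prodfV -big_split /=; apply: (big_ind (unit_in A)).
  - exact: unit_in1.
  - by move=> ? ?; apply: unit_inM.
  move=> i _; rewrite fmorphXz invr_expz -exprz_inv -expfzMl; apply: unit_inX => //.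
  by rewrite rowK; apply/vP/UT/unit_group_rho.
have Qr : mx_repr G Qm.
  split=> [|g k Gg Gk]; apply/row_matrixP => i; rewrite rowK.
    by rewrite rho1 -{1}(expo1 i) v_expo row1.
  rewrite rhoM // v_rho //; last exact: unit_group_rho.
  by rewrite row_mul rowK.
exists n, (MxRepresentation Qr), v; split=> //; last by move=> z; exists (expo z).
exists 1%:M; first exact: unitmx1.
move=> g Gg i; have [j ij] := rho_s g i Gg; exists j.
by rewrite row1 -rowE rowK row1; apply: v_eq; rewrite expo1.
Qed.

End UnitLattice.

(** * Homomorphisms out of fraction fields *)

Lemma fraction_numden (R : idomainType) (x : {fraction R}) :
  exists a b : R, b != 0 /\ x = tofrac a / tofrac b.
Proof.
elim/quotW: x => r; exists \n_r, \d_r; split; first exact: denom_ratioP.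
have d0 : tofrac \d_r != 0 :> {fraction R} by rewrite tofrac_eq0 denom_ratioP.
apply: (mulIf d0); rewrite mulfVK //; unlock tofrac.
rewrite -[LHS]FracField.pi_mul; apply/eqmodP; rewrite /= FracField.equivfE /FracField.mulf.
by rewrite !numden_Ratio ?mulf_neq0 ?oner_eq0 ?denom_ratioP // !mulr1 mulrC.
Qed.

Lemma tofrac_inj (R : idomainType) : injective (@tofrac R).
Proof. by move=> a b /eqP; rewrite tofrac_eq => /eqP. Qed.

Section FractionLift.
Variables (R : idomainType) (E : fieldType) (f : {rmorphism R -> E}).
Hypothesis f_inj : injective f.

Let f0 x : (f x == 0) = (x == 0). Proof. by rewrite -(inj_eq f_inj) rmorph0. Qed.

Lemma fraction_lift_fun : exists F : {fraction R} -> E,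
  forall a b, b != 0 -> F (tofrac a / tofrac b) = f a / f b.
Proof.
have hex (x : {fraction R}) : exists y, exists a b,
    [/\ b != 0, x = tofrac a / tofrac b & y = f a / f b].
  by have [a [b [b0 e]]] := fraction_numden x; exists (f a / f b), a, b.
exists (fun x => projT1 (cid (hex x))) => a b b0.
case: (cid _) => y /= [c [d [d0 e ->]]].
apply/eqP; rewrite eqr_div ?f0 // -!rmorphM (inj_eq f_inj).
move/eqP: e; rewrite eqr_div ?tofrac_eq0 // -!tofracM tofrac_eq => /eqP e.
by rewrite e.
Qed.

Let subf_div (F : fieldType) (a b c d : F) : b != 0 -> d != 0 ->
  a / b - c / d = (a * d - c * b) / (b * d).
Proof. by move=> b0 d0; rewrite -mulNr addf_div // mulNr. Qed.

(** The universal property of the field of fractions. *)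
Lemma fraction_lift : exists F : {rmorphism {fraction R} -> E},
  forall a, F (tofrac a) = f a.
Proof.
have [F FP] := fraction_lift_fun.
have FT a : F (tofrac a) = f a.
  by have := FP a 1 (oner_neq0 _); rewrite tofrac1 rmorph1 !divr1.
have FB : zmod_morphism F.
  move=> x y; have [a [b [b0 ->]]] := fraction_numden x.
  have [c [d [d0 ->]]] := fraction_numden y.
  rewrite subf_div ?tofrac_eq0 // -!tofracM -tofracB !FP ?mulf_neq0 //.
  by rewrite subf_div ?f0 // rmorphB !rmorphM.
have FM : monoid_morphism F.
  split; first by rewrite -tofrac1 FT rmorph1.
  move=> x y; have [a [b [b0 ->]]] := fraction_numden x.
  have [c [d [d0 ->]]] := fraction_numden y.
  by rewrite mulf_div -!tofracM !FP ?mulf_neq0 // mulf_div -!rmorphM.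
pose FZ := GRing.isZmodMorphism.Build _ _ F FB.
pose FMm := GRing.isMonoidMorphism.Build _ _ F FM.
pose F' : {rmorphism {fraction R} -> E} := HB.pack F FZ FMm.
by exists F'.
Qed.
End FractionLift.

Lemma fraction_rmorph_ext (R : idomainType) (E : fieldType)
    (f g : {rmorphism {fraction R} -> E}) :
  (forall a, f (tofrac a) = g (tofrac a)) -> f =1 g.
Proof.
move=> fg x; have [a [b [_ ->]]] := fraction_numden x.
by rewrite !fmorph_div !fg.
Qed.

(** * Laurent polynomials inside the field of rational functions *)

Section Laurent.
Variables (k : fieldType) (L : splittingFieldType k).
Local Notation F n := {fraction {mpoly L[n]}}.

Lemma char_mon_neq0 n (v : 'rV[int]_n) : char_mon L v != 0.
Proof.
apply/prodf_neq0 => i _; apply: expfz_neq0.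
by rewrite tofrac_eq0 -msize_poly_eq0 msizeX.
Qed.

Lemma char_monN n (v : 'rV[int]_n) : char_mon L (- v) = (char_mon L v)^-1.
Proof.
apply: (mulIf (char_mon_neq0 v)); rewrite -char_monD addNr char_mon0 mulVf //.
exact: char_mon_neq0.
Qed.

Lemma char_monX n (v : 'rV[int]_n) e : char_mon L v ^+ e = char_mon L (v *+ e).
Proof.
by elim: e => [|e IH]; rewrite ?expr0 ?mulr0n ?char_mon0 // exprS mulrS char_monD IH.
Qed.

Lemma char_monZ n (v : 'rV[int]_n) (e : int) : char_mon L v ^ e = char_mon L (e *: v).
Proof.
case: e => e; first by rewrite -exprnP char_monX -scaler_nat natz.
by rewrite NegzE scaleNr char_monN -[RHS]invrK -exprnN; congr _^-1; rewrite invrK char_monX -scaler_nat natz.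
Qed.

Lemma char_mon_sum n (I : Type) (r : seq I) (P : pred I) (f : I -> 'rV[int]_n) :
  char_mon L (\sum_(i <- r | P i) f i) = \prod_(i <- r | P i) char_mon L (f i).
Proof. exact: (big_morph _ (@char_monD k L n) (@char_mon0 k L n)). Qed.

Lemma char_mon_delta n (i : 'I_n) : char_mon L (delta_mx 0 i) = tofrac 'X_i.
Proof.
rewrite /char_mon (bigD1 i) //= mxE !eqxx expr1z big1 ?mulr1 // => j ji.
by rewrite mxE eqxx (negPf ji) expr0z.
Qed.

Definition mnm_row n (m : 'X_{1..n}) : 'rV[int]_n := \row_i (m i)%:Z.

Lemma char_mon_mnm n (m : 'X_{1..n}) : char_mon L (mnm_row m) = tofrac 'X_[m].
Proof.
rewrite /char_mon mpolyXE_id rmorph_prod; apply: eq_bigr => i _.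
by rewrite mxE rmorphXn.
Qed.

Lemma lconst_char_mon_mnm n (p : {mpoly L[n]}) :
  tofrac p = \sum_(m <- msupp p) lconst n p@_m * char_mon L (mnm_row m).
Proof.
rewrite {1}[p]mpolyE rmorph_sum; apply: eq_bigr => m _.
by rewrite -mul_mpolyC rmorphM char_mon_mnm.
Qed.

(** Multiplication by a large power of the product of all variables clears the
negative exponents and turns the relation into one between distinct monomials of the
polynomial ring. *)
Lemma char_mon_independent n (I : eqType) (s : seq I) (w : I -> 'rV[int]_n)
    (c : I -> L) : uniq s -> {in s &, injective w} ->
  \sum_(i <- s) lconst n (c i) * char_mon L (w i) = 0 -> forall i, i \in s -> c i = 0.
Proof.
move=> us w_inj e0 i0 i0s.
(* K bounds the absolute values of all the exponents that occur. *)
pose K := (\sum_(i <- s) \sum_j `|w i 0%R j|)%N.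
pose m i : 'X_{1..n} := [multinom `|(w i 0 j + K%:Z)%R|%N | j < n].
have wK i j : i \in s -> (`|(w i 0 j + K%:Z)%R|%N)%:Z = w i 0 j + K%:Z.
  move=> i_s; have : (`|w i 0%R j| <= K)%N.
    rewrite /K (big_rem i) //= (bigD1 j) //= -addnA; exact: leq_addr.
  by lia.
have m_inj : {in s &, injective m}.
  move=> i j i_s j_s /mnmP e; apply: w_inj => //; apply/rowP => l.
  have := e l; rewrite !mnmE => /(congr1 Posz); rewrite !wK // => /addIr //.
have {e0} : \sum_(i <- s) c i *: 'X_[m i] = 0 :> {mpoly L[n]}.
  apply/eqP; rewrite -tofrac_eq0 rmorph_sum /=; apply/eqP.
  transitivity ((\sum_(i <- s) lconst n (c i) * char_mon L (w i)) * char_mon L (const_mx K%:Z)); last first.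
    by rewrite e0 mul0r.
  rewrite mulr_suml big_seq [RHS]big_seq; apply: eq_bigr => i i_s.
  rewrite -mul_mpolyC tofracM -mulrA -char_monD; congr (_ * _).
  rewrite -char_mon_mnm; congr char_mon; apply/rowP => j.
  by rewrite !mxE mnmE wK.
move/(congr1 (mcoeff (m i0))); rewrite mcoeff0 raddf_sum /= (big_rem i0) //=.
rewrite mcoeffZ mcoeffX eqxx mulr1 big_seq big1 ?addr0 // => i.
rewrite mem_rem_uniq // inE => /andP[ii0 i_s]; rewrite mcoeffZ mcoeffX.
by case: eqP => [/m_inj e|_]; rewrite ?mulr0 //; case/eqP: ii0; apply: e.
Qed.

Lemma laurentE n (a : {malg L['rV[int]_n]}) :
  laurent a = \sum_(v <- monalg.msupp a) lconst n (monalg.mcoeff v a) * char_mon L v.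
Proof. by []. Qed.

Lemma laurent_inj n : injective (@laurent k L n).
Proof.
move=> a b e; apply/eqP; rewrite -subr_eq0; apply/eqP.
have : laurent (a - b) = 0 by rewrite raddfB /= e subrr.
rewrite laurentE => /char_mon_independent H; apply/malgP => v; rewrite monalg.mcoeff0.
have [v_s|/monalg.mcoeff_outdom//] := boolP (v \in monalg.msupp (a - b)).
by apply: H v_s => //; exact: fset_uniq.
Qed.

(** A monomial substitution with injective exponent matrix sends distinct monomials to
distinct monomials, so it is injective on polynomials and extends to rational
functions. *)
Lemma monomial_map n n' (s : {rmorphism L -> L}) (N : 'M[int]_(n, n')) :
  (forall v : 'rV[int]_n, v *m N = 0 -> v = 0) ->
  exists mu : {rmorphism F n -> F n'},
    (forall c, mu (lconst n c) = lconst n' (s c)) /\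
    (forall v, mu (char_mon L v) = char_mon L (v *m N)).
Proof.
move=> N_inj.
have [r [rX rC]] : exists r : {rmorphism {mpoly L[n]} -> F n'},
    (forall i, r 'X_i = char_mon L (row i N)) /\ forall c, r c%:MP = lconst n' (s c).
  exists (mmap (@lconst k L n' \o s) (fun i => char_mon L (row i N))).
  by split=> [i|c] /=; rewrite ?mmapX ?mmap1U ?mmapC.
have rm (m : 'X_{1..n}) : r 'X_[m] = char_mon L (mnm_row m *m N).
  rewrite mpolyXE_id rmorph_prod mulmx_sum_row char_mon_sum; apply: eq_bigr => i _.
  by rewrite rmorphXn rX mxE -char_monZ.
have rE p : r p = \sum_(m <- msupp p) lconst n' (s p@_m) * char_mon L (mnm_row m *m N).
  rewrite {1}[p]mpolyE rmorph_sum; apply: eq_bigr => m _.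
  by rewrite -mul_mpolyC rmorphM rC rm.
have r_inj : injective r.
  suff r_ker p : r p = 0 -> p = 0 by apply: raddf_inj.
  rewrite rE => e0.
  apply/mpolyP => m; rewrite mcoeff0.
  have [m_p|/memN_msupp_eq0//] := boolP (m \in msupp p).
  apply/eqP; rewrite -(fmorph_eq0 s); apply/eqP.
  apply: (char_mon_independent _ _ e0) m_p; first exact: msupp_uniq.
  move=> m1 m2 _ _ e; have /N_inj e' : (mnm_row m1 - mnm_row m2) *m N = 0.
    by rewrite mulmxBl e subrr.
  apply/mnmP => i; move/matrixP/(_ 0 i): e'.
  by rewrite !mxE => /eqP; rewrite subr_eq0 => /eqP[].
have [mu muE] := fraction_lift r_inj; exists mu; split=> [c|v].
  by rewrite /lconst muE rC.
rewrite [in LHS]/char_mon rmorph_prod mulmx_sum_row char_mon_sum.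
by apply: eq_bigr => i _; rewrite fmorphXz muE rX char_monZ.
Qed.

Lemma laurent_rmorph_ext n (E : fieldType) (f g : {rmorphism F n -> E}) :
  (forall c, f (lconst n c) = g (lconst n c)) ->
  (forall i, f (char_mon L (delta_mx 0 i)) = g (char_mon L (delta_mx 0 i))) -> f =1 g.
Proof.
move=> fgC fgX; apply: fraction_rmorph_ext => a.
apply: (mpoly_rmorph_ext (f := f \o @tofrac _) (g := g \o @tofrac _)) => //= i.
by rewrite -char_mon_delta.
Qed.

Lemma rmorph_laurent n n' (mu : {rmorphism F n -> F n'}) (s : {rmorphism L -> L})
    (N : 'M[int]_(n, n')) (a : {malg L['rV[int]_n]}) :
  (forall c, mu (lconst n c) = lconst n' (s c)) ->
  (forall v, mu (char_mon L v) = char_mon L (v *m N)) ->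
  mu (laurent a) = laurent (\sum_(v <- monalg.msupp a) << s (monalg.mcoeff v a) *g v *m N >>).
Proof.
move=> muC muX; rewrite laurentE rmorph_sum raddf_sum; apply: eq_bigr => v _ /=.
by rewrite laurentU rmorphM muC muX.
Qed.

Definition is_laurent n (x : F n) := exists a, x = laurent a.

Lemma is_laurent_subring n : subring_set (@is_laurent n).
Proof.
split.
- by exists << 1 *g 0 >>; rewrite laurentU rmorph1 char_mon0 mulr1.
- by move=> _ _ [a ->] [b ->]; exists (a - b); rewrite raddfB.
by move=> _ _ [a ->] [b ->]; exists (convol a b); rewrite laurentM.
Qed.

Lemma is_laurent_lconst n c : is_laurent (lconst n c).
Proof. by exists << c *g 0 >>; rewrite laurentU char_mon0 mulr1. Qed.

Lemma is_laurent_char_mon n (v : 'rV[int]_n) : is_laurent (char_mon L v).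
Proof. by exists << 1 *g v >>; rewrite laurentU rmorph1 mul1r. Qed.

Lemma subring_sum (Om : fieldType) (A : Om -> Prop) (I : eqType) (s : seq I) (f : I -> Om) :
  subring_set A -> (forall i, i \in s -> A (f i)) -> A (\sum_(i <- s) f i).
Proof.
move=> hA; elim: s => [|i s IH] Af.
  by rewrite big_nil -(subrr 1); case: hA => A1 AB _; apply: AB.
rewrite big_cons; apply: subringD => //; first by apply: Af; rewrite inE eqxx.
by apply: IH => j js; apply: Af; rewrite inE js orbT.
Qed.

Lemma subring_prod (Om : fieldType) (A : Om -> Prop) (I : eqType) (s : seq I) (f : I -> Om) :
  subring_set A -> (forall i, i \in s -> A (f i)) -> A (\prod_(i <- s) f i).
Proof.
move=> hA; elim: s => [|i s IH] Af; first by rewrite big_nil; case: hA.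
rewrite big_cons; apply: subringM => //; first by apply: Af; rewrite inE eqxx.
by apply: IH => j js; apply: Af; rewrite inE js orbT.
Qed.

Lemma laurent_generated n (A : F n -> Prop) : subring_set A ->
  (forall c, A (lconst n c)) -> (forall v, A (char_mon L v)) ->
  forall x, is_laurent x -> A x.
Proof.
move=> hA AC AX _ [a ->]; rewrite laurentE; apply: subring_sum => // v _.
exact: subringM.
Qed.

Definition is_poly n (x : F n) := exists p : {mpoly L[n]}, x = tofrac p.

Lemma is_poly_subring n : subring_set (@is_poly n).
Proof. exact: range_subring. Qed.

Lemma is_poly_laurent n x : @is_poly n x -> is_laurent x.
Proof.
move=> [p ->]; rewrite lconst_char_mon_mnm; apply: subring_sum => [|m _].
  exact: is_laurent_subring.
by apply: subringM; [exact: is_laurent_subring|exact: is_laurent_lconst|exact: is_laurent_char_mon].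
Qed.

Lemma is_poly_char_mon n (v : 'rV[int]_n) : (forall i, 0 <= v 0 i) -> is_poly (char_mon L v).
Proof.
move=> v0; exists 'X_[[multinom `|v 0%R i|%N | i < n]]; rewrite -char_mon_mnm.
by congr char_mon; apply/rowP => i; rewrite mxE mnmE; have := v0 i; lia.
Qed.

Lemma is_laurentE n x :
  @is_laurent n x <-> localization (@is_poly n) (char_mon L (const_mx 1)) x.
Proof.
have hL := is_laurent_subring n; have hP := is_poly_subring n.
split=> [|[e /is_poly_laurent lx]]; last first.
  rewrite -[x](mulfK (expf_neq0 e (char_mon_neq0 (const_mx 1)))).
  by apply: subringM => //; rewrite char_monX -char_monN; apply: is_laurent_char_mon.
apply: laurent_generated => [|c|v].
- by apply: localization_subring => //; apply: is_poly_char_mon => i; rewrite mxE.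
- by apply: localization_sub; exists c%:MP.
exists (\sum_i `|v 0%R i|)%N; rewrite char_monX -char_monD.
apply: is_poly_char_mon => i; rewrite !mxE mulmxnE mxE.
by rewrite (bigD1 i) //= natz PoszD; lia.
Qed.

(** A factorization of a variable into primes has just one factor, since its total
degree is 1; so the variable is associate to a prime. *)
Lemma mpolyX_prime n (i : 'I_n) : prime_elt ('X_i : {mpoly L[n]}).
Proof.
have X0 : ('X_i : {mpoly L[n]}) != 0 by rewrite -msize_poly_eq0 msizeX.
have [u [ps [uu pps e]]] := factorial_ring_mpoly X0.
case: ps pps e => [|p ps] pps.
  rewrite big_nil mulr1 => e; move: uu; rewrite -e => /mpoly_unitP[c c0 ec].
  by have := congr1 (fun p => msize p) ec; rewrite msizeX mdeg1 msizeC c0.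
have sz (q : {mpoly L[n]}) : prime_elt q -> (1 < msize q)%N.
  move=> [q0 Uq _]; rewrite ltnNge; apply: contra Uq => q1.
  apply/mpoly_unitP; exists (q@_0); last exact: msize1_polyC.
  by apply: contraNneq q0 => q00; rewrite (msize1_polyC q1) q00 mpolyC0.
have [pp pps'] := proj1 (all_prime_cons p ps) pps.
have u0 : u != 0 by apply: contraTneq uu => ->; rewrite unitr0.
have [p0 Up pP] := pp.
rewrite big_cons; have [c c0 ec] := mpoly_unitP _ uu.
case: ps pps' {pps} => [_|q ps pps'] e; last first.
  have [qq pps''] := proj1 (all_prime_cons q ps) pps'.
  have [q0 _ _] := qq.
  have := congr1 (fun p => msize p) e; rewrite msizeX mdeg1 big_cons.
  have r0 : \prod_(j <- ps) j != 0.
    by rewrite prodf_seq_neq0; apply/allP => r /pps''[r0 _ _]; rewrite r0 implybT.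
  rewrite ec mul_mpolyC msizeZ // !msizeM ?mulf_neq0 //.
  have := sz _ pp; have := sz _ qq; have : (0 < msize (\prod_(j <- ps) j))%N.
    by rewrite lt0n msize_poly_eq0.
  set x := mmeasure _ q; set y := mmeasure _ p; set z := mmeasure _ _.
  by clearbody x y z => *; exfalso; lia.
rewrite e big_nil mulr1; split; first by rewrite mulf_neq0.
  by rewrite unitrM uu.
move=> a b [d ed]; have [|[f ->]|[f ->]] := pP a b.
- by exists (d * u); rewrite ed mulrA.
- by left; exists (f * u^-1); rewrite -mulrA mulKr.
by right; exists (f * u^-1); rewrite -mulrA mulKr.
Qed.

(** The Laurent polynomial ring is the localization of the polynomial ring at the
product of the variables, which are prime, and the units of a polynomial ring are
constant. *)
Lemma unit_laurentP n (x : F n) : unit_in (@is_laurent n) x ->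
  exists c v, c != 0 /\ x = lconst n c * char_mon L v.
Proof.
move=> [x0 /is_laurentE ax /is_laurentE ay].
have tE : char_mon L (const_mx 1) = \prod_(i < n) tofrac 'X_i.
  by apply: eq_bigr => i _; rewrite mxE expr1z.
rewrite tE in ax ay.
have tP (i : 'I_n) : prime_in (@is_poly n) (tofrac 'X_i).
  exact: (prime_in_range (@tofrac_inj _) (mpolyX_prime i)).
have [u [w [uu ->]]] := unit_localization (is_poly_subring n) tP (And3 x0 ax ay).
have [p ep] : is_poly u by case: uu.
have /mpoly_unitP[c c0 ec] : p \is a GRing.unit.
  by move: uu; rewrite ep; apply: (proj1 (unit_in_range (@tofrac_inj _) p)).
exists c, (\row_i w i); split=> //; rewrite ep ec; congr (_ * _).
by apply: eq_bigr => i _; rewrite mxE.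
Qed.

End Laurent.

(** * Two factorial models of one field *)

Section FractionSet.
Variables (Om : fieldType) (A : Om -> Prop).
Hypothesis hA : subring_set A.

Definition fraction_set x := exists a b, [/\ A a, A b, b != 0 & x = a / b].

Lemma fraction_set_sub x : A x -> fraction_set x.
Proof. by exists x, 1; rewrite divr1 oner_eq0; split=> //; case: hA. Qed.

Lemma fraction_set_subring : subring_set fraction_set.
Proof.
split; first by apply: fraction_set_sub; case: hA.
  move=> _ _ [a [b [Aa Ab b0 ->]]] [c [d [Ac Ad d0 ->]]].
  exists (a * d - c * b), (b * d); split; [ | exact: subringM | exact: mulf_neq0 | ].
    by case: (hA) => _ AB AM; apply: AB; apply: AM.
  by rewrite -mulNr addf_div // mulNr.
move=> _ _ [a [b [Aa Ab b0 ->]]] [c [d [Ac Ad d0 ->]]].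
exists (a * c), (b * d); split; [exact: subringM | exact: subringM | exact: mulf_neq0 | ].
by rewrite mulf_div.
Qed.

Lemma fraction_set_inv x : fraction_set x -> fraction_set x^-1.
Proof.
move=> [a [b [Aa Ab b0 ->]]]; have [a0|a0] := eqVneq a 0; last first.
  by exists b, a; rewrite invf_div.
rewrite a0 mul0r invr0; apply: fraction_set_sub.
by rewrite -(subrr 1); case: hA => A1 AB _; apply: AB.
Qed.

Lemma fraction_set_div x y : fraction_set x -> fraction_set y -> fraction_set (x / y).
Proof.
by move=> Fx /fraction_set_inv; apply: subringM => //; apply: fraction_set_subring.
Qed.

Definition fraction_full := forall x, fraction_set x.

End FractionSet.

Section TwoModels.
Variables (gT : finGroupType) (G : {group gT}) (Om : fieldType).
Variable rho : gT -> {rmorphism Om -> Om}.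
Hypothesis rho1 : forall x, rho 1%g x = x.
Hypothesis rhoM : {in G &, forall g h x, rho (g * h)%g x = rho h (rho g x)}.

Lemma norm_invariant g x : g \in G ->
  rho g (\prod_(h in G) rho h x) = \prod_(h in G) rho h x.
Proof.
move=> Gg; rewrite rmorph_prod [RHS](reindex_inj (mulIg g)) /=.
by apply: eq_big => h; [rewrite groupMr | move=> Gh; rewrite rhoM].
Qed.

(** The norm of a common denominator is an invariant common denominator. *)
Lemma invariant_denominator (A : Om -> Prop) (s : seq Om) :
  subring_set A -> {in G, forall g x, A x -> A (rho g x)} -> fraction_full A ->
  exists h, [/\ A h, h != 0, {in G, forall g, rho g h = h} & forall x, x \in s -> A (x * h)].
Proof.
move=> hA rA fA.
have [d [Ad d0 ds]] : exists d, [/\ A d, d != 0 & forall x, x \in s -> A (x * d)].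
  elim: s => [|x s [d [Ad d0 ds]]]; first by exists 1; rewrite oner_eq0; split=> //; case: hA.
  have [a [b [Aa Ab b0 ->]]] := fA x; exists (b * d).
  split; [exact: subringM | exact: mulf_neq0 |].
  move=> y; rewrite inE => /orP[/eqP->|/ds Ay].
    by rewrite mulrA mulfVK //; apply: subringM.
  by rewrite mulrCA; apply: subringM.
exists (\prod_(h in G) rho h d); split.
- by apply: big_ind => [|? ?|h Gh]; [case: hA | exact: subringM | exact: rA].
- by apply/prodf_neq0 => h _; rewrite fmorph_eq0.
- by move=> g Gg; apply: norm_invariant.
move=> x /ds Axd; rewrite (bigD1 1%g) //= rho1 mulrA; apply: subringM => //.
by apply: big_ind => [|? ?|h /andP[Gh _]]; [case: hA | exact: subringM | exact: rA].
Qed.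

Lemma localization_le (A B : Om -> Prop) (h : Om) : subring_set B ->
  h != 0 -> (forall x, A x -> B x) -> B h^-1 -> forall x, localization A h x -> B x.
Proof.
move=> hB h0 AB BVh x [e Ax].
rewrite -[x](mulfK (expf_neq0 e h0)) -exprVn; apply: subringM => //; first exact: AB.
exact: subringX.
Qed.

Variables (A1 A2 : Om -> Prop).
Hypotheses (hA1 : subring_set A1) (hA2 : subring_set A2).
Hypotheses (fA1 : factorial_subring A1) (fA2 : factorial_subring A2).
Hypothesis rhoA1 : {in G, forall g x, A1 x -> A1 (rho g x)}.
Hypothesis rhoA2 : {in G, forall g x, A2 x -> A2 (rho g x)}.
Hypotheses (ffA1 : fraction_full A1) (ffA2 : fraction_full A2).
Hypothesis gen1 : exists s : seq Om, forall S, subring_set S ->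
  (forall x, A2 x -> S x) -> (forall x, x \in s -> S x) -> forall x, A1 x -> S x.
Hypothesis gen2 : exists s : seq Om, forall S, subring_set S ->
  (forall x, A1 x -> S x) -> (forall x, x \in s -> S x) -> forall x, A2 x -> S x.

(** Each of the two rings is finitely generated over the other one, so that A1 is
contained in A2[1/d2] and A2 in A1[1/d1] for invariant d1 and d2. Inverting d1 and d2
in both rings gives the same ring; the powers only serve to have the inverted element
in A1 or in A2. *)
Lemma common_localization : exists h1 h2,
  [/\ [/\ A1 h1, h1 != 0 & {in G, forall g, rho g h1 = h1}],
      [/\ A2 h2, h2 != 0 & {in G, forall g, rho g h2 = h2}]
    & forall x, localization A1 h1 x <-> localization A2 h2 x].
Proof.
have [s1 s1P] := gen1; have [s2 s2P] := gen2.
have [d2 [Ad2 d20 rd2 s1d]] := invariant_denominator s1 hA2 rhoA2 ffA2.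
have [d1 [Ad1 d10 rd1 s2d]] := invariant_denominator s2 hA1 rhoA1 ffA1.
have hL1 := localization_subring hA1 Ad1; have hL2 := localization_subring hA2 Ad2.
have A12 x : A1 x -> localization A2 d2 x.
  apply: s1P => // y; first exact: localization_sub.
  by move=> /s1d Ay; exists 1%N; rewrite expr1.
have A21 x : A2 x -> localization A1 d1 x.
  apply: s2P => // y; first exact: localization_sub.
  by move=> /s2d Ay; exists 1%N; rewrite expr1.
have [e1 Ae1] := A21 _ Ad2; have [e2 Ae2] := A12 _ Ad1.
have main (A B : Om -> Prop) (a b : Om) e f : subring_set A -> subring_set B ->
    A a -> B b -> a != 0 -> b != 0 -> A (b * a ^+ e) -> B (a * b ^+ f) ->
    (forall x, A x -> localization B b x) ->
    forall x, localization A (a ^+ e.+1 * b) x -> localization B (b ^+ f.+1 * a) x.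
  move=> hA hB Aa Bb a0 b0 Aba Bab AB.
  have BH : B (b ^+ f.+1 * a) by rewrite exprS -mulrA [_ * a]mulrC; apply: subringM.
  have H0 : b ^+ f.+1 * a != 0 by rewrite mulf_neq0 ?expf_neq0.
  have hLB := localization_subring hB BH.
  have LVH := localization_inv hB H0.
  have LVb : localization B (b ^+ f.+1 * a) b^-1.
    have -> : b^-1 = (a * b ^+ f) * (b ^+ f.+1 * a)^-1.
      by rewrite exprS; field; rewrite a0 b0 expf_neq0.
    by apply: subringM => //; apply: localization_sub.
  have LVa : localization B (b ^+ f.+1 * a) a^-1.
    have -> : a^-1 = b ^+ f.+1 * (b ^+ f.+1 * a)^-1.
      by rewrite exprS; field; rewrite a0 b0 expf_neq0.
    by apply: subringM => //; apply: localization_sub; apply: subringX.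
  apply: localization_le => //; first by rewrite mulf_neq0 ?expf_neq0.
    by move=> x /AB; apply: localization_le => // y; apply: localization_sub.
  by rewrite invfM -exprVn; apply: subringM => //; apply: subringX.
exists (d1 ^+ e1.+1 * d2), (d2 ^+ e2.+1 * d1); split; [split | split |].
- by rewrite exprS -mulrA [_ * d2]mulrC; apply: subringM.
- by rewrite mulf_neq0 ?expf_neq0.
- by move=> g Gg; rewrite rmorphM rmorphXn /= rd1 ?rd2.
- by rewrite exprS -mulrA [_ * d1]mulrC; apply: subringM.
- by rewrite mulf_neq0 ?expf_neq0.
- by move=> g Gg; rewrite rmorphM rmorphXn /= rd1 ?rd2.
by move=> x; split; apply: main.
Qed.

Variables (m : nat) (M : mx_representation int G m) (chi : 'rV[int]_m -> Om).
Hypothesis chiD : forall u v, chi (u + v) = chi u * chi v.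
Hypothesis chi_unit : forall v, unit_in A1 (chi v).
Hypothesis chi_rho : {in G, forall g v, rho g (chi v) = chi (v *m M g)}.
Hypothesis units12 : forall x, unit_in A2 x -> unit_in A1 x.
Hypothesis units1 : forall x, unit_in A1 x -> exists u v, unit_in A2 u /\ x = u * chi v.
Hypothesis chi_inj : forall v, unit_in A2 (chi v) -> v = 0.

(** Let W be the unit group of the common localization. Both W / A1^* and W / A2^* are
permutation lattices, and A1^* / A2^* is M, so 0 -> A1^* / A2^* -> W / A2^* -> W /
A1^* -> 0 is the required sequence. *)
Theorem quasi_permutation_two_models : quasi_permutation M.
Proof.
have [h1 [h2 [[Ah1 h10 rh1] [Ah2 h20 rh2] hW]]] := common_localization.
have [n1 [Q1 [v1 [perm1 v1M v1rho v1u v1s]]]] := unit_lattice rho1 rhoM hA1 fA1 rhoA1 Ah1 h10 rh1.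
have [n2 [Q2 [v2 [perm2 v2M v2rho v2u v2s]]]] := unit_lattice rho1 rhoM hA2 fA2 rhoA2 Ah2 h20 rh2.
pose W := unit_group A2 h2.
have W1 x : W x -> unit_group A1 h1 x.
  by move=> [x0 lx lVx]; split=> //; apply/hW.
have WW x : unit_group A1 h1 x -> W x.
  by move=> [x0 lx lVx]; split=> //; apply/hW.
have WM x y : W x -> W y -> W (x * y) by apply: unit_groupM.
have WV x : W x -> W x^-1 by apply: unit_groupV.
have Wrho g x : g \in G -> W x -> W (rho g x) by apply: unit_group_rho.
have Wchi v : W (chi v) by apply/WW/unit_in_group/chi_unit.
have u2v1 x : W x -> v2 x = 0 -> v1 x = 0.
  by move=> Wx e; apply/v1u; [exact: W1 | apply/units12/v2u].
have v21 : v2 1 = 0.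
  have W1' : W 1 by apply/unit_in_group/unit_in1.
  by have := v2M 1 1 W1' W1'; rewrite mulr1 => /eqP; rewrite -subr_eq0 opprD addrA subrr add0r oppr_eq0 => /eqP.
have v2V x : W x -> v2 x^-1 = - v2 x.
  move=> Wx; have [x0 _ _] := Wx; apply/eqP; rewrite -addr_eq0 -v2M //; last exact: WV.
  by rewrite mulVf // v21.
have v1_eq x y : W x -> W y -> v2 x = v2 y -> v1 x = v1 y.
  move=> Wx Wy e; have [y0 _ _] := Wy.
  have WVy := WV _ Wy; have Wxy := WM _ _ Wx WVy.
  have e0 : v1 (x / y) = 0 by apply: (u2v1) => //; rewrite v2M // v2V // e subrr.
  by rewrite -[x](mulfVK y0) v1M ?e0 ?add0r; [ | exact: W1 | exact: W1].
have /choice[w wP] : forall z : 'rV[int]_n2, exists x, W x /\ v2 x = z.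
  by move=> z; have [x Wx e] := v2s z; exists x.
pose i : 'M[int]_(m, n2) := \matrix_l v2 (chi (delta_mx 0 l)).
pose q : 'M[int]_(n2, n1) := \matrix_l v1 (w (delta_mx 0 l)).
have lin p r (f : 'rV[int]_p -> 'rV[int]_r) : (forall x y, f (x + y) = f x + f y) ->
    forall z, f z = z *m \matrix_l f (delta_mx 0 l).
  move=> fD z; have f0 : f 0 = 0.
    by have := fD 0 0; rewrite addr0 => /eqP; rewrite -subr_eq0 opprD addrA subrr add0r oppr_eq0 => /eqP.
  have fN x : f (- x) = - f x.
    by apply/eqP; rewrite -addr_eq0 -fD addNr f0.
  have fn x e : f (x *+ e) = f x *+ e.
    by elim: e => [|e IH]; rewrite ?mulr0n ?f0 // !mulrS fD IH.
  have fZ (e : int) x : f (e *: x) = e *: f x.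
    by case: e => e; rewrite ?NegzE ?scaleNr ?fN -!natz !scaler_nat fn.
  rewrite {1}[z]matrix_sum_delta big_ord1 (big_morph f fD f0) mulmx_sum_row.
  by apply: eq_bigr => l _; rewrite fZ rowK.
have iE v : v2 (chi v) = v *m i.
  apply: (lin _ _ (fun v => v2 (chi v))) => x y.
  by rewrite chiD; apply: v2M; apply: (Wchi).
have qE z : v1 (w z) = z *m q.
  apply: (lin _ _ (fun z => v1 (w z))) => x y.
  have [Wx ex] := wP x; have [Wy ey] := wP y; have [Wxy exy] := wP (x + y).
  rewrite -v1M; [|exact: W1|exact: W1]; apply: v1_eq => //; first exact: WM.
  by rewrite v2M // ex ey exy.
have v1q x : W x -> v1 x = v2 x *m q.
  move=> Wx; rewrite -qE; have [Ww ew] := wP (v2 x); exact: v1_eq.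
exists n2, Q2, n1, Q1, i, q; split=> //; split.
- move=> g Gg; apply/row_matrixP => l.
  rewrite !row_mul rowK -iE rowE -chi_rho //.
  exact: v2rho Gg (Wchi _).
- move=> g Gg; apply/row_matrixP => l.
  have [Ww ew] := wP (delta_mx 0 l).
  rewrite !row_mul rowK rowE -{1}ew -v2rho // -v1q; last exact: Wrho.
  by rewrite v1rho //; apply: W1.
- move=> x y e; apply/eqP; rewrite -subr_eq0; apply/eqP/chi_inj.
  apply: (proj1 (v2u _ (Wchi _))); rewrite iE mulmxBl; apply/eqP.
  by rewrite subr_eq0; apply/eqP.
- move=> y; split=> [yq|[x ->]]; last first.
    by rewrite -iE -v1q //; apply: (proj2 (v1u _ (W1 _ (Wchi _)))).
  have [Ww ew] := wP y.
  have e0 : v1 (w y) = 0 by rewrite qE.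
  have [u [v [uu e]]] := units1 (proj1 (v1u _ (W1 _ Ww)) e0).
  have Wu : W u by apply: unit_in_group.
  by exists v; rewrite -iE -ew e (v2M _ _ Wu (Wchi v)) (proj2 (v2u _ Wu) uu) add0r.
move=> z; have [x Ux e] := v1s z; exists (v2 x).
by rewrite -v1q -?e //; apply: WW.
Qed.
End TwoModels.

(** * The Galois action on the function field of a split torus *)

Section GaloisTorus.
Variables (k : fieldType) (L : splittingFieldType k).
Variables (gT : finGroupType) (G : {group gT}).
Variable phi : {morphism G >-> gal_of {:L}}.
Hypothesis galL : galois 1%AS {:L}.
Hypothesis isoG : isom G 'Gal({:L} / 1%AS) phi.
Local Notation F n := {fraction {mpoly L[n]}}.

(** The automorphism of L given by g, as a ring morphism. The group acts on the right:
sigma (g * h) is sigma g followed by sigma h. *)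
Definition sigma (g : gT) : {rmorphism L -> L} := phi g.
Arguments sigma : simpl never.

Lemma sigmaM g h x : g \in G -> h \in G -> sigma (g * h)%g x = sigma h (sigma g x).
Proof. by move=> Gg Gh; rewrite /sigma /= morphM // galM ?memvf. Qed.

Lemma sigma1 x : sigma 1%g x = x.
Proof. by rewrite /sigma /= morph1 gal_id. Qed.

Lemma sigma_fixed x : (forall g, g \in G -> sigma g x = x) -> exists c : k, x = c%:A.
Proof.
move=> fx; have /vlineP[c ->] : x \in 1%VS; last by exists c.
have /galois_fixedField <- := galL; apply/fixedFieldP; first exact: memvf.
move=> s; have /isomP[_ <-] := isoG; move=> /morphimP[g Gg _ ->].
exact: fx.
Qed.

(** A basis w of L over k and its dual basis c for the trace form: by Dedekind
independence the matrix of all conjugates of w is invertible, and the entries of the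
column of its inverse at the identity give c. *)
Lemma dual_basis : exists d (w c : 'I_d -> L),
  (forall g, g \in G -> \sum_j c j * sigma g (w j) = (g == 1%g)%:R) /\
  (forall i j, \sum_(g in G) sigma g (w i) * sigma g (c j) = (i == j)%:R).
Proof.
pose A := ('Gal({:L} / 1%AS))%G.
have [injphi imphi] := isomP isoG.
have reA (f : gal_of {:L} -> L) : \sum_(s in A) f s = \sum_(g in G) f (phi g).
  by rewrite /A -imphi morphimEdom big_imset //=; apply/injmP.
have [wt _ [Bu _ _]] := gal_matrix A.
set B := \matrix_(i, j) _ in Bu.
pose i1 : 'I_#|A| := enum_rank_in (group1 A) 1%g.
have ev1 : enum_val i1 = 1%g by apply: enum_rankK_in; apply: group1.
pose c j := invmx B j i1.
have cE s : s \in A -> \sum_j c j * s (tnth wt j) = (s == 1%g)%:R.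
  move=> As; have := congr1 (fun M : 'M_#|A| => M (enum_rank_in (group1 A) s) i1) (mulmxV Bu).
  rewrite !mxE => e; transitivity ((enum_rank_in (group1 A) s == i1)%:R : L).
    by rewrite -e; apply: eq_bigr => j _; rewrite mxE enum_rankK_in // mulrC.
  congr (_%:R); rewrite -(inj_eq enum_val_inj) ev1 enum_rankK_in //.
have galMr s t x : s \in A -> t \in A -> (s * t)%g x = t (s x).
  by move=> _ _; rewrite galM ?memvf.
pose C := \matrix_(j, i) (enum_val i : gal_of {:L}) (c j) : 'M[L]_#|A|.
(* The relation between c and w at the identity, conjugated by all of the group, says
   that the conjugates of c form the inverse matrix. *)
have BC : B *m C = 1%:M.
  apply/matrixP => i l; rewrite !mxE.
  have Ai := enum_valP i; have Al := enum_valP l.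
  transitivity ((enum_val l : gal_of {:L}) (\sum_j c j * (enum_val i * (enum_val l)^-1)%g (tnth wt j))).
    rewrite rmorph_sum; apply: eq_bigr => j _; rewrite !mxE rmorphM mulrC; congr (_ * _).
    by rewrite -{1}(mulgKV (enum_val l) (enum_val i)) galMr ?groupM ?groupV.
  rewrite cE ?groupM ?groupV // rmorph_nat; congr (_%:R).
  by rewrite -eq_mulgV1 (inj_eq enum_val_inj).
have CB := mulmx1C BC.
exists #|A|, (tnth wt), c; split=> [g Gg|i j].
  rewrite cE; last by rewrite -imphi mem_morphim.
  by congr (_%:R); rewrite -(morph1 phi) (inj_in_eq (injmP injphi)).
have := congr1 (fun M : 'M_#|A| => M j i) CB; rewrite !mxE eq_sym => <-.
transitivity (\sum_(s in A) s (c j) * s (tnth wt i)); last first.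
  by rewrite big_enum_val; apply: eq_bigr => s _; rewrite !mxE.
rewrite reA.
by apply: eq_bigr => g _; rewrite mulrC.
Qed.

Lemma map_mpoly_fixed n (p : {mpoly L[n]}) :
  (forall g, g \in G -> map_mpoly (sigma g) p = p) ->
  exists q : {mpoly k[n]}, p = map_mpoly (in_alg L) q.
Proof.
move=> fp; have /choice[c cP] : forall m, exists c : k, p@_m = c%:A.
  move=> m; apply: sigma_fixed => g Gg.
  by rewrite -[in RHS](fp g Gg) mcoeff_map_mpoly.
exists (\sum_(m <- msupp p) c m *: 'X_[m]); rewrite {1}[p]mpolyE raddf_sum /=.
by apply: eq_bigr => m _; rewrite map_mpolyZ map_mpolyX cP.
Qed.

Section Action.
Variables (n : nat) (M : mx_representation int G n).

(** The semilinear action of G on L(M), whose fixed field is the function field of the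
torus. *)
Definition torus_action (rho : gT -> {rmorphism F n -> F n}) := forall g, g \in G ->
  (forall c, rho g (lconst n c) = lconst n (sigma g c)) /\
  (forall v, rho g (char_mon L v) = char_mon L (v *m M g)).

Lemma torus_action_exists : exists rho, torus_action rho /\ forall x, rho 1%g x = x.
Proof.
have /choice[rho rhoP] : forall g, exists r : {rmorphism F n -> F n}, g \in G ->
    (forall c, r (lconst n c) = lconst n (sigma g c)) /\
    (forall v, r (char_mon L v) = char_mon L (v *m M g)).
  move=> g; have [Gg|_] := boolP (g \in G); last by exists idfun.
  have [r rP] : exists mu : {rmorphism F n -> F n},
      (forall c, mu (lconst n c) = lconst n (sigma g c)) /\
      (forall v, mu (char_mon L v) = char_mon L (v *m M g)).
    apply: monomial_map => v v0.
    by rewrite -[v](mulmxK (repr_mx_unit M Gg)) v0 mul0mx.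
  by exists r.
exists rho; split=> [g Gg|]; first exact: rhoP.
have [rC rX] := rhoP 1%g (group1 G).
apply: (laurent_rmorph_ext (f := rho 1%g) (g := idfun)) => [c|i].
  by rewrite rC sigma1.
by rewrite rX repr_mx1 mulmx1.
Qed.

Variable rho : gT -> {rmorphism F n -> F n}.
Hypothesis rhoP : torus_action rho.

Lemma torus_actionM : {in G &, forall g h x, rho (g * h)%g x = rho h (rho g x)}.
Proof.
move=> g h Gg Gh; have [gC gX] := rhoP Gg; have [hC hX] := rhoP Gh.
have [ghC ghX] := rhoP (groupM Gg Gh).
apply: (laurent_rmorph_ext (f := rho (g * h)%g) (g := rho h \o rho g)) => [c|i] /=.
  by rewrite ghC gC hC sigmaM.
by rewrite ghX gX hX repr_mxM // mulmxA.
Qed.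

Lemma is_laurent_rho g x : g \in G -> is_laurent x -> is_laurent (rho g x).
Proof.
move=> Gg [a ->]; have [rC rX] := rhoP Gg.
by rewrite (rmorph_laurent a rC rX); eexists.
Qed.

Lemma torus_pred_fixed x : reflect
  (is_laurent x /\ forall g, g \in G -> rho g x = x) (x \in torus_pred phi M).
Proof.
apply: (iffP (torus_predP phi M x)) => [[a aP ->]|[[a ->] fx]].
  split=> [|g Gg]; first by exists a.
  have [rC rX] := rhoP Gg; have gu := repr_mx_unit M Gg.
  rewrite (rmorph_laurent a rC rX); congr laurent.
  apply/malgP => v; rewrite raddf_sum /= -[v](mulmxKV gu).
  set u := v *m invmx (M g); rewrite aP //.
  rewrite [LHS](eq_bigr (fun w => sigma g (monalg.mcoeff w a) *+ (w == u))); last first.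
    by move=> w _; rewrite mcoeffU (inj_eq (can_inj (mulmxK gu))).
  have [u_a|u_a] := boolP (u \in monalg.msupp a).
    rewrite (big_fsetD1 u) //= eqxx mulr1n big1_fset ?addr0 // => w.
    by rewrite in_fsetD1 => /andP[/negPf->].
  rewrite (monalg.mcoeff_outdom u_a) rmorph0 big1_fset // => w w_a _.
  by case: eqP w_a u_a => [->|] // ->.
exists a => // g Gg v; have [rC rX] := rhoP Gg; have gu := repr_mx_unit M Gg.
have := fx g Gg; rewrite (rmorph_laurent a rC rX) => /laurent_inj e.
rewrite -{1}e raddf_sum /=.
rewrite [LHS](eq_bigr (fun w => sigma g (monalg.mcoeff w a) *+ (w == v))); last first.
  by move=> w _; rewrite mcoeffU (inj_eq (can_inj (mulmxK gu))).
have [u_a|u_a] := boolP (v \in monalg.msupp a).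
  rewrite (big_fsetD1 v) //= eqxx mulr1n big1_fset ?addr0 // => w.
  by rewrite in_fsetD1 => /andP[/negPf->].
rewrite (monalg.mcoeff_outdom u_a) rmorph0 big1_fset // => w w_a _.
by case: eqP w_a u_a => [->|] // ->.
Qed.

Lemma trace_invariant (x : F n) h : h \in G ->
  rho h (\sum_(g in G) rho g x) = \sum_(g in G) rho g x.
Proof.
move=> Gh; rewrite rmorph_sum [RHS](reindex_inj (mulIg h)) /=.
by apply: eq_big => g; [rewrite groupMr | move=> Gg; rewrite torus_actionM].
Qed.

(** Every x is a combination with coefficients in L of invariant elements, namely the
traces of the w_j x. *)
Lemma trace_expansion : exists d (w c : 'I_d -> L), forall x : F n,
  (forall y, rho 1%g y = y) ->
  x = \sum_j lconst n (c j) * \sum_(g in G) rho g (lconst n (w j) * x).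
Proof.
have [d [w [c [wc _]]]] := dual_basis; exists d, w, c => x rho1.
transitivity (\sum_(g in G) lconst n (\sum_j c j * sigma g (w j)) * rho g x).
  rewrite (bigD1 1%g) //= wc // eqxx rmorph1 mul1r rho1 big1 ?addr0 // => g /andP[Gg g1].
  by rewrite wc // (negPf g1) rmorph0 mul0r.
under eq_bigr => g _ do rewrite rmorph_sum mulr_suml.
rewrite exchange_big; apply: eq_bigr => j _; rewrite mulr_sumr; apply: eq_bigr => g Gg.
by have [rC _] := rhoP Gg; rewrite rmorphM rmorphM /= rC mulrA.
Qed.
End Action.

End GaloisTorus.

(** * Stably rational tori have quasi-permutation character lattices *)

Lemma trivial_repr (gT : finGroupType) (G : {group gT}) m :
  mx_repr G (fun _ : gT => 1%:M : 'M[int]_m).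
Proof. by split=> // g h _ _; rewrite mulmx1. Qed.

Definition trivial_lattice (gT : finGroupType) (G : {group gT}) m :=
  MxRepresentation (trivial_repr G m).

Lemma common_denominator (R : idomainType) (I : eqType) (s : seq I) (x : I -> {fraction R}) :
  exists2 d : R, d != 0 & forall i, i \in s -> exists a, x i = tofrac a / tofrac d.
Proof.
elim: s => [|j s [d d0 ds]]; first by exists 1; rewrite ?oner_eq0.
have [a [b [b0 e]]] := fraction_numden (x j).
have tb0 : tofrac b != 0 by rewrite tofrac_eq0.
have td0 : tofrac d != 0 by rewrite tofrac_eq0.
exists (b * d); first exact: mulf_neq0.
move=> i; rewrite inE => /orP[/eqP->|/ds[c ->]].
  exists (a * d); rewrite !tofracM e -mulf_div divff ?mulr1 //.
by exists (b * c); rewrite !tofracM -mulf_div divff ?mul1r.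
Qed.

Section StablyRationalTorus.
Variables (k : fieldType) (L : splittingFieldType k).
Variables (gT : finGroupType) (G : {group gT}).
Variable phi : {morphism G >-> gal_of {:L}}.
Hypothesis galL : galois 1%AS {:L}.
Hypothesis isoG : isom G 'Gal({:L} / 1%AS) phi.
Variables (n : nat) (M : mx_representation int G n).
Local Notation F n := {fraction {mpoly L[n]}}.
Local Notation K := {fraction (torus_ring phi M)}.

Lemma is_laurent_full N : fraction_full (@is_laurent k L N).
Proof.
move=> x; have [a [b [b0 ->]]] := fraction_numden x; exists (tofrac a), (tofrac b).
split; [apply: is_poly_laurent; by exists a | apply: is_poly_laurent; by exists b | | by []].
by rewrite tofrac_eq0.
Qed.

Lemma is_laurent_factorial N : factorial_subring (@is_laurent k L N).
Proof.
have hP := @is_poly_subring k L N.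
have t0 := char_mon_neq0 L (const_mx 1 : 'rV[int]_N).
have tP : is_poly (char_mon L (const_mx 1 : 'rV[int]_N)).
  by apply: is_poly_char_mon => i; rewrite mxE.
have fP : factorial_subring (@is_poly k L N).
  exact: (factorial_range (@tofrac_inj _) (@factorial_ring_mpoly L N)).
have e : @is_laurent k L N = localization (@is_poly k L N) (char_mon L (const_mx 1)).
  by apply/funext => x; apply/propext; apply: is_laurentE.
by rewrite e; apply: localization_factorial.
Qed.

Lemma is_laurent_generators N : exists s : seq (F N), forall S, subring_set S ->
  (forall c, S (lconst N c)) -> (forall x, x \in s -> S x) ->
  forall x, is_laurent x -> S x.
Proof.
exists ([seq char_mon L (delta_mx 0 i) | i <- enum 'I_N] ++
        [seq char_mon L (- delta_mx 0 i) | i <- enum 'I_N]) => S hS SC Ss.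
have Sp i : S (char_mon L (delta_mx 0 i)).
  by apply: Ss; rewrite mem_cat; apply/orP; left; apply/mapP; exists i; rewrite ?mem_enum.
have Sn i : S (char_mon L (- delta_mx 0 i)).
  by apply: Ss; rewrite mem_cat; apply/orP; right; apply/mapP; exists i; rewrite ?mem_enum.
apply: laurent_generated => // v.
have -> : v = \sum_i v 0 i *: delta_mx 0 i.
  by rewrite {1}[v]matrix_sum_delta big_ord1.
rewrite char_mon_sum; apply: subring_prod => // i _.
case: (v 0 i) => e; first by rewrite -char_monZ; apply: subringX.
by rewrite NegzE scaleNr -scalerN -char_monZ; apply: subringX.
Qed.

Variable m : nat.
Local Notation N := (n + m)%N.
Local Notation M' := (dsum_lattice M (trivial_lattice G m)).
Variable rho : gT -> {rmorphism F N -> F N}.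
Hypothesis rhoP : torus_action phi M' rho.

(** Let T be the torus of M, with function field K. The function field K(y_1, .., y_m)
of the product of T with an affine space is embedded in L(M + Z^m), with y_j sent to
the variable of the j-th trivial character; its image is fixed by G. Injectivity:
after a common denominator is cleared, a polynomial in y over K is a sum of Laurent
monomials with distinct exponents. *)
Lemma torus_embedding : exists (inc : {rmorphism F n -> F N})
    (iota : {rmorphism {fraction {mpoly K[m]}} -> F N}),
  [/\ (forall c, inc (lconst n c) = lconst N c) /\
      (forall v, inc (char_mon L v) = char_mon L (row_mx v 0)),
      forall x g, g \in G -> rho g (iota x) = iota x,
      forall c : k, iota (tofrac ((funconst (torus_const phi M) c)%:MP)) = lconst N c%:A,
      forall x, x \in torus_pred phi M -> exists y, iota y = inc x
    & forall j : 'I_m, exists y, iota y = char_mon L (delta_mx 0 (rshift n j))].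
Proof.
have [inc [incC incX]] : exists mu : {rmorphism F n -> F N},
    (forall c, mu (lconst n c) = lconst N c) /\
    (forall v, mu (char_mon L v) = char_mon L (row_mx v 0)).
  have [|mu [muC muX]] := @monomial_map _ L n N idfun (row_mx 1%:M 0).
    by move=> v; rewrite mul_mx_row mulmx1 => /(congr1 lsubmx); rewrite row_mxKl linear0.
  by exists mu; split=> // v; rewrite muX mul_mx_row mulmx1 mulmx0.
have val_inj' : injective (inc \o (val : torus_ring phi M -> F n)).
  by move=> x y /= /fmorph_inj/val_inj.
have [iK iKE] := fraction_lift val_inj'.
pose y_ (j : 'I_m) := char_mon L (delta_mx 0 (rshift n j) : 'rV[int]_N).
have [i0 [i0C i0X]] : exists i0 : {rmorphism {mpoly K[m]} -> F N},
    (forall c, i0 c%:MP = iK c) /\ (forall j, i0 'X_j = y_ j).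
  exists (mmap iK y_).
  by split=> [c|j] /=; rewrite ?mmapC ?mmapX ?mmap1U.
have rho_inc g x : g \in G -> x \in torus_pred phi M -> rho g (inc x) = inc x.
  have [rho0 [rho0P _]] := torus_action_exists phi M.
  move=> Gg /(torus_pred_fixed rho0P)[_ /(_ g Gg)].
  have [rC rX] := rhoP Gg; have [r0C r0X] := rho0P _ Gg.
  have e : rho g \o inc =1 inc \o rho0 g.
    apply: laurent_rmorph_ext => [c|i] /=; first by rewrite incC rC r0C incC.
    by rewrite incX rX r0X incX mul_row_block !mulmx0 mul0mx !addr0.
  by move=> e0; have /= -> := e x; rewrite e0.
have rho_iK g x : g \in G -> rho g (iK x) = iK x.
  move=> Gg; apply: (fraction_rmorph_ext (f := rho g \o iK) (g := iK)) => a /=.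
  by rewrite iKE /= rho_inc //; apply: valP.
have rho_y g j : g \in G -> rho g (y_ j) = y_ j.
  move=> Gg; have [_ rX] := rhoP Gg; rewrite rX; congr char_mon.
  by rewrite delta_mx_rshift mul_row_block !mul0mx mulmx0 mulmx1 !add0r.
have i0_inj : injective i0.
  suff ker p : i0 p = 0 -> p = 0 by apply: raddf_inj.
  have i0E : i0 p = \sum_(mm <- msupp p) iK p@_mm * char_mon L (row_mx 0 (mnm_row mm)).
    rewrite {1}[p]mpolyE rmorph_sum; apply: eq_bigr => mm _.
    rewrite -mul_mpolyC rmorphM i0C; congr (_ * _).
    have -> : row_mx 0 (mnm_row mm) = \sum_j (mm j)%:Z *: delta_mx 0 (rshift n j) :> 'rV[int]_N.
      have -> : row_mx 0 (mnm_row mm) = mnm_row mm *m row_mx 0 1%:M :> 'rV[int]_N.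
        by rewrite mul_mx_row mulmx0 mulmx1.
      rewrite mulmx_sum_row; apply: eq_bigr => j _.
      by rewrite row_row_mx row0 row1 delta_mx_rshift mxE.
    rewrite mpolyXE_id rmorph_prod char_mon_sum; apply: eq_bigr => j _.
    by rewrite rmorphXn i0X -char_monZ.
  have [d d0 dP] := common_denominator (msupp p) (fun mm => p@_mm).
  have /choice[l lP] : forall mm, exists l, mm \in msupp p ->
      iK p@_mm = inc (laurent l) / inc (val d) /\ (laurent l = 0 -> p@_mm = 0).
    move=> mm; have [/dP[a ea]|] := boolP (mm \in msupp p); last by exists 0.
    have [b _ eb] := torus_predP phi M _ (valP a); exists b => _.
    rewrite -eb ea fmorph_div !iKE; split=> // a0.
    by rewrite (_ : a = 0) ?tofrac0 ?mul0r //; apply: val_inj.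
  have vd0 : inc (val d) != 0.
    by rewrite fmorph_eq0; apply: contraNneq d0 => e; apply/eqP/val_inj.
  rewrite i0E big_seq => e0.
  pose s := [seq (mm, v) | mm <- msupp p, v <- monalg.msupp (l mm)].
  have {e0} e0 : \sum_(x <- s) lconst N (monalg.mcoeff x.2 (l x.1)) *
      char_mon L (row_mx x.2 (mnm_row x.1)) = 0.
    rewrite /s big_allpairs_dep /=.
    transitivity ((\sum_(i <- msupp p | i \in msupp p)
      iK p@_i * char_mon L (row_mx 0 (mnm_row i))) * inc (val d)); last by rewrite e0 mul0r.
    rewrite mulr_suml big_seq; apply: eq_bigr => mm mmp.
    have [-> _] := lP mm mmp; rewrite mulrAC mulfVK // laurentE rmorph_sum mulr_suml.
    apply: eq_bigr => v _; rewrite rmorphM incC incX -mulrA -char_monD.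
    by rewrite add_row_mx addr0 add0r.
  have us : uniq s.
    by apply: allpairs_uniq_dep => [|mm _|[? ?] [? ?] _ _ [-> ->]]; rewrite ?msupp_uniq ?fset_uniq.
  have s_inj : {in s &, injective (fun x : 'X_{1..m} * 'rV[int]_n => row_mx x.2 (mnm_row x.1))}.
    move=> [m1 v1] [m2 v2] _ _ /= /eq_row_mx[-> e].
    congr pair; apply/mnmP => j; move/matrixP/(_ 0 j): e.
    by rewrite !mxE => -[].
  have all0 := char_mon_independent us s_inj e0.
  apply/mpolyP => mm; rewrite mcoeff0.
  have [mmp|/memN_msupp_eq0//] := boolP (mm \in msupp p).
  have [_] := lP mm mmp; apply; rewrite (_ : l mm = 0) ?raddf0 //.
  apply/malgP => v; rewrite monalg.mcoeff0.
  have [v_s|/monalg.mcoeff_outdom//] := boolP (v \in monalg.msupp (l mm)).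
  by apply: (all0 (mm, v)); apply/allpairsPdep; exists mm, v.
have [iota iotaE] := fraction_lift i0_inj.
exists inc, iota; split=> //.
- move=> x g Gg; apply: (fraction_rmorph_ext (f := rho g \o iota) (g := iota)) => a /=.
  rewrite !iotaE; apply: (mpoly_rmorph_ext (f := rho g \o i0) (g := i0)) => [c|j] /=.
    by rewrite i0C rho_iK.
  by rewrite i0X rho_y.
- by move=> c; rewrite iotaE i0C iKE /= incC.
- by move=> x xP; exists (tofrac (tofrac (TorusRing xP))%:MP); rewrite iotaE i0C iKE.
by move=> j; exists (tofrac 'X_j); rewrite iotaE i0X.
Qed.

(** The coordinates of the rational variety, over k, generate a polynomial ring over L
inside L(M + Z^m). They stay algebraically independent over L: if a polynomial p over
L vanishes on them, so does its norm, a polynomial over k. The fractions are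
everything because by the trace expansion each variable is an L-combination of
elements of the function field over k. *)
Lemma stably_rational_coordinates nn
    (theta : {rmorphism {fraction {mpoly k[nn]}} -> {fraction {mpoly K[m]}}}) :
  bijective theta ->
  (forall c : k, theta (ratconst nn c) = tofrac ((funconst (torus_const phi M) c)%:MP_[m])) ->
  (forall x, rho 1%g x = x) ->
  exists beta : {rmorphism {mpoly L[nn]} -> F N},
  [/\ injective beta, forall c, beta c%:MP = lconst N c,
      forall g p, g \in G -> rho g (beta p) = beta (map_mpoly (sigma phi g) p)
    & fraction_full (fun x => exists p, x = beta p)].
Proof.
move=> [theta' thetaK thetaK'] thetaC rho1.
have [inc [iota [[incC incX] rho_iota iotaC inc_im y_im]]] := torus_embedding.
pose tau x := iota (theta x).
have [beta [betaC betaX]] : exists beta : {rmorphism {mpoly L[nn]} -> F N},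
    (forall c, beta c%:MP = lconst N c) /\ (forall i, beta 'X_i = tau (tofrac 'X_i)).
  exists (mmap (@lconst k L N) (fun i => tau (tofrac 'X_i))).
  by split=> [c|i] /=; rewrite ?mmapC ?mmapX ?mmap1U.
have beta_rho g p : g \in G -> rho g (beta p) = beta (map_mpoly (sigma phi g) p).
  move=> Gg; have [rC _] := rhoP Gg.
  apply: (mpoly_rmorph_ext (f := rho g \o beta) (g := beta \o map_mpoly (sigma phi g))) => [c|i] /=.
    by rewrite map_mpolyC !betaC rC.
  by rewrite map_mpolyX betaX rho_iota.
have beta_tau p : beta (map_mpoly (in_alg L) p) = tau (tofrac p).
  apply: (mpoly_rmorph_ext (f := beta \o map_mpoly (in_alg L))
     (g := iota \o theta \o @tofrac _)) => [c|i] /=.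
    by rewrite map_mpolyC betaC -[tofrac _]/(ratconst nn c) thetaC iotaC.
  by rewrite map_mpolyX betaX.
have sMap g h (p : {mpoly L[nn]}) : g \in G -> h \in G ->
    map_mpoly (sigma phi h) (map_mpoly (sigma phi g) p) = map_mpoly (sigma phi (g * h)%g) p.
  move=> Gg Gh; apply/mpolyP => mm; by rewrite !mcoeff_map_mpoly /= sigmaM.
have beta_inj : injective beta.
  suff ker (p : {mpoly L[nn]}) : beta p = 0 -> p = 0 by apply: raddf_inj.
  move=> bp0; apply/eqP; apply/negPn/negP => p0.
  pose Np := \prod_(g in G) map_mpoly (sigma phi g) p.
  have [g Gg|q eq] := @map_mpoly_fixed _ _ _ _ _ galL isoG nn Np.
    rewrite /Np rmorph_prod [RHS](reindex_inj (mulIg g)) /=.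
    by apply: eq_big => h; [rewrite groupMr | move=> Gh; rewrite sMap].
  have Np0 : Np != 0.
    apply/prodf_neq0 => g _; apply: contraNneq p0 => /mpolyP e; apply/eqP/mpolyP => mm.
    have := e mm; rewrite mcoeff_map_mpoly !mcoeff0 => /eqP.
    by rewrite fmorph_eq0 => /eqP.
  have : beta Np != 0.
    rewrite eq beta_tau /tau !fmorph_eq0 tofrac_eq0.
    by apply: contraNneq Np0 => q0; rewrite eq q0 rmorph0.
  rewrite /Np (bigD1 1%g) //= rmorphM.
  have -> : map_mpoly (sigma phi 1%g) p = p.
    by apply/mpolyP => mm; rewrite mcoeff_map_mpoly /= sigma1.
  by rewrite bp0 mul0r eqxx.
exists beta; split=> //.
pose A x := exists p, x = beta p.
have hA : subring_set A by apply: range_subring.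
pose Fr := fraction_set A.
have Fr_sub : subring_set Fr by apply: fraction_set_subring.
have Fr_A x : A x -> Fr x by apply: fraction_set_sub.
have Fr_C c : Fr (lconst N c) by apply: Fr_A; exists c%:MP; rewrite betaC.
have Fr_iota x : Fr (iota x).
  rewrite -[x]thetaK'; have [a [b [b0 ->]]] := fraction_numden (theta' x).
  rewrite !fmorph_div; apply: fraction_set_div => //; apply: Fr_A.
    by exists (map_mpoly (in_alg L) a); rewrite beta_tau.
  by exists (map_mpoly (in_alg L) b); rewrite beta_tau.
have Fr_inc i : Fr (inc (char_mon L (delta_mx 0 i))).
  have [rho0 [rho0P rho01]] := torus_action_exists phi M.
  have [d [w [c e]]] := trace_expansion isoG rho0P.
  rewrite (e (char_mon L (delta_mx 0 i)) rho01) rmorph_sum; apply: subring_sum => // j _.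
  rewrite rmorphM incC; apply: subringM => //.
  have [|y <- //] := inc_im (\sum_(g in G) rho0 g (lconst n (w j) * char_mon L (delta_mx 0 i))).
  apply/(torus_pred_fixed rho0P); split; last first.
    by move=> g Gg; apply: (trace_invariant rho0P).
  have hL := @is_laurent_subring k L n.
  apply: (big_ind (@is_laurent k L n)) => [|? ?|g Gg].
  - by exists 0; rewrite raddf0.
  - exact: subringD.
  have [rC rX] := rho0P _ Gg; rewrite rmorphM rC rX.
  by apply: subringM => //; [apply: is_laurent_lconst | apply: is_laurent_char_mon].
have Fr_delta i : Fr (char_mon L (delta_mx 0 i)).
  case: (split_ordP i) => j ->; first by rewrite delta_mx_lshift -incX.
  by have [y <-] := y_im j.
have Fr_poly x : is_poly x -> Fr x.
  move=> [p ->]; rewrite lconst_char_mon_mnm; apply: subring_sum => // mm _.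
  apply: subringM => //.
  have -> : mnm_row mm = \sum_i (mm i)%:Z *: delta_mx 0 i.
    by rewrite [LHS]matrix_sum_delta big_ord1; apply: eq_bigr => i _; rewrite mxE.
  rewrite char_mon_sum; apply: subring_prod => // i _.
  by rewrite -char_monZ; apply: subringX.
move=> x; have [a [b [b0 ->]]] := fraction_numden x.
by apply: fraction_set_div => //; apply: Fr_poly; [exists a | exists b].
Qed.

End StablyRationalTorus.

Lemma char_mon_lconst (k : fieldType) (L : splittingFieldType k) n (v : 'rV[int]_n) c :
  char_mon L v = lconst n c -> v = 0.
Proof.
move=> e; have : laurent << 1 *g v >> = laurent << c *g 0 >> :> {fraction {mpoly L[n]}}.
  by rewrite !laurentU rmorph1 mul1r char_mon0 mulr1.
move/laurent_inj/(congr1 (monalg.mcoeff v)); rewrite !mcoeffU eqxx mulr1n.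
by case: eqP => // _ /eqP; rewrite mulr0n oner_eq0.
Qed.

(** The field L(M + Z^m) is the fraction field of the Laurent polynomial ring, with
units L^* x (M + Z^m), and of the polynomial ring over L in the coordinates of the
rational variety, with units L^*. Both are factorial, finitely generated over L and
stable under G. *)
Theorem stably_rational_quasi_permutation (k : fieldType) (L : splittingFieldType k)
    (gT : finGroupType) (G : {group gT}) (phi : {morphism G >-> gal_of {:L}})
    n (M : mx_representation int G n) :
  galois 1%AS {:L} -> isom G 'Gal({:L} / 1%AS) phi ->
  stably_rational (torus_const phi M) ->
  exists m, quasi_permutation (dsum_lattice M (trivial_lattice G m)).
Proof.
move=> galL isoG [m [nn [theta [theta_bij thetaC]]]]; exists m.
pose M' := dsum_lattice M (trivial_lattice G m).
have [rho [rhoP rho1]] := torus_action_exists phi M'.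
have [beta [beta_inj betaC beta_rho beta_full]] :=
  stably_rational_coordinates galL isoG rhoP theta_bij thetaC rho1.
pose A2 x := exists p, x = beta p.
have hA1 := @is_laurent_subring k L (n + m).
have hA2 : subring_set A2 by apply: range_subring.
have fA1 := @is_laurent_factorial k L (n + m).
have fA2 : factorial_subring A2 by apply: (factorial_range beta_inj (@factorial_ring_mpoly L nn)).
have units2 x : unit_in A2 x <-> exists2 c, c != 0 & x = lconst (n + m) c.
  split=> [ux|[c c0 ->]].
    have [_ [p ep] _] := ux; move: ux; rewrite ep => /(unit_in_range beta_inj)/mpoly_unitP[c c0 ->].
    by exists c; rewrite ?betaC.
  by rewrite -betaC; apply/(unit_in_range beta_inj)/mpoly_unitP; exists c.
apply: (quasi_permutation_two_models rho1 (torus_actionM rhoP) hA1 hA2 fA1 fA2 _ _ _ _ _ _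
   (chi := @char_mon k L (n + m))).
- by move=> g Gg x; apply: (is_laurent_rho rhoP Gg).
- by move=> g Gg _ [p ->]; rewrite beta_rho //; eexists.
- exact: is_laurent_full.
- exact: beta_full.
- have [s sP] := is_laurent_generators L (n + m); exists s => S hS S2; apply: sP => //.
  by move=> c; apply: S2; exists c%:MP; rewrite betaC.
- exists [seq beta 'X_i | i <- enum 'I_nn] => S hS S1 Ss _ [p ->].
  rewrite [p]mpolyE rmorph_sum; apply: subring_sum => // mm _.
  rewrite -mul_mpolyC rmorphM betaC; apply: subringM => //.
    by apply: S1; apply: is_laurent_lconst.
  rewrite mpolyXE_id rmorph_prod; apply: subring_prod => // i _.
  rewrite rmorphXn; apply: subringX => //; apply: Ss.
  by apply/mapP; exists i; rewrite ?mem_enum.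
- exact: char_monD.
- move=> v; split; [exact: char_mon_neq0 | exact: is_laurent_char_mon |].
  by rewrite -char_monN; apply: is_laurent_char_mon.
- by move=> g Gg v; have [_ rX] := rhoP g Gg; apply: rX.
- move=> _ /units2[c c0 ->]; split; [ | exact: is_laurent_lconst | ].
    by rewrite fmorph_eq0.
  by rewrite -fmorphV; apply: is_laurent_lconst.
- move=> x /unit_laurentP[c [v [c0 ->]]]; exists (lconst (n + m) c), v; split=> //.
  by apply/units2; exists c.
by move=> v /units2[c c0 /char_mon_lconst].
Qed.

(** * Traces of permutation lattices *)

Section Traces.
Variables (gT : finGroupType) (G : {group gT}).

(** The sequence splits over the integers because the quotient is free. *)
Lemma short_exact_split l m n (M : mx_representation int G l)
    (P : mx_representation int G m) (Q : mx_representation int G n) i q :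
  short_exact M P Q i q -> exists (r : 'M[int]_(m, l)) (s : 'M[int]_(n, m)),
  [/\ i *m r = 1%:M, s *m q = 1%:M, s *m r = 0 & r *m i + q *m s = 1%:M].
Proof.
move=> [_ _ i_inj ker_q q_surj].
have /choice[s0 s0P] : forall j : 'I_n, exists y : 'rV[int]_m, delta_mx 0 j = y *m q.
  by move=> j; apply: q_surj.
pose s : 'M[int]_(n, m) := \matrix_j s0 j.
have sq : s *m q = 1%:M by apply/row_matrixP => j; rewrite row_mul rowK -s0P row1.
have /choice[r0 r0P] : forall j : 'I_m, exists x : 'rV[int]_l,
    row j (1%:M - q *m s) = x *m i.
  move=> j; apply/ker_q; rewrite -row_mul mulmxBl -mulmxA sq mul1mx mulmx1 subrr.
  by rewrite row0.
pose r : 'M[int]_(m, l) := \matrix_j r0 j.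
have ri : r *m i = 1%:M - q *m s.
  by apply/row_matrixP => j; rewrite row_mul rowK -r0P.
have inj p (x y : 'M[int]_(p, l)) : x *m i = y *m i -> x = y.
  move=> e; apply/row_matrixP => j; apply: i_inj; rewrite -!row_mul e //.
have iq : i *m q = 0.
  apply/row_matrixP => j; rewrite row_mul row0; apply/ker_q.
  by exists (delta_mx 0 j); rewrite rowE.
exists r, s; split=> //; last by rewrite ri subrK.
  by apply: inj; rewrite mul1mx -mulmxA ri mulmxBr mulmxA iq mul0mx subr0 mulmx1.
by apply: inj; rewrite mul0mx -mulmxA ri mulmxBr mulmxA sq mulmx1 mul1mx subrr.
Qed.

Lemma short_exact_trace l m n (M : mx_representation int G l)
    (P : mx_representation int G m) (Q : mx_representation int G n) i q g :
  short_exact M P Q i q -> g \in G -> \tr (P g) = \tr (M g) + \tr (Q g).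
Proof.
move=> ex Gg; have [r [s [ir sq _ e]]] := short_exact_split ex.
have [Mi Pq _ _ _] := ex.
rewrite -[P g]mulmx1 -e mulmxDr linearD /=; congr (_ + _).
  by rewrite mulmxA mxtrace_mulC mulmxA -Mi // -mulmxA ir mulmx1.
by rewrite mulmxA Pq // mxtrace_mulC mulmxA sq mul1mx.
Qed.

(** The trace of a permutation is the number of its fixed points. *)
Lemma permutation_lattice_action n (P : mx_representation int G n) :
  permutation_lattice P -> exists f : gT -> 'I_n -> 'I_n,
  [/\ forall x, f 1%g x = x,
      {in G &, forall g h x, f (g * h)%g x = f h (f g x)}
    & {in G, forall g, \tr (P g) = #|[set x | f g x == x]|%:Z}].
Proof.
move=> [U Uu UP].
have /choice[f0 f0P] : forall gi : gT * 'I_n, exists j, gi.1 \in G ->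
    row gi.2 U *m P gi.1 = row j U.
  move=> [g i] /=; have [/UP/(_ i)[j]|_] := boolP (g \in G); last by exists i.
  by exists j.
pose f g i := f0 (g, i).
have fP g i : g \in G -> row i U *m P g = row (f g i) U by move=> Gg; apply: (f0P (g, i)).
have row_inj : injective (fun i => row i U).
  move=> i j /(congr1 (mulmx^~ (invmx U))); rewrite -!row_mul mulmxV // !row1.
  move/matrixP/(_ 0 i); rewrite !mxE !eqxx /=.
  by case: eqP.
exists f; split=> [x|g h Gg Gh x|g Gg].
- by apply: row_inj; rewrite /= -fP // repr_mx1 mulmx1.
- by apply: row_inj; rewrite /= -fP ?groupM // repr_mxM // mulmxA !fP.
pose D : 'M[int]_n := \matrix_(i, j) (j == f g i)%:R.
have UD : U *m P g = D *m U.
  apply/row_matrixP => i; rewrite !row_mul fP // [row i D](_ : _ = delta_mx 0 (f g i)) -?rowE //.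
  by apply/rowP => j; rewrite !mxE eqxx.
have -> : P g = invmx U *m (D *m U) by rewrite -UD mulKmx.
rewrite mxtrace_mulC mulmxK // /mxtrace.
rewrite (eq_bigr (fun i => (f g i == i)%:R)) => [|i _]; last by rewrite !mxE eq_sym.
rewrite -natr_sum natz -sum1_card [in RHS]big_mkcond; congr Posz.
by apply: eq_bigr => i _; rewrite inE; case: eqP.
Qed.

Variables a z c : gT.
Hypotheses (Ga : a \in G) (Gc : c \in G).
Hypotheses (az : (a ^+ 4 = z)%g) (z2 : (z ^+ 2 = 1)%g) (c3 : (c ^+ 3 = 1)%g).
Hypothesis ac : (a * c = c ^+ 2 * a)%g.

Let conj_c e : (a * c ^+ e = c ^+ (2 * e) * a)%g.
Proof.
elim: e => [|e IH]; first by rewrite muln0 !expg0 mulg1 mul1g.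
by rewrite expgS mulgA ac -mulgA IH mulgA -expgD mulnS.
Qed.

Let commute_zc : commute z c.
Proof.
have a2c : commute (a ^+ 2) c.
  have ac2 : (a * c ^+ 2 = c * a)%g.
    by rewrite conj_c -[(2 * 2)%N]/(3 + 1)%N expgD c3 mul1g expg1.
  by rewrite /commute expgS expg1 -mulgA ac mulgA ac2 mulgA.
by rewrite -az -[4%N]/(2 * 2)%N expgM; apply: commute_sym; apply/commuteX/commute_sym.
Qed.

(** The set of points fixed neither by z nor by c is stable under a, since a
normalizes <c> and centralizes z. It is a union of free orbits of <a>, which is cyclic
of order 8: a nontrivial subgroup of <a> contains z. *)
Lemma faithful_orbits_dvd8 n (f : gT -> 'I_n -> 'I_n) :
  (forall x, f 1%g x = x) -> {in G &, forall g h x, f (g * h)%g x = f h (f g x)} ->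
  (8 %| #|[set x | (f z x != x) && (f c x != x)]|)%N.
Proof.
move=> f1 fM; set X := [set x | _].
have [->|[x0]] := set_0Vmem X; first by rewrite cards0.
rewrite inE => /andP[zx0 _].
have a8 : (a ^+ 8 = 1)%g by rewrite -[8%N]/(4 * 2)%N expgM az z2.
have oa : #[a]%g = 8.
  have : (#[a]%g %| 8)%N by rewrite order_dvdn a8.
  have N4 : ~~ (#[a]%g %| 4)%N.
    by rewrite order_dvdn az; apply: contra zx0 => /eqP->; rewrite f1.
  by move=> /(dvdn_pfactor _ 3 (isT : prime 2))[[|[|[|[|//]]]] _ e] //; rewrite e in N4.
have Gz : z \in G by rewrite -az groupX.
have fX g e x : g \in G -> f g x = x -> f (g ^+ e)%g x = x.
  by move=> Gg fx; elim: e => [|e IH]; rewrite ?expg0 // expgS fM ?groupX // fx.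
have Xa x : x \in X -> f a x \in X.
  have inj : injective (f a).
    move=> u v e; have := congr1 (f a^-1%g) e.
    by rewrite -!fM ?groupV // mulgV !f1.
  rewrite !inE -!fM // => /andP[zx cx]; apply/andP; split.
    have -> : (a * z = z * a)%g by rewrite -az -expgS -expgSr.
    by rewrite fM // (inj_eq inj).
  apply: contra cx; rewrite ac fM ?groupX // (inj_eq inj) => /eqP c2x.
  have := fX _ 2 _ (groupX 2 Gc) c2x; rewrite -expgM.
  by rewrite -[(2 * 2)%N]/(3 + 1)%N expgD c3 mul1g expg1 => ->.
pose to x g := if g \in <[a]>%g then f g x else x.
have aG : <[a]>%g \subset G by rewrite cycle_subG.
have to_act : is_action <[a]>%g to.
  split=> [g u v|x g h ag ah].
    rewrite /to; case: ifP => // ag /(congr1 (f g^-1%g)); have Gg := subsetP aG _ ag.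
    by rewrite -!fM ?groupV // mulgV !f1.
  by rewrite /to groupM // ag ah fM // (subsetP aG).
pose toA := Action to_act.
have actsX : [acts <[a]>%g, on X | toA].
  apply/subsetP => g ag; rewrite inE; apply/andP; split=> //.
  rewrite inE; apply/subsetP => x Xx; rewrite inE /= /to ag.
  have /cycleP[e ->] := ag; elim: e => [|e IH]; first by rewrite expg0 f1.
  by rewrite expgSr fM ?groupX // Xa.
rewrite -(acts_sum_card_orbit actsX); apply: dvdn_sum => T /imsetP[x Xx ->].
rewrite card_orbit_in // (_ : ('C_(<[a]>)[x | toA] = 1)%g) ?indexg1 -?orderE ?oa //.
apply/trivgP/subsetP => g /setIP[ag]; rewrite inE => /andP[_].
rewrite inE => /subsetP/(_ x); rewrite !inE eqxx => /(_ isT) /=.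
rewrite /to ag => /eqP gx; move: Xx; rewrite inE => /andP[zx _].
have /cyclePmin[e] := ag; rewrite oa => e8 ge.
have Gg := subsetP aG _ ag.
have no j : (g ^+ j)%g != z.
  by apply: contra zx => /eqP <-; rewrite fX.
have a12 : (a ^+ 12)%g = z by rewrite -[12%N]/(8 + 4)%N expgD a8 mul1g az.
have a20 : (a ^+ 20)%g = z by rewrite -[20%N]/(8 + 12)%N expgD a8 mul1g a12.
have a28 : (a ^+ 28)%g = z by rewrite -[28%N]/(8 + 20)%N expgD a8 mul1g a20.
move: (no 1%N) (no 2) (no 4); rewrite ge -!expgM.
(* The powers 1, 2, 4 of a^e reach z = a^4 modulo 8, unless e = 0. *)
by case: e e8 {ge} => [|[|[|[|[|[|[|[|//]]]]]]]] _; rewrite ?expg0 ?az ?a12 ?a20 ?a28 ?eqxx.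
Qed.

(** By inclusion and exclusion the alternating sum counts the points fixed neither by
z nor by c: those fixed by z * c are fixed by both, as z and c are powers of z * c. *)
Lemma permutation_trace_dvd8 n (P : mx_representation int G n) :
  permutation_lattice P ->
  (8 %| (\tr (P 1%g) - \tr (P z) - \tr (P c) + \tr (P (z * c)%g)))%Z.
Proof.
move=> /permutation_lattice_action[f [f1 fM trP]].
have Gz : z \in G by rewrite -az groupX.
rewrite !trP ?groupM ?group1 //.
have -> : [set x | f 1%g x == x] = setT by apply/setP => x; rewrite !inE f1 eqxx.
have fX g e x : g \in G -> f g x = x -> f (g ^+ e)%g x = x.
  by move=> Gg fx; elim: e => [|e IH]; rewrite ?expg0 // expgS fM ?groupX // fx.
have -> : [set x | f (z * c)%g x == x] = [set x | f z x == x] :&: [set x | f c x == x].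
  apply/setP => x; rewrite !inE; apply/eqP/andP => [e|[/eqP zx /eqP cx]].
    have zc3 : ((z * c) ^+ 3 = z)%g.
      by rewrite expgMn // c3 mulg1 expgS z2 mulg1.
    have zc4 : ((z * c) ^+ 4 = c)%g.
      by rewrite expgSr zc3 mulgA -expg2 z2 mul1g.
    have := fX _ 3 _ (groupM Gz Gc) e; have := fX _ 4 _ (groupM Gz Gc) e.
    by rewrite zc3 zc4 => -> ->; rewrite !eqxx.
  by rewrite fM // zx cx.
set Z := [set x | f z x == x]; set C := [set x | f c x == x].
have := faithful_orbits_dvd8 f1 fM.
have -> : [set x | (f z x != x) && (f c x != x)] = ~: (Z :|: C).
  by apply/setP => x; rewrite !inE negb_or.
have := cardsC (Z :|: C); have := cardsUI Z C; rewrite cardsT.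
by lia.
Qed.

End Traces.

(** * The trace obstruction for the given lattice *)

Section QuasiPermutationTrace.
Variables (gT : finGroupType) (G : {group gT}) (a z c : gT).
Hypotheses (Ga : a \in G) (Gc : c \in G).
Hypotheses (az : (a ^+ 4 = z)%g) (z2 : (z ^+ 2 = 1)%g) (c3 : (c ^+ 3 = 1)%g).
Hypothesis ac : (a * c = c ^+ 2 * a)%g.

Lemma quasi_permutation_trace_dvd8 n (M : mx_representation int G n) :
  quasi_permutation M ->
  (8 %| (\tr (M 1%g) - \tr (M z) - \tr (M c) + \tr (M (z * c)%g)))%Z.
Proof.
move=> [p [P [r [Q [i [q [permP permQ ex]]]]]]].
have Gz : z \in G by rewrite -az groupX.
have dP := permutation_trace_dvd8 Ga Gc az z2 c3 ac permP.
have dQ := permutation_trace_dvd8 Ga Gc az z2 c3 ac permQ.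
have tM g : g \in G -> \tr (M g) = \tr (P g) - \tr (Q g).
  by move=> Gg; rewrite (short_exact_trace ex Gg) addrK.
rewrite !tM ?groupM // (_ : _ + _ =
  (\tr (P 1%g) - \tr (P z) - \tr (P c) + \tr (P (z * c)%g)) -
  (\tr (Q 1%g) - \tr (Q z) - \tr (Q c) + \tr (Q (z * c)%g))); last by ring.
exact: rpredB.
Qed.
End QuasiPermutationTrace.

Lemma mxA_in : mxA \in G_pred.
Proof. by apply/G_predP/gen_in; left. Qed.
Lemma mxB_in : mxB \in G_pred.
Proof. by apply/G_predP/gen_in; right. Qed.

Definition gA : G_4_33_2_1 := MkG mxA_in.
Definition gB : G_4_33_2_1 := MkG mxB_in.
(** The normal subgroup of order 3 is generated by C = ABBAB, and A acts on it by
inversion; the elements of the group are the 24 products C^i A^j. The power A^4 is the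
central element -1. *)
Definition gC : G_4_33_2_1 := (gA * (gB * (gB * (gA * gB))))%g.

Lemma G_valM (x y : G_4_33_2_1) : G_mx (x * y)%g = G_mx x *m G_mx y.
Proof. by []. Qed.

Lemma G_val1 : G_mx 1%g = 1%:M.
Proof. by []. Qed.

Lemma G_valX (x : G_4_33_2_1) s e :
  G_mx x = mx_rows s -> G_mx (x ^+ e)%g = mx_rows (iter e (rows_mul s) rows1).
Proof.
move=> xs; elim: e => [|e IH]; first by rewrite expg0 G_val1 -mx_rows1.
by rewrite expgS G_valM IH xs -mx_rowsM.
Qed.

Lemma gA_val : G_mx gA = mx_rows rowsA. Proof. by []. Qed.

Lemma gC_val : G_mx gC = mx_rows rowsC.
Proof. by rewrite /gC !G_valM /rowsC !mx_rowsM. Qed.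

Definition gZ := (gA ^+ 4)%g.

Lemma gZ_val : G_mx gZ = mx_rows (iter 4 (rows_mul rowsA) rows1).
Proof. exact: G_valX gA_val. Qed.

Lemma G_eq (x y : G_4_33_2_1) s t : G_mx x = mx_rows s -> G_mx y = mx_rows t ->
  s == t -> x = y.
Proof. by move=> xs yt /eqP e; apply: val_inj; rewrite /= xs yt e. Qed.

Lemma gZ2 : (gZ ^+ 2 = 1)%g.
Proof.
apply: (G_eq (G_valX 2 gZ_val) (t := rows1)); last by vm_compute.
by rewrite G_val1 mx_rows1.
Qed.

Lemma gC3 : (gC ^+ 3 = 1)%g.
Proof.
apply: (G_eq (G_valX 3 gC_val) (t := rows1)); last by vm_compute.
by rewrite G_val1 mx_rows1.
Qed.

Lemma gAC : (gA * gC = gC ^+ 2 * gA)%g.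
Proof.
apply: (@G_eq _ _ (rows_mul rowsA rowsC)
  (rows_mul (iter 2 (rows_mul rowsC) rows1) rowsA)); last by vm_compute.
  by rewrite G_valM gC_val mx_rowsM.
by rewrite G_valM (G_valX 2 gC_val) mx_rowsM.
Qed.

Definition rows_trace (s : seq (seq int)) : int :=
  \sum_(i <- [:: 0%N; 1%N; 2; 3]) nth 0 (nth [::] s i) i.

Lemma mx_rows_trace s : \tr (mx_rows s) = rows_trace s.
Proof.
rewrite /mxtrace /rows_trace !big_ord_recl big_ord0 !big_cons big_nil.
by rewrite !mxE.
Qed.

(** The alternating sum of traces is 4 + 4 + 2 + 2 = 12, which is not a multiple of 8,
and trivial summands contribute 0 to it. *)
Lemma M_G_not_quasi_permutation m :
  ~ quasi_permutation (dsum_lattice M_G (trivial_lattice [set: G_4_33_2_1] m)).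
Proof.
move=> qp; have := quasi_permutation_trace_dvd8 (in_setT gA) (in_setT gC)
  (erefl gZ) gZ2 gC3 gAC qp.
have t g : \tr (dsum_lattice M_G (trivial_lattice [set: G_4_33_2_1] m) g) = \tr (G_mx g) + m%:Z.
  by rewrite /= /dsum_mx mxtrace_block mxtrace1 natz.
have e (x y u v w : int) : (x + w) - (y + w) - (u + w) + (v + w) = x - y - u + v by ring.
rewrite !t e.
rewrite (G_valM gZ gC) gC_val gZ_val -mx_rowsM G_val1 -mx_rows1 !mx_rows_trace.
by rewrite /rows_trace unlock; vm_compute.
Qed.

Lemma M_G_not_quasi_permutation0 : ~ quasi_permutation M_G.
Proof.
move=> qp; have := quasi_permutation_trace_dvd8 (in_setT gA) (in_setT gC)
  (erefl gZ) gZ2 gC3 gAC qp.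
have t g : \tr (M_G g) = \tr (G_mx g) by [].
rewrite !t (G_valM gZ gC) gC_val gZ_val -mx_rowsM G_val1 -mx_rows1 !mx_rows_trace.
by rewrite /rows_trace unlock; vm_compute.
Qed.

(** * Quotients and summands of lattices *)

Section Complement.

(** The Smith normal form makes the matrix diagonal up to changes of basis; a right
inverse forces the diagonal entries to be units, and the remaining basis vectors span
a complement. *)
Lemma complement_unimodular l m (i : 'M[int]_(l, m)) (r : 'M[int]_(m, l)) :
  i *m r = 1%:M -> exists n (r' : 'M[int]_(m, l)) (q : 'M[int]_(m, n)) (s : 'M[int]_(n, m)),
  [/\ i *m r' = 1%:M, s *m q = 1%:M, i *m q = 0, s *m r' = 0
    & r' *m i + q *m s = 1%:M].
Proof.
move=> ir; have [A Au [B Bu [d _ e]]] := int_Smith_normal_form i.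
set D := \matrix_(_, _) _ in e.
have DX : D *m (B *m r *m A) = 1%:M.
  have -> : D = invmx A *m i *m invmx B by rewrite e -[A *m D *m B]mulmxA mulKmx // mulmxK.
  by rewrite !mulmxA mulmxKV // -(mulmxA (invmx A)) ir mulmx1 mulVmx.
have Dcol (j : 'I_l) : exists2 j' : 'I_m, val j' = val j & d`_j \is a GRing.unit.
  have := congr1 (fun X : 'M_l => X j j) DX; rewrite !mxE eqxx.
  have [lt_jm|le_mj] := ltnP j m; last first.
    rewrite big1 // => j' _; rewrite !mxE (_ : (j == j' :> nat) = false) ?mulr0n ?mul0r //.
    by apply/negP => /eqP ej; move: le_mj; rewrite ej leqNgt ltn_ord.
  rewrite (bigD1 (Ordinal lt_jm)) //= big1 ?addr0 => [|j' jj'].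
    rewrite !mxE eqxx mulr1n => dx; exists (Ordinal lt_jm) => //.
    by apply/unitrP; eexists; split; last exact: dx; rewrite mulrC.
  rewrite !mxE (_ : (j == j' :> nat) = false) ?mulr0n ?mul0r //.
  by apply: contraNF jj' => /eqP ej; apply/eqP/val_inj.
have le_lm : (l <= m)%N.
  case: l @D i r ir A Au e DX Dcol => // l D i r ir A Au e DX Dcol.
  by have [j' ej _] := Dcol ord_max; have := ltn_ord j'; rewrite ej.
move: B Bu e DX Dcol; rewrite {}/D.
have em : m = (l + (m - l))%N by rewrite subnKC.
move: (m - l)%N em => n em; subst m => B Bu e DX Dcol.
pose dl : 'rV[int]_l := \row_j d`_j.
pose dv : 'rV[int]_l := \row_j (d`_j)^-1.
have ED : \matrix_(i0 < l, j < l + n) (d`_i0 *+ (i0 == j :> nat)) = row_mx (diag_mx dl) 0.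
  apply/matrixP => i0 j; rewrite mxE; case: (split_ordP j) => j' ->.
    by rewrite row_mxEl !mxE.
  rewrite row_mxEr mxE (_ : (i0 == _ :> nat) = false) //.
  by rewrite /= ltn_eqF // ltn_addr.
have dd : diag_mx dl *m diag_mx dv = 1%:M.
  rewrite mulmx_diag; apply/matrixP => x y; rewrite !mxE; case: eqP => // _.
  by have [_ _ du] := Dcol x; rewrite mulrV.
have dd' := mulmx1C dd.
rewrite ED in e.
exists n, (invmx B *m col_mx (diag_mx dv) 0 *m invmx A), (invmx B *m col_mx 0 1%:M),
  (row_mx 0 1%:M *m B); split.
- rewrite e -!mulmxA (mulmxA B) mulmxV // mul1mx (mulmxA (row_mx _ _)) mul_row_col.
  by rewrite mul0mx addr0 dd mul1mx mulmxV.
- by rewrite -mulmxA mulKVmx // mul_row_col mul0mx mulmx1 add0r.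
- by rewrite e -!mulmxA mulKVmx // mul_row_col mulmx0 mul0mx addr0 mulmx0.
- by rewrite -!mulmxA mulKVmx // mulmxA mul_row_col !mul0mx mulmx0 addr0 mul0mx.
have -> : invmx B *m col_mx (diag_mx dv) 0 *m invmx A *m i =
    invmx B *m (col_mx (diag_mx dv) 0 *m row_mx (diag_mx dl) 0) *m B.
  by rewrite e -!mulmxA mulKmx.
have -> : invmx B *m col_mx 0 1%:M *m (row_mx 0 1%:M *m B) =
    invmx B *m (col_mx 0 1%:M *m row_mx 0 1%:M) *m B by rewrite !mulmxA.
rewrite -mulmxDl -mulmxDr !mul_col_row !mul0mx !mulmx0 dd' mul1mx add_block_mx.
by rewrite !addr0 add0r -scalar_mx_block mulmx1 mulVmx.
Qed.

End Complement.

Section QuotientLattice.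
Variables (gT : finGroupType) (G : {group gT}).

Lemma quotient_lattice l m (M : mx_representation int G l) (P : mx_representation int G m)
    (i : 'M[int]_(l, m)) r : equivariant M P i -> i *m r = 1%:M ->
  exists n (Q : mx_representation int G n) q s,
    [/\ short_exact M P Q i q, equivariant P Q q, s *m q = 1%:M
      & exists r', i *m r' = 1%:M /\ r' *m i + q *m s = 1%:M].
Proof.
move=> Mi /complement_unimodular[n [r' [q [s [ir sq iq sr e]]]]].
pose Qm g := s *m P g *m q.
have Qq g : g \in G -> P g *m q = q *m Qm g.
  move=> Gg; rewrite /Qm !mulmxA -[LHS]mul1mx -e mulmxDl !mulmxA.
  by rewrite -(mulmxA r') -Mi // -!mulmxA iq !mulmx0 add0r.
have Qr : mx_repr G Qm.
  split=> [|g h Gg Gh]; first by rewrite /Qm repr_mx1 mulmx1.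
  by rewrite {1}/Qm repr_mxM // mulmxA -(mulmxA _ (P h)) Qq // mulmxA.
exists n, (MxRepresentation Qr), q, s; split=> //; last by exists r'.
split=> // [x y exy|y|z].
- by rewrite -[x]mulmx1 -ir mulmxA exy -mulmxA ir mulmx1.
- split=> [yq|[x ->]]; last by rewrite -mulmxA iq mulmx0.
  by exists (y *m r'); rewrite -{1}[y]mulmx1 -e mulmxDr !mulmxA yq mul0mx addr0.
by exists (z *m s); rewrite -mulmxA sq mulmx1.
Qed.

(** The kernel of b is the complement of Q in the permutation lattice P. It is
identified with the cokernel of a, which is free. *)
Lemma summand_invertible n p (Q : mx_representation int G n) (P : mx_representation int G p)
    (a : 'M[int]_(n, p)) b : permutation_lattice P ->
  equivariant Q P a -> equivariant P Q b -> a *m b = 1%:M -> invertible_lattice Q.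
Proof.
move=> permP Qa Pb ab.
have [n' [N [q [s [_ Pq sq [r [ar e]]]]]]] := quotient_lattice Qa ab.
exists n', N, p, P; split=> //.
have aq : a *m q = 0.
  have : a *m (r *m a + q *m s) *m q = a *m q by rewrite e mulmx1.
  rewrite mulmxDr !mulmxA ar mul1mx mulmxDl -(mulmxA (a *m q)) sq mulmx1.
  by move/eqP; rewrite -subr_eq0 addrK => /eqP.
pose t := s *m (1%:M - b *m a).
have ak : a *m (1%:M - b *m a) = 0 by rewrite mulmxBr mulmx1 mulmxA ab mul1mx subrr.
have qt : q *m t = 1%:M - b *m a.
  have -> : q *m t = (1%:M - r *m a) *m (1%:M - b *m a).
    by rewrite /t mulmxA; congr (_ *m _); rewrite -e addrAC subrr add0r.
  by rewrite mulmxBl mul1mx -mulmxA ak mulmx0 subr0.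
exists (col_mx a t), (row_mx b q); split.
- move=> g Gg; rewrite mul_block_col !mul0mx addr0 add0r mul_col_mx Qa //.
  congr col_mx; rewrite -[N g]mul1mx -sq -(mulmxA s) -Pq // -!mulmxA qt.
  congr (s *m _); rewrite mulmxBr mulmx1 mulmxBl mul1mx.
  by rewrite mulmxA Pb // -mulmxA Qa // mulmxA.
- have kb : (1%:M - b *m a) *m b = 0.
    by rewrite mulmxBl mul1mx -mulmxA ab mulmx1 subrr.
  have kq : (1%:M - b *m a) *m q = q.
    by rewrite mulmxBl mul1mx -mulmxA aq mulmx0 subr0.
  by rewrite mul_col_row ab aq -!mulmxA kb kq mulmx0 sq -scalar_mx_block.
by rewrite mul_row_col qt addrC subrK.
Qed.

(** If a kills the image of M and if b is equivariant and a right inverse of a modulo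
the image of M, then a and b make P / M a direct summand of P'. Vectors y in the image
of M are recognized by y = y r i. *)
Lemma quasi_invertible_criterion l m p (M : mx_representation int G l)
    (P : mx_representation int G m) (P' : mx_representation int G p)
    (i : 'M[int]_(l, m)) (r : 'M[int]_(m, l)) (a : 'M[int]_(m, p)) (b : 'M[int]_(p, m)) :
  permutation_lattice P -> permutation_lattice P' ->
  equivariant M P i -> i *m r = 1%:M -> equivariant P P' a -> i *m a = 0 ->
  (forall g, g \in G -> P' g *m b - b *m P g = (P' g *m b - b *m P g) *m r *m i) ->
  a *m b - 1%:M = (a *m b - 1%:M) *m r *m i ->
  quasi_invertible M.
Proof.
move=> permP permP' Mi ir Pa ia Pb ab.
have [n [Q [q [s [ex Pq sq [r' [ir' e]]]]]]] := quotient_lattice Mi ir.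
exists m, P, n, Q, i, q; split=> //.
have iq : i *m q = 0.
  have : i *m (r' *m i + q *m s) *m q = i *m q by rewrite e mulmx1.
  rewrite mulmxDr !mulmxA ir' mul1mx mulmxDl -(mulmxA (i *m q)) sq mulmx1.
  by move/eqP; rewrite -subr_eq0 addrK => /eqP.
have qsa : q *m (s *m a) = a.
  by rewrite -[RHS]mul1mx -e mulmxDl -(mulmxA r') ia mulmx0 add0r mulmxA.
apply: (summand_invertible (a := s *m a) (b := b *m q) permP').
- move=> g Gg; have -> : Q g = s *m P g *m q by rewrite -mulmxA Pq // mulmxA sq mul1mx.
  by rewrite -!mulmxA qsa Pa.
- move=> g Gg; have -> : b *m q *m Q g = b *m P g *m q by rewrite -!mulmxA Pq.
  by apply/eqP; rewrite mulmxA -subr_eq0 -mulmxBl Pb // -(mulmxA _ i q) iq mulmx0.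
have : s *m (a *m b - 1%:M) *m q = 0 by rewrite ab -(mulmxA _ _ q) -(mulmxA _ i q) iq !mulmx0.
rewrite mulmxBr mulmx1 mulmxBl sq !mulmxA => /eqP.
by rewrite subr_eq0 => /eqP.
Qed.

End QuotientLattice.

(** * An explicit splitting of Z[G] / M *)

Section ListMatrices.
(** Lists of integers are used for the matrices of the data below so that identities
between them are decided by evaluation. *)
Definition lget (s : seq (seq int)) i j := nth 0 (nth [::] s i) j.
Definition lbuild m n (f : nat -> nat -> int) :=
  [seq [seq f i j | j <- iota 0 n] | i <- iota 0 m].
Definition lmx m n s : 'M[int]_(m, n) := \matrix_(i, j) lget s i j.
Definition lmul m n p s t := lbuild m p (fun i j =>
  foldr (fun e x => lget s i e * lget t e j + x) 0 (iota 0 n)).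
Definition lsub m n s t := lbuild m n (fun i j => lget s i j - lget t i j).
Definition lone n := lbuild n n (fun i j => if i == j then 1 else 0).

Lemma lget_build m n f i j : (i < m)%N -> (j < n)%N -> lget (lbuild m n f) i j = f i j.
Proof.
move=> im jn; rewrite /lget /lbuild (nth_map 0%N) ?size_iota // nth_iota //.
by rewrite (nth_map 0%N) ?size_iota // nth_iota.
Qed.

Lemma lmx_build m n f : lmx m n (lbuild m n f) = \matrix_(i, j) f i j.
Proof. by apply/matrixP => i j; rewrite !mxE lget_build. Qed.

Lemma lmx_mul m n p s t : lmx m p (lmul m n p s t) = lmx m n s *m lmx n p t.
Proof.
rewrite lmx_build; apply/matrixP => i j; rewrite !mxE.
under [RHS]eq_bigr => e _ do rewrite !mxE.
rewrite -(big_mkord predT (fun e => lget s i e * lget t e j)) /index_iota subn0.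
by elim: (iota 0 n) => [|e r IH]; rewrite ?big_nil ?big_cons //= IH.
Qed.

Lemma lmx_sub m n s t : lmx m n (lsub m n s t) = lmx m n s - lmx m n t.
Proof. by rewrite lmx_build; apply/matrixP => i j; rewrite !mxE. Qed.

Lemma lmx_one n : lmx n n (lone n) = 1%:M.
Proof.
rewrite lmx_build; apply/matrixP => i j; rewrite !mxE.
by rewrite (inj_eq val_inj); case: eqP.
Qed.
End ListMatrices.

(** Product and inverse in the group, with C^i A^j numbered 8 i + j as in the list of
its elements: A^j C^k = C^((-1)^j k) A^j. *)
Definition mul_index (x y : nat) : nat :=
  (8 * ((x %/ 8 + (if odd (x %% 8) then 2 else 1) * (y %/ 8)) %% 3) + (x %% 8 + y %% 8) %% 8)%N.
Definition inv_index (x : nat) : nat :=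
  (8 * (((if odd (x %% 8) then 2 else 1) * (3 - x %/ 8)) %% 3) + (8 - x %% 8) %% 8)%N.
Definition nth_rows (x : nat) := nth [::] G_rows x.

Lemma mul_indexP : all (fun x => all (fun y => (mul_index x y < 24)%N &&
  (nth_rows (mul_index x y) == rows_mul (nth_rows x) (nth_rows y))) (iota 0 24)) (iota 0 24).
Proof. by vm_compute. Qed.

Lemma G_rows_wf : all (fun s => (size s == 4%N) && all (fun r => size r == 4%N) s) G_rows.
Proof. by vm_compute. Qed.

Lemma G_rows_uniq : uniq G_rows /\ size G_rows = 24.
Proof. by vm_compute. Qed.

Lemma mx_rows_inj : {in G_rows &, injective mx_rows}.
Proof.
move=> s t /(allP G_rows_wf)/andP[/eqP s4 sr] /(allP G_rows_wf)/andP[/eqP t4 tr] e.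
apply: (@eq_from_nth _ [::]); rewrite ?s4 ?t4 // => i i4.
have /eqP si := all_nthP [::] sr i (eq_ind_r (fun n => i < n)%N i4 s4).
have /eqP ti := all_nthP [::] tr i (eq_ind_r (fun n => i < n)%N i4 t4).
apply: (@eq_from_nth _ 0); rewrite ?si ?ti // => j j4.
by move/matrixP/(_ (Ordinal i4) (Ordinal j4)): e; rewrite !mxE.
Qed.

Definition elt_index (g : G_4_33_2_1) : nat :=
  find (fun x => G_mx g == mx_rows (nth_rows x)) (iota 0 24).

Lemma elt_indexP g : (elt_index g < 24)%N /\ G_mx g = mx_rows (nth_rows (elt_index g)).
Proof.
have /mapP[s sG e] := G_finite (valP g).
have h : has (fun x => G_mx g == mx_rows (nth_rows x)) (iota 0 24).
  apply/hasP; exists (index s G_rows).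
    by have := sG; rewrite -index_mem (proj2 G_rows_uniq) mem_iota.
  by rewrite /nth_rows nth_index // [G_mx g]e.
split; first by rewrite /elt_index -[X in (_ < X)%N](size_iota 0 24) -has_find.
have lt : (elt_index g < 24)%N by rewrite /elt_index -[X in (_ < X)%N](size_iota 0 24) -has_find.
have /eqP := nth_find 0%N h; rewrite nth_iota //.
Qed.

Lemma elt_index_uniq g x : (x < 24)%N -> G_mx g = mx_rows (nth_rows x) -> elt_index g = x.
Proof.
have [U S] := G_rows_uniq; have [lt e] := elt_indexP g => lx ex.
have lS y : (y < 24)%N -> (y < size G_rows)%N by rewrite S.
apply/eqP; rewrite -(nth_uniq [::] (lS _ lt) (lS _ lx) U); apply/eqP.
by apply: mx_rows_inj; [exact/mem_nth/lS | exact/mem_nth/lS | rewrite -[LHS]e -ex].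
Qed.

Lemma elt_indexM g h : elt_index (g * h)%g = mul_index (elt_index g) (elt_index h).
Proof.
have [lg eg] := elt_indexP g; have [lh eh] := elt_indexP h.
have /allP/(_ (elt_index g)) := mul_indexP; rewrite mem_iota => /(_ lg)/allP/(_ (elt_index h)).
rewrite mem_iota => /(_ lh)/andP[l /eqP e]; apply: elt_index_uniq => //.
by rewrite G_valM eg eh e mx_rowsM.
Qed.

Lemma elt_index1 : elt_index 1%g = 0%N.
Proof. by apply: elt_index_uniq => //; rewrite G_val1 -mx_rows1. Qed.

Lemma inv_indexP : all (fun x => [&& (inv_index x < 24)%N, mul_index (inv_index x) x == 0%N
  & mul_index x (inv_index x) == 0%N]) (iota 0 24).
Proof. by vm_compute. Qed.

Section PermutationTable.
Variables (n : nat) (act : nat -> nat -> nat).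
Definition action_table :=
  all (fun x => (act x 0 == x) && all (fun y => (act x y < n)%N &&
    all (fun z => act (act x y) z == act x (mul_index y z)) (iota 0 24)) (iota 0 24)) (iota 0 n).
Hypothesis actP : action_table.

Definition table_mx (g : G_4_33_2_1) : 'M[int]_n :=
  \matrix_(x, y) (val y == act x (elt_index g))%:R.

Lemma table_row x k : (x < n)%N -> (k < 24)%N -> (act x k < n)%N.
Proof.
move=> xn kn; have /allP/(_ x) := actP; rewrite mem_iota => /(_ xn)/andP[_ /allP/(_ k)].
by rewrite mem_iota => /(_ kn)/andP[].
Qed.

Lemma row_table_mx (x : 'I_n) g :
  row x (table_mx g) = delta_mx 0 (Ordinal (table_row (ltn_ord x) (proj1 (elt_indexP g)))).
Proof.
by apply/rowP => y; rewrite !mxE eqxx /= -(inj_eq val_inj).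
Qed.

Lemma table_act x k l : (x < n)%N -> (k < 24)%N -> (l < 24)%N ->
  act (act x k) l = act x (mul_index k l).
Proof.
move=> xn kn ln; have /allP/(_ x) := actP; rewrite mem_iota => /(_ xn)/andP[_ /allP/(_ k)].
by rewrite mem_iota => /(_ kn)/andP[_ /allP/(_ l)]; rewrite mem_iota => /(_ ln)/eqP.
Qed.

Lemma table_act0 x : (x < n)%N -> act x 0 = x.
Proof. by move=> xn; have /allP/(_ x) := actP; rewrite mem_iota => /(_ xn)/andP[/eqP]. Qed.

Lemma table_mulmx p b g : table_mx g *m lmx n p b =
  lmx n p (lbuild n p (fun x y => lget b (act x (elt_index g)) y)).
Proof.
apply/row_matrixP => x; rewrite row_mul row_table_mx -rowE lmx_build.
by apply/rowP => y; rewrite !mxE.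
Qed.

Lemma mulmx_table m a g : lmx m n a *m table_mx g =
  lmx m n (lbuild m n (fun x y => lget a x (act y (inv_index (elt_index g))))).
Proof.
have [gn _] := elt_indexP g.
have /allP/(_ (elt_index g)) := inv_indexP; rewrite mem_iota => /(_ gn)/and3P[vn /eqP vg /eqP gv].
rewrite lmx_build; apply/matrixP => x y; rewrite !mxE.
rewrite (bigD1 (Ordinal (table_row (ltn_ord y) vn))) //= big1 ?addr0 => [|e ne].
  by rewrite !mxE /= table_act // vg table_act0 // eqxx mulr1.
rewrite !mxE; case: eqP => [ey|_]; last by rewrite mulr0.
by case/eqP: ne; apply: val_inj; rewrite /= ey table_act // gv table_act0.
Qed.

Lemma table_repr : mx_repr [set: G_4_33_2_1] table_mx.
Proof.
split=> [|g h _ _]; apply/row_matrixP => x; rewrite row_table_mx.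
  rewrite row1; congr delta_mx; apply: val_inj; rewrite /= elt_index1.
  exact: table_act0.
rewrite row_mul row_table_mx -rowE row_table_mx; congr delta_mx; apply: val_inj => /=.
by rewrite table_act ?elt_indexM //; [have [] := elt_indexP g | have [] := elt_indexP h].
Qed.

Definition table_lattice := MxRepresentation table_repr.

Lemma table_lattice_permutation : permutation_lattice table_lattice.
Proof.
exists 1%:M; first exact: unitmx1.
move=> g _ x; rewrite row1 -rowE /= row_table_mx; eexists; rewrite row1; reflexivity.
Qed.
End PermutationTable.

(** The right action on G, and that on the disjoint union of G, of the 12 cosets <A^4>
g, and of the 8 cosets <C> g. The coset of C^i A^j has the number 24 + 4 i + (j mod 4)
in the second part and 36 + j in the third. *)
Definition regular_act (x k : nat) := mul_index x k.
Definition coset_act (x k : nat) : nat :=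
  if (x < 24)%N then mul_index x k
  else if (x < 36)%N then
    let y := mul_index (8 * ((x - 24) %/ 4) + (x - 24) %% 4) k in
    (24 + 4 * (y %/ 8) + (y %% 8) %% 4)%N
  else (36 + mul_index (x - 36) k %% 8)%N.

Lemma regular_actP : action_table 24 regular_act. Proof. by vm_compute. Qed.
Lemma coset_actP : action_table 44 coset_act. Proof. by vm_compute. Qed.

(** The embedding i of M in Z[G] sends m to the sum of the (m g^-1)_0 [g], where x_0
is the first coordinate of x. *)
Definition i_list := lbuild 4 24 (fun l x => lget (nth_rows (inv_index x)) l 0).
(** A left inverse of the embedding, so its image is saturated in Z[G]. *)
Definition r_list : seq (seq int) := lbuild 24 4 (fun x l => match x with
  | 0%N => nth 0 [:: 1; 1; 0; -1] l | 1%N => nth 0 [:: 0; 0; -1; 0] l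
  | 2 => nth 0 [:: 0; 0; -1; 1] l | 8 => nth 0 [:: 0; 1; -1; 0] l | _ => 0 end).
(** The images under i of a = e_0 - e_3 and b = e_1. Since a changes sign under A^4,
and b + bC + bC^2 = 0, one can solve beta2 (1 - A^4) = i(a) and beta3 (1 - C) = i(b)
in Z[G]: beta2 is the part of i(a) on half of G, and beta3 is made of the partial sums
of i(b) along the cosets h <C>. Then beta2 i(m) = i(3 m) and beta3 i(m) = i(-2 m), so
that alpha = 1 - beta2 - beta3 kills i(M). *)
Definition i_a := [seq lget i_list 0 x - lget i_list 3 x | x <- iota 0 24].
Definition i_b := [seq lget i_list 1 x | x <- iota 0 24].
Definition beta2 := [seq if (x %% 8 < 4)%N then nth 0 i_a x else 0 | x <- iota 0 24].
Definition beta3 := [seq if (x < 8)%N then nth 0 i_b x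
  else let h := (x %% 8)%N in let hC := mul_index h 8 in
    if x == hC then nth 0 i_b h + nth 0 i_b hC else 0 | x <- iota 0 24].
Definition alpha := [seq (if x == 0%N then 1 else 0) - nth 0 beta2 x - nth 0 beta3 x | x <- iota 0 24].

(** The map from Z[G] to the permutation lattice of coset_act sends g to alpha g, to the
coset <A^4> g and to the coset <C> g. The map back is the identity on Z[G] and sends
these cosets to beta2 g and beta3 g, which depend only on the cosets modulo i(M). The
composite is alpha + beta2 + beta3 = 1. *)
Definition to_split_list := lbuild 24 44 (fun g t =>
  if (t < 24)%N then nth 0 alpha (mul_index t (inv_index g))
  else if (t < 36)%N then if t == (24 + 4 * (g %/ 8) + (g %% 8) %% 4)%N then 1 else 0
  else if t == (36 + g %% 8)%N then 1 else 0).
Definition from_split_list := lbuild 44 24 (fun t x =>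
  if (t < 24)%N then if t == x then 1 else 0
  else if (t < 36)%N then
    nth 0 beta2 (mul_index x (inv_index (8 * ((t - 24) %/ 4) + (t - 24) %% 4)))
  else nth 0 beta3 (mul_index x (inv_index (t - 36)))).

Lemma i_check : all (fun k => lmul 4 4 24 (nth_rows k) i_list ==
  lbuild 4 24 (fun x y => lget i_list x (regular_act y (inv_index k)))) (iota 0 24).
Proof. by vm_compute. Qed.

Lemma r_check : lmul 4 24 4 i_list r_list == lone 4.
Proof. by vm_compute. Qed.

Lemma ia_check : lmul 4 24 44 i_list to_split_list == lbuild 4 44 (fun _ _ => 0).
Proof. by vm_compute. Qed.

Lemma a_check : all (fun k =>
  lbuild 24 44 (fun x y => lget to_split_list (regular_act x k) y) ==
  lbuild 24 44 (fun x y => lget to_split_list x (coset_act y (inv_index k)))) (iota 0 24).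
Proof. by vm_compute. Qed.

(** The map back is equivariant modulo i(M) only: the defect d satisfies d = d r i. *)
Lemma b_check : all (fun k =>
  let d := lsub 44 24 (lbuild 44 24 (fun x y => lget from_split_list (coset_act x k) y))
    (lbuild 44 24 (fun x y => lget from_split_list x (regular_act y (inv_index k)))) in
  d == lmul 44 4 24 (lmul 44 24 4 d r_list) i_list) (iota 0 24).
Proof. by vm_compute. Qed.

Lemma ab_check : let d := lsub 24 24 (lmul 24 44 24 to_split_list from_split_list) (lone 24) in
  d == lmul 24 4 24 (lmul 24 24 4 d r_list) i_list.
Proof. by vm_compute. Qed.

Theorem M_G_quasi_invertible : quasi_invertible M_G.
Proof.
have idx g : elt_index g \in iota 0 24 by rewrite mem_iota; have [] := elt_indexP g.
have Mg g : M_G g = lmx 4 4 (nth_rows (elt_index g)) by have [_ e] := elt_indexP g; exact: e.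
apply: (quasi_invertible_criterion (P := table_lattice regular_actP) (P' := table_lattice coset_actP)
  (i := lmx 4 24 i_list) (r := lmx 24 4 r_list) (a := lmx 24 44 to_split_list) (b := lmx 44 24 from_split_list)).
- exact: table_lattice_permutation.
- exact: table_lattice_permutation.
- by move=> g _; rewrite Mg -lmx_mul (eqP (allP i_check _ (idx g))) -(mulmx_table regular_actP).
- by rewrite -lmx_mul (eqP r_check) lmx_one.
- move=> g _; rewrite [LHS](table_mulmx regular_actP) (eqP (allP a_check _ (idx g))).
  by rewrite -(mulmx_table coset_actP).
- rewrite -lmx_mul (eqP ia_check) lmx_build.
  by apply/matrixP => x y; rewrite !mxE.
- move=> g _; rewrite [table_lattice coset_actP g *m _](table_mulmx coset_actP).
  rewrite [_ *m table_lattice regular_actP g](mulmx_table regular_actP) -lmx_sub -!lmx_mul.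
  by rewrite {1}(eqP (allP b_check _ (idx g))).
by rewrite -!lmx_mul -lmx_one -lmx_sub -!lmx_mul {1}(eqP ab_check).
Qed.

(** * A criterion for retract rationality *)

Lemma rmorph_factor (K F E : fieldType) (g : {rmorphism K -> E}) (j : {rmorphism F -> E}) :
  (forall x, exists y, j y = g x) ->
  exists f : {rmorphism K -> F}, forall x, j (f x) = g x.
Proof.
move=> /choice[f fP].
have fB : zmod_morphism f.
  by move=> x y; apply: (fmorph_inj j); rewrite rmorphB !fP rmorphB.
have fM : monoid_morphism f.
  split; first by apply: (fmorph_inj j); rewrite fP !rmorph1.
  by move=> x y; apply: (fmorph_inj j); rewrite rmorphM !fP rmorphM.
pose FZ := GRing.isZmodMorphism.Build _ _ f fB.
pose FM := GRing.isMonoidMorphism.Build _ _ f fM.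
pose f' : {rmorphism K -> F} := HB.pack f FZ FM.
by exists f'.
Qed.

(** A homomorphism on A extends to A[1/f]; the extension is only specified there. *)
Lemma localization_hom (A : idomainType) (E K : fieldType) (j : {rmorphism A -> E})
    (s : {rmorphism A -> K}) (f : A) : injective j -> s f != 0 ->
  exists psi : E -> K, forall p e, psi (j p / j f ^+ e) = s p / s f ^+ e.
Proof.
move=> j_inj sf0.
have jf0 : j f != 0 by rewrite -(rmorph0 j) (inj_eq j_inj); apply: contraNneq sf0 => ->; rewrite rmorph0.
have H y : exists z, forall p e, y = j p / j f ^+ e -> z = s p / s f ^+ e.
  have [[p [e ->]]|no] := pselect (exists p e, y = j p / j f ^+ e); last first.
    by exists 0 => p e ey; case: no; exists p, e.
  exists (s p / s f ^+ e) => q e' /eqP.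
  rewrite eqr_div ?expf_neq0 // -!(rmorphXn j) -!(rmorphM j) (inj_eq j_inj) => /eqP e1.
  by apply/eqP; rewrite eqr_div ?expf_neq0 // -!(rmorphXn s) -!(rmorphM s) e1.
have [psi psiP] := choice H.
by exists psi => p e; apply: psiP.
Qed.

Lemma localization_invl (D : fieldType) (A : D -> Prop) a b :
  A b -> a != 0 -> localization A (a * b) a^-1.
Proof. by move=> Ab a0; exists 1%N; rewrite expr1 mulKf. Qed.

Lemma fraction_scale (D : fieldType) (p f H : D) e : H != 0 ->
  p / f ^+ e = (p * H ^+ e) / (f * H) ^+ e.
Proof. by move=> H0; rewrite exprMn -mulf_div divff ?mulr1 ?expf_neq0. Qed.

Lemma fraction_sub (D : fieldType) (a b c d : D) : b != 0 -> d != 0 ->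
  a / b - c / d = (a * d - c * b) / (b * d).
Proof. by move=> b0 d0; rewrite -mulNr addf_div // mulNr. Qed.

Section Criterion.
Variables (k : fieldType) (R : idomainType) (iota : {rmorphism k -> R}).
Local Notation K := {fraction R}.
Variables (B : idomainType) (cst : {rmorphism k -> B}) (f : B).
Local Notation E := {fraction B}.
Variables (psi0 : {rmorphism B -> K}) (phi0 : {rmorphism K -> E}).
Hypothesis psi0C : forall c, psi0 (cst c) = funconst iota c.
Hypothesis phi0C : forall c, phi0 (funconst iota c) = tofrac (cst c).
Hypothesis psi0_gen : exists s : seq K, forall S, subring_set S ->
  (forall c, S (funconst iota c)) -> (forall x, x \in s -> S x) -> forall p, S (psi0 p).
Hypothesis psi0f : psi0 f != 0.
Hypothesis retr : forall a : R, exists p e,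
  phi0 (tofrac a) = tofrac p / tofrac f ^+ e /\ psi0 p / psi0 f ^+ e = tofrac a.

Definition is_localized (g : B) (u : E) := exists p e, u = tofrac p / tofrac g ^+ e.

Lemma is_localizedE (g : B) x : g != 0 ->
  is_localized g x <-> localization (fun y => exists p, y = tofrac p) (tofrac g) x.
Proof.
move=> g0; have tg0 : tofrac g != 0 by rewrite tofrac_eq0.
split=> [[p [e ->]]|[e [p ep]]]; [exists e, p | exists p, e].
  by rewrite mulfVK ?expf_neq0.
by rewrite -ep mulfK ?expf_neq0.
Qed.

(** The maps psi0 and phi0 have denominators, which are absorbed as follows. Let h be
a common denominator in R for the values of psi0 on generators and for the inverse of
psi0 f, and let S = R[1/h]. If phi0 h = H / f^e, then phi0 maps S to B[1/(f H)], and
psi0 extends to B[1/(f H)] with values in S because psi0 H = h psi0(f)^e is a unit of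
S. *)
Lemma retract_data : exists S : K -> Prop,
  [/\ subring_set S, forall c, S (funconst iota c),
      forall x : K, exists a b : K, [/\ S a, S b, b != 0 & x = a / b]
    & exists (g : B) (psi : E -> K),
      [/\ g != 0, hom_on S (is_localized g) phi0,
          hom_on (is_localized g) S psi /\ (forall c, psi (tofrac (cst c)) = funconst iota c)
        & forall x, S x -> psi (phi0 x) = x]].
Proof.
have f0 : f != 0 by apply: contraNneq psi0f => ->; rewrite rmorph0.
pose A (x : K) := exists a, x = tofrac a.
have hA : subring_set A by apply: range_subring.
have [gens gensP] := psi0_gen.
have [h h0 hP] := common_denominator ((psi0 f)^-1 :: gens) id.
have th0 : tofrac h != 0 :> K by rewrite tofrac_eq0.
pose S := localization A (tofrac h).
have Ah : A (tofrac h) by exists h.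
have hS : subring_set S by apply: localization_subring.
have SA x : A x -> S x by apply: localization_sub.
have SVh : S (tofrac h)^-1 by apply: localization_inv.
have Sden x : x \in (psi0 f)^-1 :: gens -> S x.
  by move=> /hP[a ->]; apply: subringM => //; apply: SA; exists a.
have SVf : S (psi0 f)^-1 by apply: Sden; rewrite inE eqxx.
have Spsi p : S (psi0 p).
  apply: gensP => // [c|x x_s]; first by apply: SA; exists (iota c).
  by apply: Sden; rewrite inE x_s orbT.
have [H [eh [phih psih]]] := retr h.
have H0 : H != 0.
  apply: contraNneq th0 => e; rewrite -(fmorph_eq0 phi0) phih e.
  by rewrite rmorph0 mul0r.
have psiH0 : psi0 H != 0.
  by apply: contraNneq th0 => e; rewrite -psih e mul0r.
have fH0 : f * H != 0 by rewrite mulf_neq0.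
have tf0 : tofrac f != 0 :> E by rewrite tofrac_eq0.
have tH0 : tofrac H != 0 :> E by rewrite tofrac_eq0.
have psifH : psi0 (f * H) != 0 by rewrite rmorphM mulf_neq0.
have [psi psiP] := localization_hom (@tofrac_inj _) psifH.
pose Pl (y : E) := exists p, y = tofrac p.
have hPl : subring_set Pl by apply: range_subring.
pose T := localization Pl (tofrac (f * H)).
have hT : subring_set T by apply: localization_subring; rewrite //; exists (f * H).
have TP y : is_localized (f * H) y <-> T y by apply: is_localizedE.
have Tp p : T (tofrac p) by apply: localization_sub; exists p.
have TVf : T (tofrac f)^-1.
  by rewrite /T tofracM; apply: localization_invl => //; exists H.
have TVH : T (tofrac H)^-1.
  by rewrite /T tofracM [_ * tofrac H]mulrC; apply: localization_invl => //; exists f.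
have Ta a : T (phi0 (tofrac a)).
  have [p [e [-> _]]] := retr a; rewrite -exprVn.
  by apply: subringM => //; apply: subringX.
have TVphih : T (phi0 (tofrac h))^-1.
  rewrite phih invf_div; by apply: subringM => //; apply: subringX.
have SE x : S x -> exists a e, x = tofrac a / tofrac h ^+ e.
  by move=> [e [a ea]]; exists a, e; rewrite -ea mulfK ?expf_neq0.
have STphi x : S x -> T (phi0 x).
  move=> /SE[a [e ->]]; rewrite fmorph_div rmorphXn -exprVn.
  by apply: subringM => //; apply: subringX.
have TE y : T y -> exists p e, y = tofrac p / tofrac (f * H) ^+ e by move/TP.
have SpsiT y : T y -> S (psi y).
  move=> /TE[p [e ->]]; rewrite psiP -exprVn; apply: subringM => //; apply: subringX => //.
  have -> : psi0 (f * H) = tofrac h * psi0 f ^+ eh.+1.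
    by rewrite rmorphM -psih exprSr mulrA mulfVK ?expf_neq0 // mulrC.
  rewrite invfM -exprVn; apply: subringM => //; exact: subringX.
have psiM x y : T x -> T y -> psi (x * y) = psi x * psi y.
  move=> /TE[p [e ->]] /TE[q [e' ->]].
  by rewrite mulf_div -tofracM -exprD !psiP mulf_div -rmorphM -exprD.
have psiB x y : T x -> T y -> psi (x - y) = psi x - psi y.
  move=> /TE[p [e ->]] /TE[q [e' ->]].
  have tg0 : tofrac (f * H) != 0 :> E by rewrite tofrac_eq0.
  rewrite !psiP !fraction_sub ?expf_neq0 // -!exprD.
  have -> : tofrac p * tofrac (f * H) ^+ e' - tofrac q * tofrac (f * H) ^+ e =
      tofrac (p * (f * H) ^+ e' - q * (f * H) ^+ e) :> E.
    by rewrite tofracB !tofracM !tofracXn tofracM.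
  by rewrite psiP rmorphB !(rmorphM, rmorphXn).
have psi_const c : psi (tofrac (cst c)) = funconst iota c.
  have -> : tofrac (cst c) = tofrac (cst c) / tofrac (f * H) ^+ 0 by rewrite expr0 divr1.
  by rewrite psiP expr0 divr1 psi0C.
have psi_a a : psi (phi0 (tofrac a)) = tofrac a.
  have [p [e [-> <-]]] := retr a.
  have -> : tofrac p / tofrac f ^+ e = tofrac (p * H ^+ e) / tofrac (f * H) ^+ e :> E.
    by rewrite !tofracM tofracXn; apply: fraction_scale.
  by rewrite psiP !rmorphM rmorphXn; apply/esym/fraction_scale.
exists S; split=> //.
- by move=> c; apply: SA; exists (iota c).
- move=> x; have [a [b [b0 ->]]] := fraction_numden x; exists (tofrac a), (tofrac b).
  by rewrite tofrac_eq0; split=> //; apply: SA; [exists a | exists b].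
exists (f * H), psi; split=> //.
- split=> [x /STphi/TP|||] //; first by rewrite rmorph1.
    by move=> x y _ _; rewrite rmorphB.
  by move=> x y _ _; rewrite rmorphM.
- split=> //; split=> [y /TP/SpsiT||x y /TP Tx /TP Ty|x y /TP Tx /TP Ty] //.
  + by have := psi_const 1; rewrite /funconst !rmorph1.
  + exact: psiB.
  exact: psiM.
move=> x /SE[a [e ->]].
have the0 : tofrac h ^+ e != 0 :> K by rewrite expf_neq0.
apply: (mulIf the0); rewrite mulfVK //.
transitivity (psi (phi0 (tofrac a / tofrac h ^+ e)) * psi (phi0 (tofrac (h ^+ e)))).
  by rewrite psi_a tofracXn.
rewrite -psiM //; last first.
  by apply: STphi; apply: subringM; rewrite // -?exprVn; [apply: SA; exists a | apply: subringX].
by rewrite -rmorphM tofracXn mulfVK // psi_a.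
Qed.
End Criterion.

(** It is enough to have field-theoretic data: a homomorphism phi0 from the function
field of the variety to k(x), whose values on R have powers of f as denominators, and
a homomorphism psi0 on polynomials that retracts it. *)
Theorem retract_rational_criterion (k : fieldType) (R : idomainType) (iota : {rmorphism k -> R})
    d (f : {mpoly k[d]}) (psi0 : {rmorphism {mpoly k[d]} -> {fraction R}})
    (phi0 : {rmorphism {fraction R} -> {fraction {mpoly k[d]}}}) :
  (forall c, psi0 c%:MP = funconst iota c) ->
  (forall c, phi0 (funconst iota c) = ratconst d c) ->
  psi0 f != 0 ->
  (forall a : R, exists p e,
    phi0 (tofrac a) = tofrac p / tofrac f ^+ e /\ psi0 p / psi0 f ^+ e = tofrac a) ->
  retract_rational iota.
Proof.
move=> psi0C phi0C psi0f retr.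
have [|S [hS Sc SK [g [psi [g0 hphi [hpsi psic] ret]]]]] :=
  @retract_data k R iota {mpoly k[d]} (@mpolyC d k) f psi0 phi0 psi0C _ psi0f retr.
  exists [seq psi0 'X_j | j <- enum 'I_d] => S hS Sc Ss p.
  rewrite [p]mpolyE rmorph_sum; apply: subring_sum => // m _.
  rewrite -mul_mpolyC rmorphM psi0C; apply: subringM => //.
  rewrite mpolyXE_id rmorph_prod; apply: subring_prod => // j _.
  rewrite rmorphXn; apply: subringX => //; apply: Ss.
  by apply/mapP; exists j; rewrite ?mem_enum.
exists S; split=> //; exists d, g, phi0, psi; split=> //.
Qed.

(** * A torus whose lattice is monomially split off Z[G] *)

Section MonomialEvaluation.
Variables (Om : fieldType) (m : nat) (t : 'I_m -> Om).
Hypothesis t0 : forall j, t j != 0.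

Definition monomial_eval (v : 'rV[int]_m) : Om := \prod_j t j ^ v 0 j.

Lemma monomial_eval0 : monomial_eval 0 = 1.
Proof. by rewrite /monomial_eval big1 // => j _; rewrite mxE expr0z. Qed.

Lemma monomial_evalD v w : monomial_eval (v + w) = monomial_eval v * monomial_eval w.
Proof. by rewrite /monomial_eval -big_split; apply: eq_bigr => j _; rewrite mxE expfzDr. Qed.

Lemma monomial_eval_neq0 v : monomial_eval v != 0.
Proof. by apply/prodf_neq0 => j _; apply: expfz_neq0. Qed.

Lemma monomial_evalX v e : monomial_eval (v *+ e) = monomial_eval v ^+ e.
Proof.
by elim: e => [|e IH]; rewrite ?mulr0n ?monomial_eval0 ?expr0 // mulrS monomial_evalD IH exprS.
Qed.

Lemma monomial_evalM n (i : 'M[int]_(n, m)) v :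
  monomial_eval (v *m i) = \prod_l monomial_eval (row l i) ^ v 0 l.
Proof.
rewrite mulmx_sum_row (big_morph _ monomial_evalD monomial_eval0).
apply: eq_bigr => l _.
rewrite /monomial_eval (big_morph (fun x => x ^ _) (fun x y => expfzMl x y _) (exp1rz _ _)).
by apply: eq_bigr => j _; rewrite mxE mulrC exprz_exp.
Qed.
End MonomialEvaluation.

Lemma quotient_eq (D : fieldType) (x y t : D) : t != 0 -> x * t = y -> y / t = x.
Proof. by move=> t0 <-; rewrite mulfK. Qed.

Section RegularEmbedding.
Variables (k : fieldType) (L : splittingFieldType k).
Variables (gT : finGroupType) (G : {group gT}).
Variable phi : {morphism G >-> gal_of {:L}}.
Hypothesis galL : galois 1%AS {:L}.
Hypothesis isoG : isom G 'Gal({:L} / 1%AS) phi.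
Variables (n : nat) (M : mx_representation int G n).
Local Notation F n := {fraction {mpoly L[n]}}.
Local Notation K := {fraction (torus_ring phi M)}.
Local Notation N := #|G|.
Variable rho : gT -> {rmorphism F n -> F n}.
Hypothesis rhoP : torus_action phi M rho.
Hypothesis rho1 : forall x, rho 1%g x = x.

(** The fixed field of G in L(M) is the fraction field of the invariant Laurent
polynomials, since denominators can be made invariant by the norm. *)
Lemma torus_fixed_field (valK : {rmorphism K -> F n}) :
  (forall a, valK (tofrac a) = val a) ->
  forall x, (forall g, g \in G -> rho g x = x) -> exists y, valK y = x.
Proof.
move=> valKE x fx.
have rA : {in G, forall g y, is_laurent y -> is_laurent (rho g y)}.
  by move=> g Gg y; apply: (is_laurent_rho rhoP Gg).
have [h [Ah h0 rh xh]] := invariant_denominator rho1 (torus_actionM rhoP) [:: x]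
  (@is_laurent_subring k L n) rA (@is_laurent_full k L n).
have hT : h \in torus_pred phi M by apply/(torus_pred_fixed rhoP).
have xT : x * h \in torus_pred phi M.
  apply/(torus_pred_fixed rhoP); split; first by apply: xh; rewrite inE eqxx.
  by move=> g Gg; rewrite rmorphM fx // rh.
exists (tofrac (TorusRing xT) / tofrac (TorusRing hT)).
by rewrite fmorph_div !valKE /= mulfK.
Qed.

Section LinearForms.
Variables (d : nat) (w c : 'I_d -> L).
Hypothesis wc : forall g, g \in G -> \sum_j c j * sigma phi g (w j) = (g == 1%g)%:R.
Hypothesis cw : forall i j, \sum_(g in G) sigma phi g (w i) * sigma phi g (c j) = (i == j)%:R.

(** Galois descent for the torus of Z[G]: the variables X_g are permuted like the
conjugates of an element of L, and the forms Y_j = sum_g g(w_j) X_g have coefficients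
that make a base change over L and are fixed by the semilinear action. So the
invariants of L[X_g] are the polynomials over k in the Y_j. *)
Lemma linear_forms : exists (E : {rmorphism {mpoly L[d]} -> {mpoly L[N]}}),
  [/\ forall a, E a%:MP = a%:MP,
      forall j, E 'X_j = \sum_(i < N) sigma phi (enum_val i) (w j) *: 'X_i
    & bijective E].
Proof.
have [E [EC EX]] : exists E : {rmorphism {mpoly L[d]} -> {mpoly L[N]}},
    (forall a, E a%:MP = a%:MP) /\
    (forall j, E 'X_j = \sum_(i < N) sigma phi (enum_val i) (w j) *: 'X_i).
  exists (mmap (@mpolyC N L) (fun j => \sum_(i < N) sigma phi (enum_val i) (w j) *: 'X_i)).
  by split=> [a|j] /=; rewrite ?mmapC ?mmapX ?mmap1U.
have [E' [EC' EX']] : exists E' : {rmorphism {mpoly L[N]} -> {mpoly L[d]}},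
    (forall a, E' a%:MP = a%:MP) /\
    (forall i, E' 'X_i = \sum_(j < d) sigma phi (enum_val i) (c j) *: 'X_j).
  exists (mmap (@mpolyC d L) (fun i => \sum_(j < d) sigma phi (enum_val i) (c j) *: 'X_j)).
  by split=> [a|j] /=; rewrite ?mmapC ?mmapX ?mmap1U.
exists E; split=> //; exists E' => p.
  apply: (mpoly_rmorph_ext (f := E' \o E) (g := idfun)) => [a|j] /=; first by rewrite EC EC'.
  rewrite EX rmorph_sum.
  under eq_bigr => i _ do rewrite -mul_mpolyC rmorphM EC' EX' mul_mpolyC scaler_sumr.
  rewrite exchange_big /=.
  under eq_bigr => l _ do (under eq_bigr => i _ do rewrite scalerA; rewrite -scaler_suml).
  have cw' l : \sum_(i < N) sigma phi (enum_val i) (w j) * sigma phi (enum_val i) (c l) =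
      (j == l)%:R by rewrite -cw [RHS]big_enum_val.
  rewrite (bigD1 j) //= cw' eqxx scale1r big1 ?addr0 // => l lj.
  by rewrite cw' eq_sym (negPf lj) scale0r.
apply: (mpoly_rmorph_ext (f := E \o E') (g := idfun)) => [a|i] /=; first by rewrite EC' EC.
have key h g : h \in G -> g \in G ->
    \sum_j sigma phi h (c j) * sigma phi g (w j) = (g == h)%:R.
  move=> Gh Gg; transitivity (sigma phi h (\sum_j c j * sigma phi (g * h^-1)%g (w j))).
    rewrite rmorph_sum; apply: eq_bigr => j _; rewrite rmorphM; congr (_ * _).
    by rewrite -sigmaM ?groupM ?groupV // mulgKV.
  by rewrite wc ?groupM ?groupV // rmorph_nat -eq_mulgV1.
rewrite EX' rmorph_sum.
under eq_bigr => j _ do rewrite -mul_mpolyC rmorphM EC EX mul_mpolyC scaler_sumr.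
rewrite exchange_big /=.
under eq_bigr => l _ do (under eq_bigr => j _ do rewrite scalerA; rewrite -scaler_suml).
rewrite (bigD1 i) //= key ?enum_valP // eqxx scale1r big1 ?addr0 // => l li.
by rewrite key ?enum_valP // (inj_eq enum_val_inj) (negPf li) scale0r.
Qed.
End LinearForms.

Variables (i : 'M[int]_(n, N)) (u : F n).
Hypothesis i_equiv : equivariant M (regular_repr int G) i.
Hypothesis i_inj : forall v : 'rV[int]_n, v *m i = 0 -> v = 0.
Hypothesis u0 : u != 0.
Hypothesis u_mon : forall l,
  \prod_(j < N) rho (enum_val j) u ^ i l j = char_mon L (delta_mx 0 l).

(** The extension to Z[G] of the characters of M, with values in L(M)^*: it sends the
basis element g to the conjugate of u by g. *)
Definition ev : 'rV[int]_N -> F n := monomial_eval (fun j : 'I_N => rho (enum_val j) u).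

Lemma conjugate_neq0 (j : 'I_N) : rho (enum_val j) u != 0.
Proof. by rewrite fmorph_eq0. Qed.

Lemma ev_embedding v : ev (v *m i) = char_mon L v.
Proof.
rewrite /ev (monomial_evalM conjugate_neq0).
rewrite {2}[v]matrix_sum_delta big_ord1 char_mon_sum; apply: eq_bigr => l _.
rewrite -char_monZ -u_mon; congr (_ ^ _).
by apply: eq_bigr => j _; rewrite mxE.
Qed.

Lemma ev_neq0 v : ev v != 0.
Proof. exact: (monomial_eval_neq0 conjugate_neq0 v). Qed.

Lemma ev_shift v w e : ev (v *m i + w *+ e) = char_mon L v * ev w ^+ e.
Proof.
rewrite -ev_embedding; have := monomial_evalX conjugate_neq0 w e.
by move=> <-; apply: (monomial_evalD conjugate_neq0).
Qed.

(** The substitution of the conjugates of u for the variables X_g is a left inverse of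
the embedding of Laurent polynomials given by i. It is applied to x times a monomial,
because only polynomials can be evaluated by Psi. *)
Lemma evaluation_retraction (Phi : {rmorphism F n -> F N})
    (Psi : {rmorphism {mpoly L[N]} -> F n}) x p e :
  (forall a, Phi (lconst n a) = lconst N a) ->
  (forall v, Phi (char_mon L v) = char_mon L (v *m i)) ->
  (forall a, Psi a%:MP = lconst n a) ->
  (forall j, Psi 'X_j = rho (enum_val j) u) ->
  is_laurent x -> Phi x * char_mon L (const_mx 1) ^+ e = tofrac p ->
  x * ev (const_mx 1) ^+ e = Psi p.
Proof.
move=> PC PX PsC PsX [a ->].
pose c1 : 'rV[int]_N := const_mx 1 *+ e.
pose a1 : {malg L['rV[int]_N]} :=
  \sum_(v <- monalg.msupp a) << monalg.mcoeff v a *g v *m i + c1 >>.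
pose a2 : {malg L['rV[int]_N]} := \sum_(m <- msupp p) << p@_m *g mnm_row m >>.
have e1 : Phi (laurent a) * char_mon L (const_mx 1) ^+ e = laurent a1.
  rewrite laurentE rmorph_sum mulr_suml raddf_sum; apply: eq_bigr => v _ /=.
  by rewrite rmorphM PC PX laurentU char_monD char_monX mulrA.
have e2 : tofrac p = laurent a2.
  rewrite lconst_char_mon_mnm raddf_sum; apply: eq_bigr => m _ /=.
  by rewrite laurentU.
rewrite e1 e2 => /laurent_inj e12.
pose PsiM (b : {malg L['rV[int]_N]}) : F n := monalg.mmap (@lconst k L n) ev b.
have PsiMD b b' : PsiM (b + b') = PsiM b + PsiM b' by apply: raddfD.
have PsiM0 : PsiM 0 = 0 by apply: raddf0.
have PsiMU b v : PsiM << b *g v >> = lconst n b * ev v by apply: mmapU.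
have -> : laurent a * ev (const_mx 1) ^+ e = PsiM a1.
  rewrite /a1 (big_morph PsiM PsiMD PsiM0) laurentE mulr_suml.
  apply: eq_bigr => v _; by rewrite PsiMU ev_shift mulrA.
have -> : Psi p = \sum_(m <- msupp p) lconst n p@_m * Psi 'X_[m].
  rewrite {1}[p]mpolyE rmorph_sum; apply: eq_bigr => m _.
  by rewrite -mul_mpolyC rmorphM PsC.
rewrite e12 /a2 (big_morph PsiM PsiMD PsiM0); apply: eq_bigr => m _.
rewrite PsiMU mpolyXE_id rmorph_prod; congr (_ * _); apply: eq_bigr => j _.
by rewrite mxE rmorphXn PsX.
Qed.

Lemma regular_action (g : gT) (h : gT) : g \in G -> h \in G ->
  delta_mx 0 (gring_index G h) *m regular_repr int G g =
    delta_mx 0 (gring_index G (h * g)%g) :> 'rV[int]_N.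
Proof. by move=> Gg Gh; rewrite -rowE /= rowK gring_indexK. Qed.

(** An equivariant embedding i of M in Z[G] is a homomorphism of tori from R, the Weil
restriction of G_m from L to k, to the torus T of M. The element u gives a
homomorphism from Z[G] to L(M)^* that restricts to the characters on M, that is, a
rational section of it. As R is an open subset of the affine space with coordinates
Y_j, complement of the zeros of the norm form f, this makes T a rational retract of an
affine space. *)
Theorem retract_rational_regular : retract_rational (torus_const phi M).
Proof.
have [d [w [c [wc cw]]]] := dual_basis isoG.
have [E [EC EX E_bij]] := linear_forms wc cw.
have E_inj := bij_inj E_bij.
have [rhoX [rhoXP _]] := torus_action_exists phi (regular_repr int G).
have [Phi [PhiC PhiX]] : exists Phi : {rmorphism F n -> F N},
    (forall a, Phi (lconst n a) = lconst N a) /\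
    (forall v, Phi (char_mon L v) = char_mon L (v *m i)).
  exact: (@monomial_map _ L n N idfun i).
have rhoPhi g x : g \in G -> rhoX g (Phi x) = Phi (rho g x).
  move=> Gg; have [rC rX] := rhoP Gg; have [xC xX] := rhoXP _ Gg.
  apply: (laurent_rmorph_ext (f := rhoX g \o Phi) (g := Phi \o rho g)) => [a|l] /=.
    by rewrite PhiC xC rC PhiC.
  by rewrite PhiX xX rX PhiX -!mulmxA i_equiv.
have [Psi [PsiC PsiX]] : exists Psi : {rmorphism {mpoly L[N]} -> F n},
    (forall a, Psi a%:MP = lconst n a) /\ (forall j, Psi 'X_j = rho (enum_val j) u).
  exists (mmap (@lconst k L n) (fun j => rho (enum_val j) u)).
  by split=> [a|j] /=; rewrite ?mmapC ?mmapX ?mmap1U.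
have [valK valKE] := fraction_lift (@val_inj _ _ (torus_ring phi M)).
pose inA := in_alg L.
pose kappa (p : {mpoly k[d]}) := E (map_mpoly inA p).
have EY j : E 'X_j = \sum_(g in G) sigma phi g (w j) *: 'X_(gring_index G g).
  rewrite EX [RHS]big_enum_val; apply: eq_bigr => l _; congr (_ *: 'X__).
  by apply: enum_val_inj; rewrite gring_indexK // enum_valP.
have tofracEY j : tofrac (E 'X_j) =
    \sum_(g in G) lconst N (sigma phi g (w j)) * char_mon L (delta_mx 0 (gring_index G g)).
  rewrite EY rmorph_sum; apply: eq_bigr => g _ /=.
  by rewrite -mul_mpolyC tofracM char_mon_delta.
have rhoE g q : g \in G -> rhoX g (tofrac (E q)) = tofrac (E (map_mpoly (sigma phi g) q)).
  move=> Gg; have [xC xX] := rhoXP _ Gg.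
  apply: (mpoly_rmorph_ext (f := rhoX g \o @tofrac _ \o E)
    (g := @tofrac _ \o E \o map_mpoly (sigma phi g))) => [a|j] /=.
    by rewrite map_mpolyC !EC; apply: xC.
  rewrite map_mpolyX tofracEY rmorph_sum [RHS](reindex_inj (mulIg g)) /=.
  apply: eq_big => h; first by rewrite groupMr.
  by move=> Gh; rewrite rmorphM xC xX regular_action // -sigmaM.
(* Invariant polynomials in the X_g are polynomials over k in the Y_j. *)
have invariants p : (forall g, g \in G -> rhoX g (tofrac p) = tofrac p) ->
    exists q, p = kappa q.
  have [E' E'K EK'] := E_bij; move=> fp.
  have [g Gg|q eq] := @map_mpoly_fixed _ _ _ _ _ galL isoG d (E' p).
    apply: E_inj; apply: (@tofrac_inj {mpoly L[N]}).
    by rewrite -rhoE // EK' fp.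
  by exists q; rewrite /kappa -eq EK'.
have kappa_inj : injective kappa.
  apply: inj_comp E_inj _ => p q /mpolyP e; apply/mpolyP => m; apply: (fmorph_inj inA).
  by have := e m; rewrite !mcoeff_map_mpoly.
pose kap : {rmorphism {mpoly k[d]} -> F N} := @tofrac _ \o E \o map_mpoly inA.
have kapE p : kap p = tofrac (kappa p) by [].
have kap_inj : injective kap by move=> p q; rewrite !kapE => /tofrac_inj/kappa_inj.
have [kF kFE] := fraction_lift kap_inj.
have [PhiK PhiKE] := fraction_lift (inj_comp (fmorph_inj Phi) (@val_inj _ _ (torus_ring phi M))).
pose X := \prod_(j < N) ('X_j : {mpoly L[N]}).
have XE : tofrac X = char_mon L (const_mx 1).
  by rewrite rmorph_prod; apply: eq_bigr => j _; rewrite mxE expr1z.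
have PsiXE : Psi X = ev (const_mx 1).
  by rewrite rmorph_prod; apply: eq_bigr => j _; rewrite mxE expr1z PsiX.
have rhoX1 g : g \in G -> rhoX g (char_mon L (const_mx 1)) = char_mon L (const_mx 1).
  move=> Gg; have [_ xX] := rhoXP _ Gg; rewrite xX; congr char_mon.
  have -> : const_mx 1 = \sum_(h in G) delta_mx 0 (gring_index G h) :> 'rV[int]_N.
    rewrite big_enum_val; apply/rowP => j; rewrite mxE summxE (bigD1 j) //=.
    have idx (l : 'I_N) : gring_index G (enum_val l) = l.
      by apply: enum_val_inj; rewrite gring_indexK // enum_valP.
    rewrite idx mxE !eqxx big1 ?addr0 // => l lj.
    by rewrite idx mxE [j == l]eq_sym (negPf lj) andbF.
  rewrite mulmx_suml [RHS](reindex_inj (mulIg g)) /=.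
  by apply: eq_big => h; [rewrite groupMr | move=> Gh; rewrite regular_action].
(* The norm form: the product of the variables X_g. *)
have [f ef] : exists f, X = kappa f by apply: invariants => g Gg; rewrite XE rhoX1.
have f0 : tofrac f != 0 :> {fraction {mpoly k[d]}}.
  rewrite -(fmorph_eq0 kF) kFE kapE -ef XE; exact: char_mon_neq0.
have image (a : torus_ring phi M) : exists p e,
    Phi (val a) * char_mon L (const_mx 1) ^+ e = tofrac (kappa p).
  have /torus_pred_fixed-/(_ _ rhoP)[la fa] := valP a.
  have /is_laurentE[e [q eq]] : is_laurent (Phi (val a)).
    have [b ->] := la; rewrite (rmorph_laurent (s := idfun) b PhiC PhiX); by eexists.
  have [|p ep] := invariants q.
    move=> g Gg; rewrite -eq rmorphM rmorphXn rhoX1 // rhoPhi // fa //.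
  by exists p, e; rewrite eq ep.
have kF_image a p e : Phi (val a) * char_mon L (const_mx 1) ^+ e = tofrac (kappa p) ->
    kF (tofrac p / tofrac f ^+ e) = PhiK (tofrac a).
  move=> epe; rewrite fmorph_div rmorphXn !kFE !kapE -ef XE -epe PhiKE.
  by apply: quotient_eq => //; exact/expf_neq0/char_mon_neq0.
have [phi0 phi0E] : exists phi0 : {rmorphism K -> {fraction {mpoly k[d]}}},
    forall x, kF (phi0 x) = PhiK x.
  apply: rmorph_factor => x; have [a [b [b0 ->]]] := fraction_numden x.
  have [p [e /kF_image ep]] := image a; have [q [e' /kF_image eq]] := image b.
  by exists (tofrac p / tofrac f ^+ e / (tofrac q / tofrac f ^+ e')); rewrite !(fmorph_div kF) -!(fmorph_div kF) fmorph_div ep eq fmorph_div.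
(* The values at the conjugates of u of the forms Y_j are the traces of the w_j u,
   which lie in the function field of the torus. *)
have /choice[y yP] : forall j, exists y, valK y = Psi (kappa 'X_j).
  move=> j; apply: (torus_fixed_field valKE) => g Gg.
  have -> : Psi (kappa 'X_j) = \sum_(h in G) rho h (lconst n (w j) * u).
    rewrite /kappa map_mpolyX EX rmorph_sum [RHS]big_enum_val; apply: eq_bigr => l _.
    have [rC _] := rhoP (enum_valP l).
    by rewrite -mul_mpolyC rmorphM PsiC PsiX rmorphM rC.
  exact: (trace_invariant rhoP).
have [psi0 [psi0C psi0X]] : exists psi0 : {rmorphism {mpoly k[d]} -> K},
    (forall a, psi0 a%:MP = funconst (torus_const phi M) a) /\ (forall j, psi0 'X_j = y j).
  exists (mmap (@tofrac _ \o torus_const phi M) y).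
  by split=> [a|j] /=; rewrite ?mmapC ?mmapX ?mmap1U.
have psi0E p : valK (psi0 p) = Psi (kappa p).
  apply: (mpoly_rmorph_ext (f := valK \o psi0)
    (g := Psi \o E \o map_mpoly inA)) => [a|j] /=.
    by rewrite psi0C map_mpolyC EC PsiC valKE.
  by rewrite psi0X yP /kappa map_mpolyX.
have psi0f : psi0 f != 0.
  rewrite -(fmorph_eq0 valK) psi0E -ef PsiXE; exact: ev_neq0.
apply: (@retract_rational_criterion _ _ _ d f psi0 phi0) => // [a|a].
  apply: (fmorph_inj kF); rewrite phi0E PhiKE /= PhiC /ratconst kFE kapE /kappa.
  by rewrite map_mpolyC EC.
have [p [e ep]] := image a; exists p, e; split.
  by apply: (fmorph_inj kF); rewrite phi0E (kF_image a).
apply: (fmorph_inj valK); rewrite fmorph_div rmorphXn !psi0E -ef PsiXE valKE.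
have /torus_pred_fixed-/(_ _ rhoP)[la fa] := valP a.
apply: quotient_eq; first exact/expf_neq0/ev_neq0.
exact: evaluation_retraction PhiC PhiX PsiC PsiX la ep.
Qed.

End RegularEmbedding.

(** * An explicit section *)

Section ExplicitUnit.

(** The multiplicative form of the equation beta2 (1 - A^4) = i(a): 1 + t and its
conjugate 1 + t^-1 differ by the factor t. *)
Lemma half_orbit (D : fieldType) (t : D) (e : int) : t != 0 -> 1 + t != 0 ->
  (1 + t) ^ e * (1 + t^-1) ^ (- e) = t ^ e.
Proof.
move=> t0 t1; have -> : 1 + t^-1 = (1 + t) / t by rewrite mulrDl mul1r divff // addrC.
have V : ((1 + t) / t) ^ (- e) = (1 + t) ^ (- e) * t ^ e.
  by rewrite expfzMl exprz_inv opprK.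
by rewrite V mulrA -expfzDr // subrr expr0z mul1r.
Qed.

(** The multiplicative form of the equation beta3 (1 - C) = i(b): the conjugates of W
= 1 + p + t^-1 under C are W / p and W / (p s). The powers of W cancel because the
exponents add up to 0. *)
Lemma third_orbit (D : fieldType) (p s t : D) (e0 e1 e2 : int) :
  p != 0 -> s != 0 -> t = (p * s)^-1 -> 1 + p + t^-1 != 0 -> e0 + e1 + e2 = 0 ->
  (1 + p + t^-1) ^ e0 * (1 + s + p^-1) ^ e1 * (1 + t + s^-1) ^ e2 = p ^ (- e1) * t ^ e2.
Proof.
move=> p0 s0 -> ; rewrite invrK => W0 e.
have -> : 1 + s + p^-1 = (1 + p + p * s) * p^-1 by field.
have -> : 1 + (p * s)^-1 + s^-1 = (1 + p + p * s) * (p * s)^-1 by field; rewrite ?p0 ?s0.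
set W := 1 + p + p * s in W0 *.
transitivity (W ^ e0 * W ^ e1 * W ^ e2 * (p ^ (- e1) * (p * s)^-1 ^ e2)).
  by rewrite [(W * p^-1) ^ _]expfzMl [(W * _) ^ e2]expfzMl !exprz_inv; ring.
by rewrite -!expfzDr // e expr0z mul1r.
Qed.

Definition nth_elt (x : nat) : G_4_33_2_1 := (gC ^+ (x %/ 8) * gA ^+ (x %% 8))%g.

Lemma nth_elt_check : all (fun x => nth_rows x == rows_mul (iter (x %/ 8) (rows_mul rowsC) rows1)
  (iter (x %% 8) (rows_mul rowsA) rows1)) (iota 0 24).
Proof. by vm_compute. Qed.

Lemma nth_elt_val x : (x < 24)%N -> G_mx (nth_elt x) = mx_rows (nth_rows x).
Proof.
move=> x24; have /allP/(_ x) := nth_elt_check; rewrite mem_iota => /(_ x24)/eqP ->.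
by rewrite G_valM (G_valX _ gC_val) (G_valX _ gA_val) -mx_rowsM.
Qed.

Lemma nth_eltK x : (x < 24)%N -> elt_index (nth_elt x) = x.
Proof. by move=> x24; apply: elt_index_uniq => //; apply: nth_elt_val. Qed.

Lemma elt_index_inj : injective elt_index.
Proof.
by move=> g h e; apply: val_inj; have [_ /= ->] := elt_indexP g; have [_ /= ->] := elt_indexP h; rewrite e.
Qed.

Lemma elt_indexK g : nth_elt (elt_index g) = g.
Proof. by apply: elt_index_inj; rewrite nth_eltK //; have [] := elt_indexP g. Qed.

Lemma nth_eltV x : (x < 24)%N -> (nth_elt x)^-1%g = nth_elt (inv_index x).
Proof.
move=> x24; have /allP/(_ x) := inv_indexP; rewrite mem_iota => /(_ x24)/and3P[ix /eqP e _].
apply/eqP; rewrite eq_sym eq_mulgV1 invgK; apply/eqP/elt_index_inj.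
by rewrite elt_indexM !nth_eltK // e elt_index1.
Qed.

Lemma big_nth_elt (D : comNzRingType) (f : G_4_33_2_1 -> D) :
  \prod_(g in [set: G_4_33_2_1]) f g = \prod_(x <- iota 0 24) f (nth_elt x).
Proof.
rewrite -(big_map nth_elt predT f) -big_enum; apply: perm_big.
apply: uniq_perm; first exact: enum_uniq.
  rewrite map_inj_in_uniq ?iota_uniq // => x y; rewrite !mem_iota => x24 y24 e.
  by rewrite -(nth_eltK x24) e nth_eltK.
move=> g; rewrite mem_enum inE; apply/esym/mapP; exists (elt_index g); rewrite ?elt_indexK //.
by rewrite mem_iota; have [] := elt_indexP g.
Qed.

(** The row vector s * (C^i A^j) for x = 8 i + j. *)
Definition translate (s : seq int) (x : nat) : seq (seq int) := lmul 1 4 4 [:: s] (nth_rows x).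

(** The vectors a = e_0 - e_3 and b = e_1 used above to split Z[G] / M. *)
Definition sa : seq int := [:: 1; 0; 0; -1].
Definition sb : seq int := [:: 0; 1; 0; 0].
Definition lneg m n s := lbuild m n (fun i j => - lget s i j).

Lemma lmx_neg m n s : lmx m n (lneg m n s) = - lmx m n s.
Proof. by rewrite lmx_build; apply/matrixP => i j; rewrite !mxE. Qed.

(** Representatives of the cosets of <A^4>; x and x + 4 are in the same coset. *)
Definition half_index := [seq (8 * i + j)%N | i <- iota 0 3, j <- iota 0 4].

Lemma half_check : all (fun x => (translate sa (x + 4) == lneg 1 4 (translate sa x)) &&
  all (fun l => lget i_list l (x + 4) == - lget i_list l x) (iota 0 4)) half_index.
Proof. by vm_compute. Qed.

(** The coset of <C> of j < 8 is {j, 8 + j, 16 + j}. With bC^2 = a and b + bC = - a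
these are the relations between the conjugates of a and b in it. *)
Lemma third_check : all (fun j =>
  [&& translate sa j == lneg 1 4 (lsub 1 4 (translate sb j) (lneg 1 4 (translate sb (8 + j)))),
      translate sa (8 + j) == translate sb j,
      translate sb (16 + j) == translate sa j,
      translate sa (16 + j) == translate sb (8 + j) &
  all (fun l => lget i_list l j + lget i_list l (8 + j) + lget i_list l (16 + j) == 0) (iota 0 4)])
  (iota 0 8).
Proof. by vm_compute. Qed.

Lemma lmx_translate s x : (x < 24)%N ->
  lmx 1 4 (translate s x) = lmx 1 4 [:: s] *m G_mx (nth_elt x).
Proof. by move=> x24; rewrite lmx_mul nth_elt_val. Qed.

Definition lcomb (r : seq nat) (f : nat -> seq (seq int)) (e : nat -> int) :=
  lbuild 1 4 (fun i j => foldr (fun x s => e x * lget (f x) i j + s) 0 r).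

Lemma lmx_lcomb r f e : lmx 1 4 (lcomb r f e) = \sum_(x <- r) e x *: lmx 1 4 (f x).
Proof.
rewrite lmx_build; apply/matrixP => i j; rewrite summxE mxE.
by elim: r => [|x r IH]; rewrite ?big_nil ?big_cons //= IH !mxE.
Qed.

(** The identity 3 e_l - 2 e_l = e_l, with the left hand side expressed as the sum of
the contributions of the half orbits and of the third orbits. *)
Lemma unit_check : all (fun l =>
  [seq lget (lcomb half_index (translate sa) (lget i_list l)) 0 j
     + (lget (lcomb (iota 0 8) (translate sb) (fun x => - lget i_list l (8 + x))) 0 j
     + lget (lcomb (iota 0 8) (translate sa) (fun x => lget i_list l (16 + x))) 0 j) | j <- iota 0 4]
  == [seq (l == j)%:R | j <- iota 0 4]) (iota 0 4).
Proof. by vm_compute. Qed.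

Lemma half_perm : perm_eq (iota 0 24) (half_index ++ [seq (x + 4)%N | x <- half_index]).
Proof. by vm_compute. Qed.

Lemma third_perm : perm_eq (iota 0 24)
  (iota 0 8 ++ [seq (8 + x)%N | x <- iota 0 8] ++ [seq (16 + x)%N | x <- iota 0 8]).
Proof. by vm_compute. Qed.

End ExplicitUnit.

Section Coinduction.
Variables (gT : finGroupType) (G : {group gT}) (n : nat) (M : mx_representation int G n).
Variable c : 'I_n.

(** The equivariant map from M to Z[G] that corresponds by Frobenius reciprocity to
the coordinate c, a linear form on M. *)
Definition orbit_coordinates : 'M[int]_(n, #|G|) :=
  \matrix_(l, j) M (enum_val j)^-1%g l c.

Lemma orbit_coordinates_equivariant : equivariant M (regular_repr int G) orbit_coordinates.
Proof.
move=> g Gg; apply/matrixP => l j; rewrite mxE.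
transitivity (M (g * (enum_val j)^-1)%g l c).
  rewrite repr_mxM ?groupV ?enum_valP // mxE.
  by apply: eq_bigr => e _; rewrite mxE.
pose h := (enum_val j * g^-1)%g.
have Gh : h \in G by rewrite groupM ?groupV ?enum_valP.
rewrite mxE (bigD1 (gring_index G h)) //= big1 ?addr0; last first.
  move=> e eh; rewrite !mxE eqxx /=; case: eqP => [je|_]; last by rewrite mulr0.
  case/eqP: eh; rewrite /h je gring_indexK ?groupM ?enum_valP // mulgK.
  by rewrite gring_valK.
rewrite !mxE gring_indexK // mulgKV gring_valK !eqxx mulr1.
by rewrite invMg invgK.
Qed.

Lemma orbit_coordinates_eq0 (v : 'rV[int]_n) :
  v *m orbit_coordinates = 0 -> forall g, g \in G -> (v *m M g) 0 c = 0.
Proof.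
move=> v0 g Gg; move/rowP/(_ (gring_index G g^-1%g)): v0.
rewrite !mxE => v0; rewrite -[RHS]v0; apply: eq_bigr => l _.
by rewrite mxE gring_indexK ?groupV // invgK.
Qed.
End Coinduction.

(** The translates of the first coordinate by 1, A, A^2 and B are independent. *)
Lemma M_G_cogenerated (v : 'rV[int]_4) :
  (forall g : G_4_33_2_1, (v *m G_mx g) 0 0 = 0) -> v = 0.
Proof.
move=> h; have e0 := h 1%g; have eA := h gA; have eB := h gB; have eAA := h (gA ^+ 2)%g.
rewrite G_val1 mulmx1 in e0.
move: eA eB eAA; rewrite gA_val (G_valX 2 gA_val) [G_mx gB]/(mx_rows rowsB) !mxE.
rewrite !big_ord_recl !big_ord0 !mxE /=.
set v0 := v 0 _; set v1 := v 0 _; set v2 := v 0 _; set v3 := v 0 _.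
move=> eA eB eAA.
have E : [/\ v0 = 0, v1 = 0, v2 = 0 & v3 = 0].
  have e0' : v0 = 0 := e0.
  move: eA eB eAA; vm_compute (nth _ _ _); split; lia.
have [E0 E1 E2 E3] := E.
apply/rowP => j; rewrite !mxE.
by case: j => [[|[|[|[|j]]]] jl] //; [rewrite -[RHS]E0|rewrite -[RHS]E1|rewrite -[RHS]E2|rewrite -[RHS]E3];
  congr (v _ _); apply: val_inj.
Qed.

Section RetractRational.
Variables (k : fieldType) (L : splittingFieldType k).
Variable phi : {morphism [set: G_4_33_2_1] >-> gal_of {:L}}.
Variable rho : G_4_33_2_1 ->
  {rmorphism {fraction {mpoly L[4]}} -> {fraction {mpoly L[4]}}}.
Hypothesis rhoP : torus_action phi M_G rho.

Local Notation zA x := (char_mon L (lmx 1 4 (translate sa x))).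
Local Notation zB x := (char_mon L (lmx 1 4 (translate sb x))).
Local Notation za := (char_mon L (lmx 1 4 [:: sa])).
Local Notation zb := (char_mon L (lmx 1 4 [:: sb])).

Lemma half_factor_neq0 : 1 + za != 0.
Proof.
apply/eqP => e; have : za = lconst 4 (-1).
  by rewrite rmorphN1; apply/eqP; rewrite -addr_eq0 addrC; apply/eqP.
by move/char_mon_lconst/rowP/(_ 0); rewrite !mxE.
Qed.

Lemma third_factor_neq0 : 1 + zb + za^-1 != 0.
Proof.
apply/eqP => e.
pose w (i : 'I_3) : 'rV[int]_4 :=
  lmx 1 4 (nth [::] [:: [:: [:: 0; 0; 0; 0]]; [:: sb]; lneg 1 4 [:: sa]] i).
have w_inj : {in index_enum 'I_3 &, injective w}.
  move=> x y _ _ /rowP exy; apply: val_inj; have := exy 0; have := exy (lift 0 0).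
  rewrite !mxE; case: x {exy} => [[|[|[|x]]] lx]; case: y => [[|[|[|y]]] ly] //.
have/char_mon_independent: uniq (index_enum 'I_3) by exact: index_enum_uniq.
move/(_ k L 4%N w (fun=> 1) w_inj)=> H.
suff /H/(_ 0 (mem_index_enum _))/eqP : \sum_i lconst 4 1 * char_mon L (w i) = 0
  by rewrite oner_eq0.
rewrite !big_ord_recl big_ord0 !rmorph1 !mul1r addr0 addrA -{}[RHS]e.
congr (_ + _ + _); last by rewrite /w /= lmx_neg char_monN.
rewrite -[RHS](char_mon0 L 4); congr char_mon; apply/rowP => j; rewrite !mxE.
by case: j => [[|[|[|[|j]]]] jl].
Qed.

Definition explicit_unit := (1 + za) * (1 + zb + za^-1).

Lemma conjugate_char_mon s x : (x < 24)%N ->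
  rho (nth_elt x) (char_mon L (lmx 1 4 [:: s])) = char_mon L (lmx 1 4 (translate s x)).
Proof. by move=> x24; have [_ ->] := rhoP (in_setT (nth_elt x)); rewrite lmx_translate. Qed.

(** The factor 1 + z^a is grouped over the cosets of <A^4>. *)
Lemma half_orbits l : (l < 4)%N ->
  \prod_(x <- iota 0 24) (1 + zA x) ^ lget i_list l x =
  char_mon L (lmx 1 4 (lcomb half_index (translate sa) (lget i_list l))).
Proof.
move=> l4; rewrite (perm_big _ half_perm) big_cat big_map /= -big_split /=.
rewrite lmx_lcomb char_mon_sum big_seq [RHS]big_seq; apply: eq_bigr => x xh.
have /allP/(_ x xh)/andP[/eqP -> /allP/(_ l)] := half_check.
rewrite mem_iota => /(_ l4)/eqP ->; rewrite lmx_neg char_monN -char_monZ.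
apply: half_orbit; first exact: char_mon_neq0.
have x24 : (x < 24)%N.
  by have := perm_mem half_perm x; rewrite mem_cat xh mem_iota => /andP[].
by rewrite -conjugate_char_mon // -(rmorph1 (rho (nth_elt x))) -rmorphD fmorph_eq0 half_factor_neq0.
Qed.

(** The factor 1 + z^b + z^-a is grouped over the cosets of <C>. *)
Lemma third_orbits l : (l < 4)%N ->
  \prod_(x <- iota 0 24) (1 + zB x + (zA x)^-1) ^ lget i_list l x =
  char_mon L (lmx 1 4 (lcomb (iota 0 8) (translate sb) (fun x => - lget i_list l (8 + x)))) *
  char_mon L (lmx 1 4 (lcomb (iota 0 8) (translate sa) (fun x => lget i_list l (16 + x)))).
Proof.
move=> l4; rewrite !lmx_lcomb !char_mon_sum -big_split.
pose f x := (1 + zB x + (zA x)^-1) ^ lget i_list l x.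
transitivity (\prod_(x <- iota 0 8) (f x * (f (8 + x)%N * f (16 + x)%N))).
  by rewrite (perm_big _ third_perm) !big_cat !big_map !big_split.
rewrite big_seq [RHS]big_seq /f.
apply: eq_bigr => x x8.
have /allP/(_ x x8)/and5P[/eqP e1 /eqP e2 /eqP e3 /eqP e4 /allP/(_ l)] := third_check.
rewrite mem_iota => /(_ l4)/eqP e; rewrite e2 e3 e4 -!char_monZ mulrA.
have x24 : (x < 24)%N by move: x8; rewrite mem_iota; lia.
apply: third_orbit => //; try exact: char_mon_neq0.
  by rewrite e1 lmx_neg lmx_sub lmx_neg opprK char_monN char_monD.
rewrite -!conjugate_char_mon // -(rmorph1 (rho (nth_elt x))) -fmorphV -!rmorphD fmorph_eq0.
exact: third_factor_neq0.
Qed.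

Lemma explicit_unitP (l : 'I_4) :
  \prod_(j < #|[set: G_4_33_2_1]|)
    rho (enum_val j) explicit_unit ^ orbit_coordinates M_G 0 l j =
  char_mon L (delta_mx 0 l).
Proof.
transitivity (\prod_(g in [set: G_4_33_2_1]) rho g explicit_unit ^ G_mx g^-1%g l 0).
  by rewrite [RHS]big_enum_val; apply: eq_bigr => j _; rewrite mxE.
rewrite big_nth_elt.
transitivity (\prod_(x <- iota 0 24)
  ((1 + zA x) ^ lget i_list l x * (1 + zB x + (zA x)^-1) ^ lget i_list l x)).
  rewrite big_seq [RHS]big_seq; apply: eq_bigr => x; rewrite mem_iota => /andP[_ x24].
  rewrite -expfzMl; congr (_ ^ _).
    by rewrite rmorphM !rmorphD rmorph1 fmorphV !conjugate_char_mon.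
  have /allP/(_ x) := inv_indexP; rewrite mem_iota => /(_ x24)/and3P[ix _ _].
  by rewrite nth_eltV // nth_elt_val // mxE lget_build.
rewrite big_split /= half_orbits // third_orbits // -!char_monD; congr char_mon.
have /allP/(_ l) := unit_check; rewrite mem_iota => /(_ (ltn_ord l))/eqP e.
apply/rowP => j; rewrite [RHS]mxE eqxx /= ![in LHS]mxE.
have := congr1 (fun s => nth 0 s j) e.
rewrite !(nth_map 0%N) ?size_iota // !nth_iota // add0n => ->.
by rewrite eq_sym (inj_eq val_inj).
Qed.
End RetractRational.

Theorem M_G_retract_rational (k : fieldType) (L : splittingFieldType k)
    (phi : {morphism [set: G_4_33_2_1] >-> gal_of {:L}}) :
  galois 1%AS {:L} -> isom [set: G_4_33_2_1] 'Gal({:L} / 1%AS) phi ->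
  retract_rational (torus_const phi M_G).
Proof.
move=> galL isoG; have [rho [rhoP rho1]] := torus_action_exists phi M_G.
apply: (retract_rational_regular galL isoG rhoP rho1
  (orbit_coordinates_equivariant M_G 0) _ _ (explicit_unitP rhoP)).
  move=> v /orbit_coordinates_eq0 v0; apply: M_G_cogenerated => g.
  by apply: v0; rewrite inE.
by rewrite mulf_neq0 // ?half_factor_neq0 // third_factor_neq0.
Qed.

Theorem proposition5p21 :
  [/\ quasi_invertible M_G,
      ~ quasi_permutation M_G
    & forall (k : fieldType) (L : splittingFieldType k)
        (phi : {morphism [set: G_4_33_2_1] >-> gal_of {:L}}),
        [pchar k] =i pred0 ->
        galois 1%AS {:L} ->
        isom [set: G_4_33_2_1] 'Gal({:L} / 1%AS) phi ->
        retract_rational (torus_const phi M_G) /\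
        ~ stably_rational (torus_const phi M_G)].
Proof.
split; [exact: M_G_quasi_invertible | exact: M_G_not_quasi_permutation0 |].
move=> k L phi _ galL isoG; split; first exact: M_G_retract_rational.
by move/(stably_rational_quasi_permutation galL isoG) => [m /M_G_not_quasi_permutation].
Qed.
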